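(* The Neumann P\'olya conjecture for the unit disk holds for all $\mu\geq 11.89$; that is, $$\mathscr{N}^{\mathtt{N}}_{\mathcal{B}_1^2}(\mu)\geq\frac{\mu^2}{4}\qquad\text{for all real }\mu\geq 11.89.$$
   Context: $\mathcal{B}_1^2\subset\mathbb{R}^2$ is the unit disk. $\mathscr{N}^{\mathtt{N}}_{\mathcal{B}_1^2}(\mu)$ is the number (counted with multiplicity) of eigenvalues of the Neumann Laplacian $-\Delta$ on the disk that are $\le\mu^2$. For a bounded domain $\mathscr{D}\subset\mathbb{R}^d$ the Neumann P\'olya inequality is $\mathscr{N}^{\mathtt{N}}_{\mathscr{D}}(\mu)\ge\frac{\omega_d}{(2\pi)^d}|\mathscr{D}|\mu^d$ with $\omega_d$ the volume of the unit ball in $\mathbb{R}^d$; for the unit disk the right side is $\mu^2/4$. *)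

(* Defs.v *)
From Stdlib Require Import Reals List.
From Coquelicot Require Import Coquelicot.
Open Scope R_scope.

Definition open_disk (x y : R) : Prop := x ^ 2 + y ^ 2 < 1.
Definition closed_disk (x y : R) : Prop := x ^ 2 + y ^ 2 <= 1.
Definition unit_circle (x y : R) : Prop := x ^ 2 + y ^ 2 = 1.

Definition continuous_on_closed_disk (f : R -> R -> R) : Prop :=
  continuous_on (fun z : R * R => closed_disk (fst z) (snd z))
                (fun z : R * R => f (fst z) (snd z)).

Definition laplacian (u : R -> R -> R) (x y : R) : R :=
  partial_derive 2 0 u x y + partial_derive 0 2 u x y.

(* u is in C^2 of the open disk and C^1 up to the boundary, i.e. u and its
   gradient extend continuously to the closed disk; [p] and [q] are the extended
   partial derivatives.  The outward unit normal at a boundary point (x, y) is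
   (x, y) itself, so the normal derivative of u there is x p + y q.
   Only the values of u on the closed disk matter, and u = 0 is allowed.
   The boundary of the disk being smooth, these classical solutions are exactly
   the elements of ker (-Delta - lambda) for the self-adjoint Neumann Laplacian
   in L^2 (by Green's formula and elliptic regularity). *)
Definition neumann_solution (lambda : R) (u : R -> R -> R) : Prop :=
  (forall x y, open_disk x y -> ex_diff_n u 2 x y) /\
  (forall x y, open_disk x y -> - laplacian u x y = lambda * u x y) /\
  continuous_on_closed_disk u /\
  exists p q : R -> R -> R,
    continuous_on_closed_disk p /\
    continuous_on_closed_disk q /\
    (forall x y, open_disk x y ->
       p x y = partial_derive 1 0 u x y /\ q x y = partial_derive 0 1 u x y) /\
    (forall x y, unit_circle x y -> x * p x y + y * q x y = 0).

Definition neumann_eigenvalue (lambda : R) : Prop :=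
  exists u : R -> R -> R,
    neumann_solution lambda u /\ exists x y, open_disk x y /\ u x y <> 0.

(* Linear independence of f 1, ..., f n as functions on the disk; for n = 0 the
   sum is empty and the condition holds. *)
Definition independent_on_disk (n : nat) (f : nat -> R -> R -> R) : Prop :=
  forall c : nat -> R,
    (forall x y, open_disk x y -> sum_n_m (fun i => c i * f i x y) 1 n = 0) ->
    forall i, (1 <= i <= n)%nat -> c i = 0.

(* The dimension of the eigenspace, as an element of the extended reals. *)
Definition multiplicity (lambda : R) : Rbar :=
  Lub_Rbar (fun r => exists (n : nat) (f : nat -> R -> R -> R),
    r = INR n /\
    (forall i, (1 <= i <= n)%nat -> neumann_solution lambda (f i)) /\
    independent_on_disk n f).

Definition sum_multiplicities (l : list R) : Rbar :=
  fold_right Rbar_plus (Finite 0) (map multiplicity l).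

(* The sum of the multiplicities of all eigenvalues <= mu^2, an unordered sum of
   nonnegative terms and hence the least upper bound of its finite subsums.  It
   is taken in the extended reals because finiteness is not part of the
   definition. *)
Definition neumann_counting (mu : R) : Rbar :=
  Rbar_lub (fun s => exists l : list R,
    NoDup l /\
    (forall lambda, In lambda l ->
       neumann_eigenvalue lambda /\ lambda <= mu ^ 2) /\
    s = sum_multiplicities l).

(* Main.v *)
Require Import Defs.
From Stdlib Require Import Reals List Lra Lia Psatz Factorial Arith Machin.
From Coquelicot Require Import Coquelicot.
Open Scope R_scope.

(** Separation of variables produces Neumann eigenfunctions J_m(j r) cos (m theta) and
J_m(j r) sin (m theta) for the eigenvalue j^2, where J_m'(j) = 0.  They are smooth solutions
and linearly independent, so the counting function at mu is at least the number of such triples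
(m, angular factor, j) with j <= mu (neumann_counting_ge).  It remains to count the critical
points of the Bessel functions from below and to sum over m.

Critical points.  Let f_m(x) = sqrt (x^2 - m^2) - m arccos (m / x) be the WKB phase.  A Picone
identity comparing x J_m' with the WKB approximation shows that J_m' oscillates more slowly than
this approximation: consecutive critical points are at least pi apart in phase
(bessel_critical_spacing).  On the other hand the phase and the index of the critical points are
known at infinity, from the asymptotics of J_m (bessel_asymptotics), Sturm comparison for J_0 and
interlacing.  Going back from infinity, each critical point lies no further out than the WKB
approximation predicts: if f_m(mu) > (n + 1/4) pi, then there are at least n + 1 critical points
in [0, mu], with 0 included when m = 0 (neumann_zero_count).  The phase of J_0 and J_1 at infinity
comes from Poisson's integrals by stationary phase; the constant pi/4 in it reflects the equality of
the two Fresnel integrals over the half-line (fresnel_limit).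

Summation.  Counting by levels n instead of orders m, level n contributes all integers m with
|m| < h_n, where h_n is the order whose phase at mu is (n + 1/4) pi; these are at least
2 h_n - 1 integers.  The points (n + 1/4, h_n) lie on a decreasing convex curve whose area is
mu^2/8, half of the bound to be reached.  Trapezoids overestimate this area, and sampling at
n + 1/4 rather than in the middle of [n, n + 1] gains about mu/2, whereas rounding
loses 1 on each of about mu/pi levels.  The gain wins as soon as mu is not too small; the precise
comparison depends only on the position of the first node and is the elementary inequality
wkb_first_point_bound, whose margin at mu = 11.89 is small. *)

(** * Bessel functions of integer order *)

Definition clifford_coef (m k : nat) : R :=
  (-1) ^ k / (INR (fact k) * INR (fact (k + m))).

(** The Bessel-Clifford function, for which J_m(x) = (x/2)^m C_m(x^2/4).  Taking the
    factor x^m off J_m leaves an entire function of x^2, which is why the eigenfunctions are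
    smooth at the centre of the disk. *)
Definition clifford (m : nat) (s : R) : R := PSeries (clifford_coef m) s.

Lemma clifford_coef_neq_0 m k : clifford_coef m k <> 0.
Proof.
  unfold clifford_coef, Rdiv.
  apply Rmult_integral_contrapositive_currified.
  - apply pow_nonzero; lra.
  - apply Rinv_neq_0_compat, Rmult_integral_contrapositive_currified;
      apply INR_fact_neq_0.
Qed.

Lemma fact_S_INR n : INR (fact (S n)) = (INR n + 1) * INR (fact n).
Proof. change (fact (S n)) with (S n * fact n)%nat; rewrite mult_INR, S_INR; ring. Qed.

Lemma CV_radius_clifford m : CV_radius (clifford_coef m) = p_infty.
Proof.
  apply CV_radius_infinite_DAlembert; [apply clifford_coef_neq_0 |].
  apply is_lim_seq_le_le with (u := fun _ => 0) (w := fun n => / (INR n + 1)).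
  - intro n.
    assert (Hn := pos_INR n). assert (Hm := pos_INR (n + m)).
    assert (Hf := INR_fact_neq_0 n). assert (Hg := INR_fact_neq_0 (n + m)).
    assert (Hs : (-1) ^ n <> 0) by (apply pow_nonzero; lra).
    replace (clifford_coef m (S n) / clifford_coef m n)
      with (- (/ (INR n + 1) * / (INR (n + m) + 1))).
    2: { unfold clifford_coef. change (S n + m)%nat with (S (n + m)).
         rewrite !fact_S_INR. simpl pow. field. repeat split; auto; lra. }
    rewrite Rabs_Ropp, Rabs_pos_eq.
    + split.
      * apply Rmult_le_pos; apply Rlt_le, Rinv_0_lt_compat; lra.
      * rewrite <- (Rmult_1_r (/ (INR n + 1))) at 2.
        apply Rmult_le_compat_l; [apply Rlt_le, Rinv_0_lt_compat; lra |].
        rewrite <- Rinv_1. apply Rinv_le_contravar; lra.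
    + apply Rmult_le_pos; apply Rlt_le, Rinv_0_lt_compat; lra.
  - apply is_lim_seq_const.
  - replace (Finite 0) with (Rbar_inv p_infty) by reflexivity.
    apply is_lim_seq_inv; [| discriminate].
    apply is_lim_seq_ext with (u := fun n => INR (S n)); [intro; apply S_INR |].
    apply (is_lim_seq_incr_1 INR), is_lim_seq_INR.
Qed.

Lemma is_derive_clifford m s : is_derive (clifford m) s (- clifford (S m) s).
Proof.
  replace (- clifford (S m) s) with (PSeries (PS_derive (clifford_coef m)) s).
  - apply is_derive_PSeries. rewrite CV_radius_clifford. exact I.
  - unfold clifford. rewrite <- PSeries_opp. apply PSeries_ext. intro k.
    unfold PS_derive, PS_opp, clifford_coef, opp; simpl opp.
    rewrite S_INR. change (S k + m)%nat with (S (k + m)).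
    replace (k + S m)%nat with (S (k + m)) by lia.
    rewrite !fact_S_INR. simpl pow. simpl.
    assert (Hn := pos_INR k). assert (Hm := pos_INR (k + m)).
    assert (Hf := INR_fact_neq_0 k). assert (Hg := INR_fact_neq_0 (k + m)).
    field. repeat split; auto; lra.
Qed.

Lemma ex_pseries_clifford m s : ex_pseries (clifford_coef m) s.
Proof. apply CV_radius_inside. rewrite CV_radius_clifford. exact I. Qed.

(** The differential equation and the recurrences between Bessel functions of different
    orders all follow from this relation and is_derive_clifford. *)
Lemma clifford_rec m s :
  clifford m s = (INR m + 1) * clifford (S m) s - s * clifford (S (S m)) s.
Proof.
  unfold clifford. rewrite <- PSeries_incr_1, <- PSeries_scal, <- PSeries_minus.
  - apply PSeries_ext. intro k.
    unfold PS_minus, PS_scal, PS_plus, PS_opp, PS_incr_1, clifford_coef, scal, plus, opp, zero; simpl.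
    unfold mult; simpl.
    destruct k as [| k].
    + change (0 + S m)%nat with (S m). rewrite fact_S_INR. simpl.
      assert (Hm := pos_INR m). assert (Hg := INR_fact_neq_0 m). field; split; auto; lra.
    + replace (k + S (S m))%nat with (S (S (k + m))) by lia.
      replace (S k + S m)%nat with (S (S (k + m))) by lia.
      change (S k + m)%nat with (S (k + m)).
      rewrite !fact_S_INR, S_INR, plus_INR. simpl pow.
      assert (Hn := pos_INR k). assert (Hm := pos_INR m).
      assert (Hf := INR_fact_neq_0 k). assert (Hg := INR_fact_neq_0 (k + m)).
      field. repeat split; auto; lra.
  - apply (ex_pseries_scal (INR m + 1)); [apply Rmult_comm | apply ex_pseries_clifford].
  - apply (ex_pseries_incr_1 (clifford_coef (S (S m)))), ex_pseries_clifford.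
Qed.

Lemma clifford_0 m : clifford m 0 = / INR (fact m).
Proof.
  unfold clifford. rewrite PSeries_0. unfold clifford_coef. simpl.
  field. apply INR_fact_neq_0.
Qed.

Lemma clifford_0_pos m : 0 < clifford m 0.
Proof. rewrite clifford_0. apply Rinv_0_lt_compat, INR_fact_lt_0. Qed.

Lemma clifford_continuous m s : continuous (clifford m) s.
Proof. apply (ex_derive_continuous (clifford m)). eexists. apply is_derive_clifford. Qed.

Definition bessel (m : nat) (x : R) : R := (x / 2) ^ m * clifford m (x ^ 2 / 4).

(** This is x J_m'(x).  With D = x d/dx, Bessel's equation becomes the system
    D J_m = w, D w = - (x^2 - m^2) J_m for w = bessel_d m. *)
Definition bessel_d (m : nat) (x : R) : R := INR m * bessel m x - x * bessel (S m) x.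

Lemma bessel_rec m x :
  x * bessel m x = 2 * (INR m + 1) * bessel (S m) x - x * bessel (S (S m)) x.
Proof.
  unfold bessel. rewrite (clifford_rec m). simpl pow. field.
Qed.

Lemma is_derive_comp_R (f g : R -> R) (x df dg : R) :
  is_derive f (g x) df -> is_derive g x dg ->
  is_derive (fun t => f (g t)) x (dg * df).
Proof. intros Hf Hg. exact (is_derive_comp f g x df dg Hf Hg). Qed.

Lemma is_derive_eq (f : R -> R) (x l l' : R) : is_derive f x l -> l = l' -> is_derive f x l'.
Proof. intros H <-. exact H. Qed.

Lemma is_derive_mult_R (f g : R -> R) (x df dg : R) :
  is_derive f x df -> is_derive g x dg ->
  is_derive (fun t => f t * g t) x (df * g x + f x * dg).
Proof. intros Hf Hg. exact (is_derive_mult f g x df dg Hf Hg Rmult_comm). Qed.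

Lemma is_derive_minus_R (f g : R -> R) (x df dg : R) :
  is_derive f x df -> is_derive g x dg -> is_derive (fun t => f t - g t) x (df - dg).
Proof. intros Hf Hg. exact (is_derive_minus f g x df dg Hf Hg). Qed.

Lemma is_derive_plus_R (f g : R -> R) (x df dg : R) :
  is_derive f x df -> is_derive g x dg -> is_derive (fun t => f t + g t) x (df + dg).
Proof. intros Hf Hg. exact (is_derive_plus f g x df dg Hf Hg). Qed.

Lemma is_derive_bessel m x : x <> 0 -> is_derive (bessel m) x (bessel_d m x / x).
Proof.
  intro Hx. unfold bessel.
  assert (H1 : is_derive (fun t => clifford m (t ^ 2 / 4)) x
                 (x / 2 * - clifford (S m) (x ^ 2 / 4))).
  { apply (is_derive_comp_R (clifford m) (fun t => t ^ 2 / 4)).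
    - apply is_derive_clifford.
    - auto_derive; [exact I | field]. }
  assert (H2 : is_derive (fun t => (t / 2) ^ m) x (INR m * (x / 2) ^ m / x)).
  { auto_derive; [exact I |]. destruct m as [| m].
    - simpl. field; auto.
    - simpl pred. change (x * / 2) with (x / 2). simpl pow.
      generalize ((x / 2) ^ m) (INR (S m)). intros. field; auto. }
  eapply is_derive_eq.
  - exact (is_derive_mult_R _ _ x _ _ H2 H1).
  - unfold bessel_d, bessel. simpl pow.
    generalize ((x / 2) ^ m). intro. field; auto.
Qed.

Lemma is_derive_bessel_d m x : x <> 0 ->
  is_derive (bessel_d m) x (- (x ^ 2 - INR m ^ 2) / x * bessel m x).
Proof.
  intro Hx. unfold bessel_d.
  assert (Ha := is_derive_bessel m x Hx). assert (Hb := is_derive_bessel (S m) x Hx).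
  eapply is_derive_eq.
  - apply is_derive_minus_R.
    + apply is_derive_scal, Ha.
    + apply (is_derive_mult_R (fun t => t)); [apply @is_derive_id | exact Hb].
  - unfold one; simpl. unfold bessel_d.
    assert (Hr := bessel_rec m x).
    replace (bessel (S (S m)) x)
      with ((2 * (INR m + 1) * bessel (S m) x - x * bessel m x) / x)
      by (rewrite Hr; field; auto).
    rewrite S_INR. field; auto.
Qed.

Lemma eq_0_of_continuous_right (S : R -> R) :
  continuous S 0 -> (forall t, 0 < t < 1 -> S t = 0) -> S 0 = 0.
Proof.
  intros Hc Hz. destruct (Req_dec (S 0) 0) as [E | E]; [exact E | exfalso].
  assert (He : 0 < Rabs (S 0)) by (apply Rabs_pos_lt; exact E).
  destruct (proj1 (filterlim_locally _ _) Hc (mkposreal _ He)) as [d Hd].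
  assert (Hdp := cond_pos d).
  set (t := Rmin (d / 2) (1 / 2)).
  assert (Ht : 0 < t < 1 /\ t < d).
  { unfold t. split; [split |].
    - apply Rmin_glb_lt; lra.
    - eapply Rle_lt_trans; [apply Rmin_r | lra].
    - eapply Rle_lt_trans; [apply Rmin_l | lra]. }
  assert (Hb : ball 0 d t).
  { unfold ball; simpl; unfold AbsRing_ball, abs, minus, plus, opp; simpl.
    rewrite Rabs_pos_eq; lra. }
  apply Hd in Hb.
  unfold ball in Hb; simpl in Hb; unfold AbsRing_ball, abs, minus, plus, opp in Hb; simpl in Hb.
  rewrite Hz in Hb by tauto.
  rewrite Rplus_0_l, Rabs_Ropp in Hb. lra.
Qed.

(** The derivative of t C_0^2 + t^2 C_1^2 is C_0^2.  This nonnegative and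
    nondecreasing quantity can only vanish at s if C_0 vanishes on (0, s), which contradicts
    C_0(0) = 1. *)
Lemma clifford_no_common_zero_0 s : 0 < s -> clifford 0 s = 0 -> clifford 1 s = 0 -> False.
Proof.
  intros Hs H0 H1.
  set (g := fun t => t * clifford 0 t ^ 2 + t ^ 2 * clifford 1 t ^ 2).
  assert (Hd : forall t, is_derive g t (clifford 0 t ^ 2)).
  { intro t. unfold g.
    assert (D0 := is_derive_clifford 0 t). assert (D1 := is_derive_clifford 1 t).
    eapply is_derive_eq.
    - auto_derive; [| reflexivity]. repeat split; eexists; eassumption.
    - assert (E0 : Derive (fun x : R => clifford 0 x) t = - clifford 1 t)
        by exact (is_derive_unique _ _ _ D0).
      assert (E1 : Derive (fun x : R => clifford 1 x) t = - clifford 2 t)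
        by exact (is_derive_unique _ _ _ D1).
      rewrite E0, E1.
      assert (Hr := clifford_rec 0 t). simpl INR in Hr.
      assert (Hr' : t * clifford 2 t = clifford 1 t - clifford 0 t) by lra.
      transitivity (clifford 0 t ^ 2 - 2 * t * clifford 0 t * clifford 1 t + 2 * t * clifford 1 t ^ 2 - 2 * t * clifford 1 t * (t * clifford 2 t)); [ring | rewrite Hr'; ring]. }
  assert (Hz : forall t, 0 < t < s -> clifford 0 t = 0).
  { intros t Ht.
    assert (Hg0 : g t <= g s).
    { destruct (MVT_gen g t s (fun t => clifford 0 t ^ 2)) as [c [Hc1 Hc2]].
      - intros; apply Hd.
      - intros; apply continuity_pt_filterlim, (ex_derive_continuous g); eexists; apply Hd.
      - assert (0 <= clifford 0 c ^ 2) by apply pow2_ge_0. nra. }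
    assert (g s = 0) by (unfold g; rewrite H0, H1; ring).
    unfold g in Hg0 at 1.
    assert (0 <= t ^ 2 * clifford 1 t ^ 2) by (apply Rmult_le_pos; apply pow2_ge_0).
    assert (0 <= clifford 0 t ^ 2) by apply pow2_ge_0.
    assert (clifford 0 t ^ 2 = 0) by nra. nra. }
  assert (H : clifford 0 (s * 0) = 0).
  { apply (eq_0_of_continuous_right (fun t => clifford 0 (s * t))).
    - apply (continuous_comp (fun t => s * t) (clifford 0)); [| apply clifford_continuous].
      apply (ex_derive_continuous (fun t => s * t)). auto_derive. exact I.
    - intros t Ht. apply Hz. nra. }
  rewrite Rmult_0_r in H. assert (Hp := clifford_0_pos 0). lra.
Qed.

(** The recurrence carries a common zero of C_m and C_(m+1) down to C_0
    and C_1. *)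
Lemma clifford_no_common_zero m s :
  0 < s -> clifford m s = 0 -> clifford (S m) s = 0 -> False.
Proof.
  intro Hs. induction m as [| m IH]; intros H0 H1.
  - apply (clifford_no_common_zero_0 s); assumption.
  - apply IH; [| exact H0]. rewrite clifford_rec, H0, H1. ring.
Qed.

Lemma bessel_nondegenerate m x : 0 < x -> bessel m x = 0 -> bessel_d m x = 0 -> False.
Proof.
  intros Hx H0 H1. unfold bessel_d in H1. rewrite H0 in H1.
  assert (H2 : bessel (S m) x = 0) by nra.
  assert (Hp : forall k, (x / 2) ^ k <> 0) by (intro; apply pow_nonzero; lra).
  apply (clifford_no_common_zero m (x ^ 2 / 4)); [nra | |].
  - unfold bessel in H0. apply Rmult_integral in H0. destruct H0; [elim (Hp m); assumption | assumption].
  - unfold bessel in H2. apply Rmult_integral in H2. destruct H2; [elim (Hp (S m)); assumption | assumption].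
Qed.

(** The radial derivative at r = 1 of r^m C_m(x^2 r^2 / 4).  It equals x J_m'(x) up to the
    factor (x/2)^m, whose removal settles the point x = 0: there it vanishes exactly when m = 0,
    so that the constant eigenfunction is counted and the zeros of J_m' at 0 for m >= 2
    are not. *)
Definition neumann_char (m : nat) (x : R) : R :=
  INR m * clifford m (x ^ 2 / 4) - 2 * (x ^ 2 / 4) * clifford (S m) (x ^ 2 / 4).

Lemma bessel_d_char m x : bessel_d m x = (x / 2) ^ m * neumann_char m x.
Proof. unfold bessel_d, bessel, neumann_char. simpl pow. field. Qed.

(** * Product eigenfunctions of the disk *)

(** A syntax, closed under both partial derivatives, that contains the eigenfunctions.
    Smoothness of all orders then needs one induction on terms, and differential identities are
    obtained by computation. *)
Inductive expr : Type :=
  | Cst (c : R) | VarX | VarY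
  | Rad (kappa : R) (m : nat)
  | Add (e1 e2 : expr) | Mul (e1 e2 : expr).

Fixpoint eval (e : expr) (x y : R) : R :=
  match e with
  | Cst c => c
  | VarX => x
  | VarY => y
  | Rad kappa m => clifford m (kappa * (x ^ 2 + y ^ 2))
  | Add e1 e2 => eval e1 x y + eval e2 x y
  | Mul e1 e2 => eval e1 x y * eval e2 x y
  end.

Fixpoint d_x (e : expr) : expr :=
  match e with
  | Cst _ | VarY => Cst 0
  | VarX => Cst 1
  | Rad kappa m => Mul (Mul (Cst (-2 * kappa)) VarX) (Rad kappa (S m))
  | Add e1 e2 => Add (d_x e1) (d_x e2)
  | Mul e1 e2 => Add (Mul (d_x e1) e2) (Mul e1 (d_x e2))
  end.

Fixpoint d_y (e : expr) : expr :=
  match e with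
  | Cst _ | VarX => Cst 0
  | VarY => Cst 1
  | Rad kappa m => Mul (Mul (Cst (-2 * kappa)) VarY) (Rad kappa (S m))
  | Add e1 e2 => Add (d_y e1) (d_y e2)
  | Mul e1 e2 => Add (Mul (d_y e1) e2) (Mul e1 (d_y e2))
  end.

Lemma is_derive_eval_x e x y : is_derive (fun t => eval e t y) x (eval (d_x e) x y).
Proof.
  induction e as [c | | | kappa m | e1 IH1 e2 IH2 | e1 IH1 e2 IH2]; simpl.
  - apply @is_derive_const.
  - apply @is_derive_id.
  - apply @is_derive_const.
  - eapply is_derive_eq.
    + apply (is_derive_comp_R (clifford m) (fun t => kappa * (t * (t * 1) + y * (y * 1)))).
      * apply is_derive_clifford.
      * auto_derive; [exact I | reflexivity].
    + ring.
  - apply (is_derive_plus_R (fun t => eval e1 t y) (fun t => eval e2 t y)); assumption.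
  - apply (is_derive_mult_R (fun t => eval e1 t y) (fun t => eval e2 t y)); assumption.
Qed.

Lemma is_derive_eval_y e x y : is_derive (fun t => eval e x t) y (eval (d_y e) x y).
Proof.
  induction e as [c | | | kappa m | e1 IH1 e2 IH2 | e1 IH1 e2 IH2]; simpl.
  - apply @is_derive_const.
  - apply @is_derive_const.
  - apply @is_derive_id.
  - eapply is_derive_eq.
    + apply (is_derive_comp_R (clifford m) (fun t => kappa * (x * (x * 1) + t * (t * 1)))).
      * apply is_derive_clifford.
      * auto_derive; [exact I | reflexivity].
    + ring.
  - apply (is_derive_plus_R (fun t => eval e1 x t) (fun t => eval e2 x t)); assumption.
  - apply (is_derive_mult_R (fun t => eval e1 x t) (fun t => eval e2 x t)); assumption.
Qed.

Lemma continuity_2d_pt_eval e x y : continuity_2d_pt (eval e) x y.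
Proof.
  induction e as [c | | | kappa m | e1 IH1 e2 IH2 | e1 IH1 e2 IH2]; simpl.
  - apply continuity_2d_pt_const.
  - apply continuity_2d_pt_id1.
  - apply continuity_2d_pt_id2.
  - apply (continuity_1d_2d_pt_comp (clifford m) (fun x y => kappa * (x ^ 2 + y ^ 2))).
    + apply continuity_pt_filterlim, clifford_continuous.
    + apply (continuity_2d_pt_ext (fun x y => kappa * (x * x + y * y))); [intros; ring |].
      repeat (apply continuity_2d_pt_mult || apply continuity_2d_pt_plus
              || apply continuity_2d_pt_const || apply continuity_2d_pt_id1
              || apply continuity_2d_pt_id2).
  - apply continuity_2d_pt_plus; assumption.
  - apply continuity_2d_pt_mult; assumption.
Qed.

Lemma Derive_eval_x e x y : Derive (fun t => eval e t y) x = eval (d_x e) x y.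
Proof. apply is_derive_unique, is_derive_eval_x. Qed.

Lemma Derive_eval_y e x y : Derive (fun t => eval e x t) y = eval (d_y e) x y.
Proof. apply is_derive_unique, is_derive_eval_y. Qed.

Lemma ex_diff_n_eval e n x y : ex_diff_n (eval e) n x y.
Proof.
  revert e; induction n as [| n IH]; intro e; simpl;
    (split; [apply continuity_2d_pt_eval |]); [exact I |].
  split; [eexists; apply is_derive_eval_x |].
  split; [eexists; apply is_derive_eval_y |].
  split.
  - apply ex_diff_n_ext_loc with (f := eval (d_x e)); [| apply IH].
    apply locally_2d_forall; intros; symmetry; apply Derive_eval_x.
  - apply ex_diff_n_ext_loc with (f := eval (d_y e)); [| apply IH].
    apply locally_2d_forall; intros; symmetry; apply Derive_eval_y.
Qed.

Lemma laplacian_eval e x y :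
  laplacian (eval e) x y = eval (d_x (d_x e)) x y + eval (d_y (d_y e)) x y.
Proof.
  unfold laplacian, partial_derive; simpl. f_equal.
  - rewrite <- (Derive_eval_x (d_x e)). apply Derive_ext. intro. apply Derive_eval_x.
  - rewrite <- (Derive_eval_y (d_y e)). apply Derive_ext. intro. apply Derive_eval_y.
Qed.

Lemma continuous_on_closed_disk_eval e : continuous_on_closed_disk (eval e).
Proof.
  intros [x y] _. simpl.
  eapply filterlim_filter_le_1.
  2: apply continuity_2d_pt_filterlim, continuity_2d_pt_eval.
  intros P HP. unfold within. apply filter_imp with (2 := HP). auto.
Qed.

(** The real and imaginary parts of (x + i y)^m. *)
Fixpoint harmonic (m : nat) : expr * expr :=
  match m with
  | O => (Cst 1, Cst 0)
  | S m =>
      let (a, b) := harmonic m in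
      (Add (Mul VarX a) (Mul (Cst (-1)) (Mul VarY b)), Add (Mul VarX b) (Mul VarY a))
  end.

Definition cauchy_riemann (a b : expr) : Prop := forall x y,
  eval (d_x a) x y = eval (d_y b) x y /\ eval (d_y a) x y = - eval (d_x b) x y.

Definition is_harmonic (m : nat) (e : expr) : Prop := forall x y,
  eval (d_x (d_x e)) x y + eval (d_y (d_y e)) x y = 0 /\
  x * eval (d_x e) x y + y * eval (d_y e) x y = INR m * eval e x y.

(** The Cauchy-Riemann equations have to be carried through the induction, because the
    Laplacian of x a - y b contains 2 (a_x - b_y). *)
Lemma harmonic_spec m :
  cauchy_riemann (fst (harmonic m)) (snd (harmonic m)) /\
  is_harmonic m (fst (harmonic m)) /\ is_harmonic m (snd (harmonic m)).
Proof.
  induction m as [| m IH].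
  - simpl. repeat split; simpl; ring.
  - simpl harmonic. destruct (harmonic m) as [a b]. simpl in IH.
    destruct IH as [Hcr [Ha Hb]].
    repeat split; intros; destruct (Hcr x y) as [C1 C2];
      destruct (Ha x y) as [A1 A2]; destruct (Hb x y) as [B1 B2]; rewrite ?S_INR; simpl.
    + rewrite C1, C2. ring.
    + rewrite C1, C2. ring.
    + transitivity (2 * (eval (d_x a) x y - eval (d_y b) x y)
        + x * (eval (d_x (d_x a)) x y + eval (d_y (d_y a)) x y)
        - y * (eval (d_x (d_x b)) x y + eval (d_y (d_y b)) x y)); [ring |].
      rewrite A1, B1, C1. ring.
    + transitivity ((x * eval a x y - y * eval b x y)
        + x * (x * eval (d_x a) x y + y * eval (d_y a) x y)
        - y * (x * eval (d_x b) x y + y * eval (d_y b) x y)); [ring |].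
      rewrite A2, B2. ring.
    + transitivity (2 * (eval (d_x b) x y + eval (d_y a) x y)
        + x * (eval (d_x (d_x b)) x y + eval (d_y (d_y b)) x y)
        + y * (eval (d_x (d_x a)) x y + eval (d_y (d_y a)) x y)); [ring |].
      rewrite A1, B1, C2. ring.
    + transitivity ((x * eval b x y + y * eval a x y)
        + x * (x * eval (d_x b) x y + y * eval (d_y b) x y)
        + y * (x * eval (d_x a) x y + y * eval (d_y a) x y)); [ring |].
      rewrite A2, B2. ring.
Qed.

Lemma harmonic_polar m r t :
  eval (fst (harmonic m)) (r * cos t) (r * sin t) = r ^ m * cos (INR m * t) /\
  eval (snd (harmonic m)) (r * cos t) (r * sin t) = r ^ m * sin (INR m * t).
Proof.
  induction m as [| m IH].
  - simpl. rewrite Rmult_0_l, cos_0, sin_0. lra.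
  - rewrite S_INR. simpl harmonic. destruct (harmonic m) as [a b]. simpl in *.
    destruct IH as [Ha Hb]. rewrite Ha, Hb.
    replace ((INR m + 1) * t) with (INR m * t + t) by ring.
    rewrite cos_plus, sin_plus. split; ring.
Qed.

(** One natural number p encodes the angular factor: p = 2 m stands for cos (m theta) and
    p = 2 m - 1 for sin (m theta).  Every p is then the code of exactly one factor, and sums over
    p have the multiplicities 1 for m = 0 and 2 for m >= 1 built in. *)
Definition angular_order (p : nat) : nat := Nat.div2 (S p).

Definition angular_part (p : nat) : expr :=
  if Nat.even p then fst (harmonic (angular_order p)) else snd (harmonic (angular_order p)).

Definition disk_mode (kappa : R) (p : nat) : R -> R -> R :=
  eval (Mul (angular_part p) (Rad kappa (angular_order p))).

Lemma angular_part_harmonic p : is_harmonic (angular_order p) (angular_part p).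
Proof.
  unfold angular_part. destruct (harmonic_spec (angular_order p)) as [_ [H1 H2]].
  destruct (Nat.even p); assumption.
Qed.

(** Euler's identity for the homogeneous harmonic factor turns the Laplacian into
    Bessel's equation and the normal derivative on the circle into neumann_char. *)
Lemma disk_mode_neumann p s :
  neumann_char (angular_order p) s = 0 -> neumann_solution (s ^ 2) (disk_mode (s ^ 2 / 4) p).
Proof.
  intro Hs. unfold disk_mode. set (kappa := s ^ 2 / 4).
  set (e := Mul (angular_part p) (Rad kappa (angular_order p))).
  set (m := angular_order p) in *.
  assert (Hh := angular_part_harmonic p). fold m in Hh.
  split; [intros; apply ex_diff_n_eval |].
  split.
  { intros x y _. rewrite laplacian_eval. destruct (Hh x y) as [H1 H2]. simpl.
    fold m. set (z := kappa * (x * (x * 1) + y * (y * 1))).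
    assert (Hr := clifford_rec m z).
    set (F0 := clifford m z) in *. set (F1 := clifford (S m) z) in *. set (F2 := clifford (S (S m)) z) in *.
    set (zz := eval (angular_part p) x y) in *.
    set (zx := eval (d_x (angular_part p)) x y) in *.
    set (zy := eval (d_y (angular_part p)) x y) in *.
    set (zxx := eval (d_x (d_x (angular_part p))) x y) in *.
    set (zyy := eval (d_y (d_y (angular_part p))) x y) in *.
    transitivity (- ((zxx + zyy) * F0) + 4 * kappa * F1 * (x * zx + y * zy)
      + 4 * kappa * zz * F1 - 4 * kappa * zz * z * F2).
    { unfold z. ring. }
    rewrite H1, H2, Hr. unfold kappa. field. }
  split; [apply continuous_on_closed_disk_eval |].
  exists (eval (d_x e)), (eval (d_y e)).
  split; [apply continuous_on_closed_disk_eval |].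
  split; [apply continuous_on_closed_disk_eval |].
  split.
  - intros x y _. 
    split; symmetry; [exact (Derive_eval_x e x y) | exact (Derive_eval_y e x y)].
  - intros x y Hxy. unfold unit_circle in Hxy. destruct (Hh x y) as [_ H2].
    unfold e. simpl. fold m.
    replace (kappa * (x * (x * 1) + y * (y * 1))) with kappa
      by (replace (x * (x * 1) + y * (y * 1)) with (x ^ 2 + y ^ 2) by ring; rewrite Hxy; ring).
    set (F0 := clifford m kappa). set (F1 := clifford (S m) kappa).
    set (zz := eval (angular_part p) x y) in *.
    transitivity ((x * eval (d_x (angular_part p)) x y + y * eval (d_y (angular_part p)) x y) * F0
      - 2 * kappa * (x ^ 2 + y ^ 2) * zz * F1); [ring |].
    rewrite H2, Hxy. transitivity (zz * (INR m * F0 - 2 * kappa * F1)); [ring |].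
    unfold neumann_char in Hs. fold kappa in Hs. fold F0 F1 in Hs. rewrite Hs. ring.
Qed.

(** * Independence of the eigenfunctions and the counting function *)

Lemma continuous_sum_f_R0 (f : nat -> R -> R) (N : nat) (t : R) :
  (forall m, continuous (f m) t) -> continuous (fun t => sum_f_R0 (fun m => f m t) N) t.
Proof.
  intro H. induction N as [| N IH]; simpl; [apply H |].
  apply (continuous_plus (fun t => sum_f_R0 (fun m => f m t) N) (f (S N))); auto.
Qed.

Lemma continuous_pow_0 (m : nat) (t : R) : continuous (fun t => t ^ m) t.
Proof. apply (ex_derive_continuous (fun t => t ^ m)). auto_derive. exact I. Qed.

(** Letting t tend to 0 leaves only the term of degree 0, so its coefficient is 0;
    what remains can be divided by t. *)
Lemma graded_sum_eq_0 (N : nat) (alpha : nat -> R) (phi : nat -> R -> R) :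
  (forall m, continuous (phi m) 0) -> (forall m, phi m 0 <> 0) ->
  (forall t, 0 < t < 1 -> sum_f_R0 (fun m => alpha m * (t ^ m * phi m t)) N = 0) ->
  forall m, (m <= N)%nat -> alpha m = 0.
Proof.
  revert alpha phi. induction N as [| N IH]; intros alpha phi Hc Hn Hs.
  - assert (H0 := eq_0_of_continuous_right (fun t => alpha 0%nat * (1 * phi 0%nat t))).
    intros m Hm. replace m with 0%nat by lia.
    assert (E : alpha 0%nat * (1 * phi 0%nat 0) = 0).
    { apply H0; [| exact Hs].
      apply (continuous_scal_r (alpha 0%nat) (fun t => 1 * phi 0%nat t)).
      apply (continuous_scal_r 1 (phi 0%nat)). apply Hc. }
    specialize (Hn 0%nat). rewrite Rmult_1_l in E.
    apply Rmult_integral in E. tauto.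
  - assert (H0 : alpha 0%nat = 0).
    { assert (E : sum_f_R0 (fun m => alpha m * (0 ^ m * phi m 0)) (S N) = 0).
      { apply (eq_0_of_continuous_right
                 (fun t => sum_f_R0 (fun m => alpha m * (t ^ m * phi m t)) (S N)));
          [| exact Hs].
        apply (continuous_sum_f_R0 (fun m t => alpha m * (t ^ m * phi m t)) (S N)).
        intro m. apply (continuous_scal_r (alpha m) (fun t => t ^ m * phi m t)).
        apply (continuous_mult (fun t => t ^ m) (phi m)); [apply continuous_pow_0 | apply Hc]. }
      rewrite decomp_sum in E by lia. rewrite (sum_eq_R0 (fun i => alpha (S i) * _)) in E.
      - simpl in E. rewrite Rplus_0_r, Rmult_1_l in E.
        specialize (Hn 0%nat). apply Rmult_integral in E. tauto.
      - intros. simpl. ring. }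
    intros [| m] Hm; [exact H0 |].
    apply (IH (fun m => alpha (S m)) (fun m => phi (S m))); auto; [| lia].
    intros t Ht. specialize (Hs t Ht). rewrite decomp_sum in Hs by lia.
    rewrite H0, Rmult_0_l, Rplus_0_l in Hs. simpl pred in Hs.
    apply (Rmult_eq_reg_l t); [| lra]. rewrite Rmult_0_r, <- Hs, scal_sum.
    apply sum_eq. intros. simpl. ring.
Qed.

Definition cos_part m := eval (fst (harmonic m)).
Definition sin_part m := eval (snd (harmonic m)).

(** On the ray at angle th the mode of order m is t^m times a function that
    does not vanish at t = 0, so the orders separate at the centre of the disk.  Two directions,
    th = 0 and th = pi / (2 m), then separate cosine from sine. *)
Lemma cos_sin_modes_independent (kappa : R) (N : nat) (d e : nat -> R) :
  (forall x y, open_disk x y ->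
     sum_f_R0 (fun m => (d m * cos_part m x y + e m * sin_part m x y)
                        * clifford m (kappa * (x ^ 2 + y ^ 2))) N = 0) ->
  forall m, (m <= N)%nat -> d m = 0 /\ (m <> 0%nat -> e m = 0).
Proof.
  intros H.
  assert (Hang : forall th m, (m <= N)%nat ->
            d m * cos (INR m * th) + e m * sin (INR m * th) = 0).
  { intro th.
    apply (graded_sum_eq_0 N (fun m => d m * cos (INR m * th) + e m * sin (INR m * th))
             (fun m t => clifford m (kappa * t ^ 2))).
    - intro m. apply (continuous_comp (fun t => kappa * t ^ 2) (clifford m));
        [| apply clifford_continuous].
      apply (ex_derive_continuous (fun t => kappa * t ^ 2)). auto_derive. exact I.
    - intro m. replace (kappa * 0 ^ 2) with 0 by ring.
      apply Rgt_not_eq, clifford_0_pos.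
    - intros t Ht.
      assert (Hsq : (t * cos th) ^ 2 + (t * sin th) ^ 2 = t ^ 2).
      { assert (Hp := sin2_cos2 th). unfold Rsqr in Hp.
        transitivity (t ^ 2 * (sin th * sin th + cos th * cos th)); [ring | rewrite Hp; ring]. }
      rewrite <- (H (t * cos th) (t * sin th)).
      + apply sum_eq. intros m _. unfold cos_part, sin_part.
        destruct (harmonic_polar m t th) as [-> ->]. rewrite Hsq. ring.
      + unfold open_disk. rewrite Hsq. nra. }
  intros m Hm. split.
  - specialize (Hang 0 m Hm). rewrite Rmult_0_r, cos_0, sin_0 in Hang. lra.
  - intro Hm0. specialize (Hang (PI / 2 / INR m) m Hm).
    replace (INR m * (PI / 2 / INR m)) with (PI / 2) in Hang
      by (field; apply not_0_INR; exact Hm0).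
    rewrite cos_PI2, sin_PI2 in Hang. lra.
Qed.

Lemma sum_f_R0_exchange (f : nat -> nat -> R) n N :
  sum_f_R0 (fun i => sum_f_R0 (fun j => f i j) N) n
  = sum_f_R0 (fun j => sum_f_R0 (fun i => f i j) n) N.
Proof.
  induction n as [| n IH]; simpl; [reflexivity |].
  rewrite IH, <- sum_plus. reflexivity.
Qed.

Lemma sum_f_R0_indicator (j : nat) (a : nat -> R) (N : nat) :
  (j <= N)%nat -> sum_f_R0 (fun m => if Nat.eq_dec m j then a m else 0) N = a j.
Proof.
  intro Hj. induction N as [| N IH].
  - replace j with 0%nat by lia. simpl. reflexivity.
  - rewrite tech5. destruct (Nat.eq_dec (S N) j) as [E | E].
    + rewrite (sum_eq_R0 (fun m => if Nat.eq_dec m j then a m else 0)).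
      * rewrite E. ring.
      * intros n Hn. destruct (Nat.eq_dec n j); [lia | reflexivity].
    + rewrite IH by lia. ring.
Qed.

Lemma disk_mode_split kappa p x y :
  disk_mode kappa p x y =
  ((if Nat.even p then cos_part (angular_order p) x y else sin_part (angular_order p) x y))
  * clifford (angular_order p) (kappa * (x ^ 2 + y ^ 2)).
Proof. unfold disk_mode, angular_part, cos_part, sin_part. destruct (Nat.even p); reflexivity. Qed.

Lemma angular_order_le p : (angular_order p <= p)%nat.
Proof.
  unfold angular_order. assert (H := Nat.div2_odd (S p)).
  destruct (Nat.odd (S p)); simpl Nat.b2n in H; lia.
Qed.

Lemma angular_order_even_inj p q :
  Nat.even p = Nat.even q -> angular_order p = angular_order q -> p = q.
Proof.
  unfold angular_order. intros He H.
  assert (Hp := Nat.div2_odd (S p)). assert (Hq := Nat.div2_odd (S q)).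
  rewrite !Nat.odd_succ in *. rewrite He in Hp. lia.
Qed.

Lemma angular_order_odd_neq_0 p : Nat.even p = false -> angular_order p <> 0%nat.
Proof. destruct p; [discriminate |]. unfold angular_order. simpl. discriminate. Qed.

Lemma NoDup_nth_inj (L : list nat) i j :
  NoDup L -> (i < length L)%nat -> (j < length L)%nat -> nth i L 0%nat = nth j L 0%nat -> i = j.
Proof. intros H Hi Hj E. exact (proj1 (NoDup_nth L 0%nat) H i j Hi Hj E). Qed.

(** The sum is regrouped by angular order; a code is determined by its order and
    its parity, so that each group contains each coefficient at most once. *)
Lemma disk_modes_independent kappa (L : list nat) :
  NoDup L ->
  independent_on_disk (length L) (fun i => disk_mode kappa (nth (pred i) L 0%nat)).
Proof.
  intros HL c Hc i Hi. destruct L as [| p0 L']; [simpl in Hi; lia |].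
  set (L := p0 :: L') in *. set (n := length L') in *.
  assert (Hlen : length L = S n) by reflexivity.
  set (q := fun j => nth j L 0%nat).
  set (N := fold_right Nat.max 0%nat L).
  assert (HN : forall j, (j <= n)%nat -> (angular_order (q j) <= N)%nat).
  { intros j Hj. eapply Nat.le_trans; [apply angular_order_le |].
    assert (Hin : In (q j) L) by (apply nth_In; lia).
    unfold N. generalize (q j), Hin. clear. induction L as [| a L IH]; simpl; [tauto |].
    intros x [-> | Hx]; [lia |]. specialize (IH x Hx). lia. }
  set (w := fun b m j => if Bool.bool_dec (Nat.even (q j)) b then
               if Nat.eq_dec m (angular_order (q j)) then c (S j) else 0 else 0).
  assert (Hz := cos_sin_modes_independent kappa N
     (fun m => sum_f_R0 (w true m) n) (fun m => sum_f_R0 (w false m) n)).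
  assert (Hz' : forall x y, open_disk x y ->
     sum_f_R0 (fun m => (sum_f_R0 (w true m) n * cos_part m x y
         + sum_f_R0 (w false m) n * sin_part m x y)
         * clifford m (kappa * (x ^ 2 + y ^ 2))) N = 0).
  { intros x y Hxy. rewrite <- (Hc x y Hxy).
    rewrite Hlen.
    transitivity (sum_f_R0 (fun j => c (S j) * disk_mode kappa (q j) x y) n).
    - transitivity (sum_f_R0 (fun m => sum_f_R0 (fun j =>
         if Nat.eq_dec m (angular_order (q j)) then
           c (S j) * ((if Nat.even (q j) then cos_part m x y else sin_part m x y)
           * clifford m (kappa * (x ^ 2 + y ^ 2))) else 0) n) N).
      + apply sum_eq. intros m _.
        rewrite Rmult_plus_distr_r.
        rewrite (Rmult_comm (sum_f_R0 (w true m) n)), (Rmult_comm (sum_f_R0 (w false m) n)).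
        rewrite (Rmult_comm (_ * sum_f_R0 (w true m) n)), (Rmult_comm (_ * sum_f_R0 (w false m) n)).
        rewrite <- !Rmult_assoc, !scal_sum, <- sum_plus.
        apply sum_eq. intros j _. unfold w.
        destruct (Nat.even (q j)); simpl; destruct (Nat.eq_dec m (angular_order (q j))); ring.
      + rewrite sum_f_R0_exchange. apply sum_eq. intros j Hj.
        rewrite (sum_f_R0_indicator (angular_order (q j)) (fun m =>
           c (S j) * ((if Nat.even (q j) then cos_part m x y else sin_part m x y)
           * clifford m (kappa * (x ^ 2 + y ^ 2))))) by (apply HN; exact Hj).
        rewrite disk_mode_split. reflexivity.
    - rewrite <- sum_n_Reals. unfold sum_n. rewrite <- sum_n_m_S. reflexivity. }
  assert (Hj : exists j, i = S j /\ (j <= n)%nat) by (exists (pred i); lia).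
  destruct Hj as [j [-> Hj]].
  destruct (Hz Hz' (angular_order (q j)) (HN j Hj)) as [Hd He].
  assert (Hone : forall b, Nat.even (q j) = b ->
            sum_f_R0 (w b (angular_order (q j))) n = c (S j)).
  { intros b Hb. rewrite <- (sum_f_R0_indicator j (fun k => c (S k)) n Hj).
    apply sum_eq. intros k Hk. unfold w.
    destruct (Nat.eq_dec k j) as [-> | Hkj].
    - destruct (Bool.bool_dec (Nat.even (q j)) b); [| tauto].
      destruct (Nat.eq_dec (angular_order (q j)) (angular_order (q j))); [reflexivity | tauto].
    - destruct (Bool.bool_dec (Nat.even (q k)) b) as [Hb' |]; [| reflexivity].
      destruct (Nat.eq_dec (angular_order (q j)) (angular_order (q k))) as [Ho |]; [| reflexivity].
      exfalso. apply Hkj. apply (NoDup_nth_inj L); [exact HL | lia | lia |].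
      change (q k = q j); apply angular_order_even_inj; [congruence | symmetry; exact Ho]. }
  destruct (Nat.even (q j)) eqn:Hev.
  - rewrite <- (Hone true); auto.
  - rewrite <- (Hone false); auto. apply He, angular_order_odd_neq_0, Hev.
Qed.

Lemma multiplicity_ge s (L : list nat) :
  NoDup L -> (forall p, In p L -> neumann_char (angular_order p) s = 0) ->
  Rbar_le (INR (length L)) (multiplicity (s ^ 2)).
Proof.
  intros HL Hz. unfold multiplicity.
  match goal with |- Rbar_le _ (Lub_Rbar ?E) => destruct (Lub_Rbar_correct E) as [Hub _] end.
  apply Hub. exists (length L), (fun i => disk_mode (s ^ 2 / 4) (nth (pred i) L 0%nat)).
  split; [reflexivity |]. split.
  - intros i Hi. apply disk_mode_neumann, Hz, nth_In. lia.
  - apply disk_modes_independent, HL.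
Qed.

Lemma neumann_char_eigenvalue p s :
  neumann_char (angular_order p) s = 0 -> neumann_eigenvalue (s ^ 2).
Proof.
  intro Hz. exists (disk_mode (s ^ 2 / 4) p). split; [apply disk_mode_neumann, Hz |].
  apply Classical_Prop.NNPP. intro Hn.
  assert (Hi := disk_modes_independent (s ^ 2 / 4) (p :: nil)).
  assert (H1 : 1 = 0); [| lra].
  apply (Hi ltac:(constructor; [simpl; tauto | constructor]) (fun _ => 1)) with (i := 1%nat);
    [| simpl; lia].
  intros x y Hxy. simpl length. rewrite sum_n_n. simpl.
  destruct (Req_dec (disk_mode (s ^ 2 / 4) p x y) 0) as [E | E]; [simpl in E; rewrite E; ring |].
  elim Hn. exists x, y. split; assumption.
Qed.

Definition fibre {A B : Type} (eqB : forall a b : B, {a = b} + {a <> b}) (f : A -> B)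
    (b : B) (E : list A) : list A :=
  filter (fun e => if eqB (f e) b then true else false) E.

Lemma length_le_sum_fibres {A B : Type} (eqB : forall a b : B, {a = b} + {a <> b}) (f : A -> B)
    (E : list A) (l : list B) :
  (forall e, In e E -> In (f e) l) ->
  (length E <= list_sum (map (fun b => length (fibre eqB f b E)) l))%nat.
Proof.
  induction E as [| e E IH]; intro Hl; [simpl; lia |].
  assert (IH' := IH (fun e' He' => Hl e' (or_intror He'))).
  assert (Hin := Hl e (or_introl eq_refl)). clear IH Hl.
  set (ind := fun b => if eqB (f e) b then 1%nat else 0%nat).
  assert (E1 : list_sum (map (fun b => length (fibre eqB f b (e :: E))) l)
            = (list_sum (map ind l) + list_sum (map (fun b => length (fibre eqB f b E)) l))%nat).
  { clear. induction l as [| b l IH]; [reflexivity |].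
    cbn [map list_sum fold_right] in *. unfold list_sum in *. cbn [fold_right]. rewrite IH.
    unfold ind at 2. unfold fibre at 1. simpl filter.
    destruct (eqB (f e) b); simpl length; unfold fibre; lia. }
  assert (E2 : (1 <= list_sum (map ind l))%nat).
  { clear -Hin. induction l as [| b l IH]; [destruct Hin |].
    unfold list_sum in *. cbn [map fold_right]. destruct Hin as [-> | Hin].
    - unfold ind at 1. destruct (eqB (f e) (f e)); [lia | tauto].
    - specialize (IH Hin). lia. }
  rewrite E1. simpl length. lia.
Qed.

Lemma NoDup_map_inj_in {A B : Type} (f : A -> B) (l : list A) :
  (forall a b, In a l -> In b l -> f a = f b -> a = b) -> NoDup l -> NoDup (map f l).
Proof.
  intros Hf Hl. induction Hl as [| a l Ha Hl IH]; simpl; constructor.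
  - intro Hin. apply in_map_iff in Hin. destruct Hin as [b [E Hb]].
    apply Ha. rewrite (Hf a b); simpl; auto.
  - apply IH. intros; apply Hf; simpl; auto.
Qed.

Lemma sum_multiplicities_ge (g : R -> nat) (l : list R) :
  (forall lambda, In lambda l -> Rbar_le (INR (g lambda)) (multiplicity lambda)) ->
  Rbar_le (INR (list_sum (map g l))) (sum_multiplicities l).
Proof.
  induction l as [| a l IH]; intro H.
  - unfold sum_multiplicities. simpl. lra.
  - unfold sum_multiplicities, list_sum in *. cbn [map fold_right].
    rewrite plus_INR.
    change (Finite (INR (g a) + INR (fold_right Nat.add 0%nat (map g l))))
      with (Rbar_plus (INR (g a)) (INR (fold_right Nat.add 0%nat (map g l)))).
    apply Rbar_plus_le_compat; [apply H; left; reflexivity |].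
    apply IH. intros; apply H; right; assumption.
Qed.

(** The pairs (p, s) are grouped by the eigenvalue s^2.  Since s >= 0, two pairs of
    one group have different p, hence give independent eigenfunctions. *)
Lemma neumann_counting_ge (mu : R) (E : list (nat * R)) :
  NoDup E ->
  (forall p s, In (p, s) E -> 0 <= s <= mu /\ neumann_char (angular_order p) s = 0) ->
  Rbar_le (INR (length E)) (neumann_counting mu).
Proof.
  intros HE Hz.
  set (lam := fun e : nat * R => snd e ^ 2).
  set (l := nodup Req_EM_T (map lam E)).
  assert (Hl : forall e, In e E -> In (lam e) l)
    by (intros e He; apply nodup_In, in_map, He).
  assert (Hl' : forall a, In a l -> exists e, In e E /\ a = lam e).
  { intros a Ha. apply nodup_In, in_map_iff in Ha. destruct Ha as [e [E1 E2]]. eauto. }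
  apply Rbar_le_trans with (INR (list_sum (map (fun a => length (fibre Req_EM_T lam a E)) l))).
  { simpl. apply le_INR, length_le_sum_fibres, Hl. }
  apply Rbar_le_trans with (sum_multiplicities l).
  - apply sum_multiplicities_ge. intros a Ha.
    destruct (Hl' a Ha) as [[p s] [He ->]]. unfold lam at 2. simpl snd.
    destruct (Hz p s He) as [Hs _].
    assert (Hfib : forall q t, In (q, t) (fibre Req_EM_T lam (lam (p, s)) E) -> In (q, t) E /\ t = s).
    { intros q t Hq. unfold fibre in Hq. apply filter_In in Hq. destruct Hq as [Hq Hq'].
      split; [exact Hq |]. destruct (Hz q t Hq) as [Ht _].
      destruct (Req_EM_T (lam (q, t)) (lam (p, s))) as [El |]; [| discriminate].
      unfold lam in El. simpl snd in El. nra. }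
    rewrite <- (length_map fst). apply multiplicity_ge.
    + apply NoDup_map_inj_in; [| apply NoDup_filter, HE].
      intros [q t] [q' t'] H1 H2 E1. simpl in E1.
      destruct (Hfib _ _ H1), (Hfib _ _ H2). subst. reflexivity.
    + intros q Hq. apply in_map_iff in Hq. destruct Hq as [[q' t] [E1 Hq]]. simpl in E1. subst q'.
      destruct (Hfib _ _ Hq) as [Hq' ->]. apply (Hz q s Hq').
  - unfold neumann_counting, Rbar_lub.
    match goal with |- Rbar_le _ (proj1_sig ?X) => destruct X as [L [Hub Hleast]] end.
    simpl. apply Hub. exists l. split; [apply NoDup_nodup |]. split; [| reflexivity].
    intros a Ha. destruct (Hl' a Ha) as [[p s] [He ->]]. destruct (Hz p s He) as [Hs Hs'].
    split; [apply (neumann_char_eigenvalue p s Hs') |].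
    unfold lam. simpl snd. apply pow_incr. exact Hs.
Qed.

(** * Spacing of the critical points of Bessel functions *)

(** The integral of sqrt (t^2 - m^2) / t from m to x, usually written
    sqrt (x^2 - m^2) - m arccos (m / x).  The derivative of the arctangent form is
    easier to compute. *)
Definition wkb_phase (m x : R) : R :=
  sqrt (x ^ 2 - m ^ 2) - m * atan (sqrt (x ^ 2 - m ^ 2) / m).

Lemma is_derive_sqrt_diff m x :
  0 <= m < x ->
  is_derive (fun t => sqrt (t ^ 2 - m ^ 2)) x (x / sqrt (x ^ 2 - m ^ 2)).
Proof.
  intro H. assert (HQ : 0 < x ^ 2 - m ^ 2) by nra.
  auto_derive; [nra |].
  replace (x * (x * 1) + - (m * (m * 1))) with (x ^ 2 - m ^ 2) by ring.
  field. apply Rgt_not_eq, sqrt_lt_R0, HQ.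
Qed.

Lemma is_derive_wkb_phase m x :
  0 <= m < x -> is_derive (wkb_phase m) x (sqrt (x ^ 2 - m ^ 2) / x).
Proof.
  intro H. assert (HQ : 0 < x ^ 2 - m ^ 2) by nra.
  assert (Hd := is_derive_sqrt_diff m x H).
  assert (Hq : 0 < sqrt (x ^ 2 - m ^ 2)) by (apply sqrt_lt_R0, HQ).
  assert (Hq2 : sqrt (x ^ 2 - m ^ 2) * sqrt (x ^ 2 - m ^ 2) = x ^ 2 - m ^ 2)
    by (apply sqrt_sqrt; lra).
  unfold wkb_phase.
  assert (Ha : is_derive (fun t => atan (sqrt (t ^ 2 - m ^ 2) / m)) x
     (x / sqrt (x ^ 2 - m ^ 2) / m * / (1 + (sqrt (x ^ 2 - m ^ 2) / m) ^ 2))).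
  { apply (is_derive_comp_R atan (fun t => sqrt (t ^ 2 - m ^ 2) / m)).
    - apply is_derive_Reals, derivable_pt_lim_atan.
    - apply (is_derive_ext (fun t => / m * sqrt (t ^ 2 - m ^ 2))); [intro; apply Rmult_comm |].
      eapply is_derive_eq; [apply is_derive_scal, Hd | unfold Rdiv; ring]. }
  eapply is_derive_eq.
  - apply is_derive_minus_R; [exact Hd | apply is_derive_scal, Ha].
  - set (q := sqrt (x ^ 2 - m ^ 2)) in *.
    destruct (Req_dec m 0) as [E | E].
    + rewrite E. rewrite E in Hq2. rewrite Rmult_0_l, Rminus_0_r.
      apply (Rmult_eq_reg_r (q * x)); [| apply Rgt_not_eq; nra].
      field_simplify; [nra | lra | lra].
    + assert (Hs : 0 < q ^ 2 + m ^ 2) by nra.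
      transitivity (x / q - x * m ^ 2 / (q * (q ^ 2 + m ^ 2))).
      * field. repeat split; lra.
      * replace (q ^ 2 + m ^ 2) with (x ^ 2) by lra.
        apply (Rmult_eq_reg_r (q * x)); [| apply Rgt_not_eq; nra].
        transitivity (x ^ 2 - m ^ 2); [field; lra |].
        rewrite <- Hq2. field; lra.
Qed.

Lemma wkb_phase_increasing m a b : 0 <= m < a -> a < b -> wkb_phase m a < wkb_phase m b.
Proof.
  intros H Hab.
  destruct (MVT_gen (wkb_phase m) a b (fun x => sqrt (x ^ 2 - m ^ 2) / x)) as [c [Hc1 Hc2]].
  - rewrite Rmin_left, Rmax_right by lra. intros. apply is_derive_wkb_phase. lra.
  - rewrite Rmin_left, Rmax_right by lra. intros.
    apply continuity_pt_filterlim, (ex_derive_continuous (wkb_phase m)).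
    eexists. apply is_derive_wkb_phase. lra.
  - rewrite Rmin_left, Rmax_right in Hc1 by lra.
    assert (0 < sqrt (c ^ 2 - m ^ 2) / c).
    { apply Rdiv_lt_0_compat; [apply sqrt_lt_R0; nra | lra]. }
    nra.
Qed.

(** The Picone quantity (w^2 / Q) (w' / w - w0' / w0), with ' for x d/dx, of w = x J_m' and its
    WKB approximation w0 = Q^(1/4) cos psi, where Q = q^2 = x^2 - m^2, tau = tan psi, and psi is
    the WKB phase up to a constant.  In this form it makes sense at the zeros of w. *)
Definition picone (y w tau q : R -> R) (x : R) : R :=
  - (y x * w x) + w x ^ 2 * (tau x / q x - x ^ 2 / (2 * q x ^ 4)).

(** Completing the square shows the sign: for q^2 <= x^2 the remaining coefficient
    of w^2 is positive. *)
Lemma is_derive_picone (y w tau q : R -> R) (x : R) :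
  0 < x -> 0 < q x ->
  is_derive y x (w x / x) -> is_derive w x (- q x ^ 2 / x * y x) ->
  is_derive tau x ((1 + tau x ^ 2) * q x / x) -> is_derive q x (x / q x) ->
  is_derive (picone y w tau q) x
    (((q x * y x - w x * (tau x - x ^ 2 / (2 * q x ^ 3))) ^ 2
      + w x ^ 2 * (x ^ 2 / q x ^ 6 * (7 / 4 * x ^ 2 - q x ^ 2))) / x).
Proof.
  intros Hx Hq Dy Dw Dt Dq. unfold picone.
  eapply is_derive_eq.
  - auto_derive; [| reflexivity].
    repeat split; try (eexists; eassumption); try exact I; try lra.
    apply Rgt_not_eq. assert (0 < q x * q x) by nra. nra.
  - assert (Ey : Derive (fun t : R => y t) x = w x / x) by exact (is_derive_unique _ _ _ Dy).
    assert (Ew : Derive (fun t : R => w t) x = - q x ^ 2 / x * y x)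
      by exact (is_derive_unique _ _ _ Dw).
    assert (Et : Derive (fun t : R => tau t) x = (1 + tau x ^ 2) * q x / x)
      by exact (is_derive_unique _ _ _ Dt).
    assert (Eq : Derive (fun t : R => q t) x = x / q x) by exact (is_derive_unique _ _ _ Dq).
    rewrite Ey, Ew, Et, Eq. field. lra.
Qed.

(** If the phases of a and b differed by less than pi, the approximation
    centred between them would have no zero on [a, b].  The Picone quantity would then be
    differentiable on [a, b] and vanish at both ends.  At an interior zero of its derivative both
    terms of is_derive_picone vanish, that is J_m = J_m' = 0. *)
Lemma bessel_critical_spacing (m : nat) (a b : R) :
  INR m < a -> a < b -> bessel_d m a = 0 -> bessel_d m b = 0 ->
  wkb_phase (INR m) a + PI <= wkb_phase (INR m) b.
Proof.
  intros Ha Hab Za Zb. assert (Hm := pos_INR m).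
  apply Rnot_lt_le. intro Hlt.
  set (f := wkb_phase (INR m)) in *.
  set (c := (f a + f b) / 2).
  set (q := fun x => sqrt (x ^ 2 - INR m ^ 2)).
  set (tau := fun x => tan (f x - c)).
  set (dP := fun x => ((q x * bessel m x - bessel_d m x * (tau x - x ^ 2 / (2 * q x ^ 3))) ^ 2
      + bessel_d m x ^ 2 * (x ^ 2 / q x ^ 6 * (7 / 4 * x ^ 2 - q x ^ 2))) / x).
  assert (Hq : forall x, a <= x <= b -> 0 < q x /\ q x ^ 2 = x ^ 2 - INR m ^ 2).
  { intros x Hx. assert (HQ : 0 < x ^ 2 - INR m ^ 2) by nra. split.
    - apply sqrt_lt_R0, HQ.
    - unfold q. rewrite pow2_sqrt; lra. }
  assert (Hd : forall x, a <= x <= b ->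
             is_derive (picone (bessel m) (bessel_d m) tau q) x (dP x)).
  { intros x Hx. destruct (Hq x Hx) as [Hq1 Hq2].
    apply is_derive_picone; [lra | exact Hq1 | | | |].
    - apply is_derive_bessel. lra.
    - rewrite Hq2. apply is_derive_bessel_d. lra.
    - unfold tau. eapply is_derive_eq.
      + apply (is_derive_comp_R tan (fun x => f x - c)).
        * apply is_derive_tan. apply Rgt_not_eq, cos_gt_0.
          -- assert (f a <= f x).
             { destruct (Req_dec a x) as [-> | E]; [lra |].
               apply Rlt_le, wkb_phase_increasing; lra. }
             unfold c. lra.
          -- assert (f x <= f b).
             { destruct (Req_dec x b) as [-> | E]; [lra |].
               apply Rlt_le, wkb_phase_increasing; lra. }
             unfold c. lra.
        * apply (is_derive_minus_R f (fun _ => c)); [| apply @is_derive_const].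
          apply is_derive_wkb_phase. lra.
      + fold (q x). unfold zero; simpl. unfold Rdiv. ring.
    - apply is_derive_sqrt_diff. lra. }
  destruct (MVT_gen (picone (bessel m) (bessel_d m) tau q) a b dP) as [x [Hx Hx']].
  - rewrite Rmin_left, Rmax_right by lra. intros. apply Hd. lra.
  - rewrite Rmin_left, Rmax_right by lra. intros.
    apply continuity_pt_filterlim, (ex_derive_continuous (picone (bessel m) (bessel_d m) tau q)).
    eexists. apply Hd. lra.
  - rewrite Rmin_left, Rmax_right in Hx by lra.
    destruct (Hq x Hx) as [Hq1 Hq2].
    unfold picone in Hx'. rewrite Za, Zb in Hx'.
    assert (Hz : dP x = 0).
    { apply (Rmult_eq_reg_r (b - a)); [| lra]. rewrite <- Hx'. ring. }
    unfold dP in Hz.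
    assert (Hk : 0 < x ^ 2 / q x ^ 6 * (7 / 4 * x ^ 2 - q x ^ 2)).
    { apply Rmult_lt_0_compat; [| nra].
      apply Rdiv_lt_0_compat; [nra | apply pow_lt, Hq1]. }
    set (k := x ^ 2 / q x ^ 6 * (7 / 4 * x ^ 2 - q x ^ 2)) in *.
    set (r := q x * bessel m x - bessel_d m x * (tau x - x ^ 2 / (2 * q x ^ 3))) in *.
    assert (Hs : r ^ 2 + bessel_d m x ^ 2 * k = 0).
    { apply (Rmult_eq_reg_r (/ x)); [| apply Rinv_neq_0_compat; lra].
      unfold Rdiv in Hz. rewrite Hz. ring. }
    assert (Hw : bessel_d m x = 0).
    { assert (0 <= r ^ 2) by apply pow2_ge_0. assert (0 <= bessel_d m x ^ 2) by apply pow2_ge_0.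
      assert (bessel_d m x ^ 2 = 0) by nra. nra. }
    assert (Hy : bessel m x = 0).
    { rewrite Hw in Hs. unfold r in Hs. rewrite Hw in Hs. 
      assert ((q x * bessel m x) ^ 2 = 0) by lra.
      assert (q x * bessel m x = 0) by nra. nra. }
    apply (bessel_nondegenerate m x); [lra | exact Hy | exact Hw].
Qed.

(** * Fresnel integrals *)

Lemma ex_RInt_everywhere_continuous (f : R -> R) (a b : R) :
  (forall t, continuous f t) -> ex_RInt f a b.
Proof. intro H. apply (ex_RInt_continuous (V := R_CompleteNormedModule)). intros; apply H. Qed.

Lemma RInt_of_derive (f df : R -> R) (a b : R) :
  (forall x, Rmin a b <= x <= Rmax a b -> is_derive f x (df x)) ->
  (forall x, Rmin a b <= x <= Rmax a b -> continuous df x) ->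
  RInt df a b = f b - f a.
Proof. intros H1 H2. apply is_RInt_unique. exact (is_RInt_derive f df a b H1 H2). Qed.

Lemma RInt_scal_R (k : R) (f : R -> R) (a b : R) :
  (forall t, continuous f t) -> RInt (fun t => k * f t) a b = k * RInt f a b.
Proof.
  intro H. exact (RInt_scal f a b k (ex_RInt_everywhere_continuous f a b H)).
Qed.

Lemma RInt_point_R (f : R -> R) (a : R) : RInt f a a = 0.
Proof. exact (RInt_point a f). Qed.

Lemma RInt_comp_mul (k : R) (f : R -> R) (b : R) :
  (forall t, continuous f t) -> k * RInt (fun v => f (k * v)) 0 b = RInt f 0 (k * b).
Proof.
  intro H. assert (E := RInt_comp_lin f k 0 0 b).
  rewrite Rmult_0_r, !Rplus_0_r in E.
  rewrite <- E by (apply ex_RInt_everywhere_continuous, H).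
  rewrite <- (RInt_scal_R k (fun v => f (k * v))).
  - apply RInt_ext. intros. rewrite Rplus_0_r. reflexivity.
  - intro t. apply (continuous_comp (fun v => k * v) f); [| apply H].
    apply (ex_derive_continuous (fun v => k * v)). auto_derive. exact I.
Qed.

Lemma is_derive_RInt_parameter (f fx : R -> R -> R) (a b x : R) :
  (forall x t, is_derive (fun z => f z t) x (fx x t)) ->
  (forall x t, continuity_2d_pt fx x t) ->
  (forall x t, continuous (f x) t) ->
  is_derive (fun x => RInt (f x) a b) x (RInt (fx x) a b).
Proof.
  intros Hd Hc Hf.
  assert (HD : forall u v, Derive (fun z => f z v) u = fx u v)
    by (intros; apply is_derive_unique, Hd).
  rewrite <- (RInt_ext (fun t => Derive (fun u => f u t) x) (fx x) a b)
    by (intros; apply HD).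
  apply is_derive_RInt_param.
  - apply filter_forall. intros. eexists. apply Hd.
  - intros. apply continuity_2d_pt_ext with (2 := Hc x t).
    intros; symmetry; apply HD.
  - apply filter_forall. intros. apply ex_RInt_everywhere_continuous. intro. apply Hf.
Qed.

Ltac as_real_eq := match goal with |- @eq _ ?a ?b => change (@eq R a b) end.

Ltac solve_continuous f :=
  apply (ex_derive_continuous f); auto_derive; try exact I; repeat split; auto; try lra; try nra.

Lemma abs_RInt_le_interval (f : R -> R) (a b M : R) :
  a <= b -> (forall t, continuous f t) -> (forall t, a <= t <= b -> Rabs (f t) <= M) ->
  Rabs (RInt f a b) <= (b - a) * M.
Proof.
  intros Hab Hc HM. apply abs_RInt_le_const; auto.
  apply ex_RInt_everywhere_continuous. intro. apply Hc.
Qed.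

Lemma Rabs_sin_le_1 x : Rabs (sin x) <= 1.
Proof. apply Rabs_le. assert (H := SIN_bound x). lra. Qed.

Lemma Rabs_cos_le_1 x : Rabs (cos x) <= 1.
Proof. apply Rabs_le. assert (H := COS_bound x). lra. Qed.

Definition fresnel_c (t : R) : R := RInt (fun u => cos (u ^ 2)) 0 t.
Definition fresnel_s (t : R) : R := RInt (fun u => sin (u ^ 2)) 0 t.

Lemma is_derive_RInt_0 (f : R -> R) (t : R) :
  (forall u, continuous f u) -> is_derive (fun t => RInt f 0 t) t (f t).
Proof.
  intro Hc. apply (is_derive_RInt f (fun t => RInt f 0 t) 0 t); [| apply Hc].
  apply filter_forall. intro b. apply @RInt_correct. apply ex_RInt_everywhere_continuous. intro. apply Hc.
Qed.

Lemma continuous_cos_sq_phase theta u : continuous (fun u => cos (u ^ 2 - theta)) u.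
Proof. solve_continuous (fun u => cos (u ^ 2 - theta)). Qed.

Lemma is_derive_fresnel_c t : is_derive fresnel_c t (cos (t ^ 2)).
Proof. apply (is_derive_RInt_0 (fun u => cos (u ^ 2))). intro u. solve_continuous (fun u => cos (u ^ 2)). Qed.

Lemma is_derive_fresnel_s t : is_derive fresnel_s t (sin (t ^ 2)).
Proof. apply (is_derive_RInt_0 (fun u => sin (u ^ 2))). intro u. solve_continuous (fun u => sin (u ^ 2)). Qed.

Lemma RInt_fresnel_phase theta t :
  RInt (fun u => cos (u ^ 2 - theta)) 0 t = cos theta * fresnel_c t + sin theta * fresnel_s t.
Proof.
  rewrite (RInt_of_derive (fun t => cos theta * fresnel_c t + sin theta * fresnel_s t)).
  - unfold fresnel_c, fresnel_s. rewrite !RInt_point_R. as_real_eq. ring.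
  - intros u _. eapply is_derive_eq.
    + apply is_derive_plus_R; apply is_derive_scal; [apply is_derive_fresnel_c | apply is_derive_fresnel_s].
    + rewrite cos_minus. ring.
  - intros. apply continuous_cos_sq_phase.
Qed.

Lemma RInt_unit_fresnel theta t : t <> 0 ->
  RInt (fun v => cos (t ^ 2 * v ^ 2 - theta)) 0 1
  = (cos theta * fresnel_c t + sin theta * fresnel_s t) / t.
Proof.
  intro Ht. rewrite <- RInt_fresnel_phase.
  assert (E : t * RInt (fun v => cos ((t * v) ^ 2 - theta)) 0 1
              = RInt (fun u => cos (u ^ 2 - theta)) 0 t).
  { transitivity (RInt (fun u => cos (u ^ 2 - theta)) 0 (t * 1)).
    - exact (RInt_comp_mul t _ 1 (continuous_cos_sq_phase theta)).
    - rewrite Rmult_1_r. reflexivity. }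
  rewrite <- E.
  rewrite (RInt_ext (fun v => cos (t ^ 2 * v ^ 2 - theta)) (fun v => cos ((t * v) ^ 2 - theta)))
    by (intros; do 2 f_equal; ring).
  symmetry; as_real_eq; field. exact Ht.
Qed.

(** The auxiliary integral of exp (i t^2 (1 + v^2)) / (1 + v^2) that serves to square the
    Fresnel integral.  The rotation by theta lets one statement cover its real and imaginary
    parts. *)
Definition fresnel_rem (theta t : R) : R :=
  RInt (fun v => sin (t ^ 2 * (1 + v ^ 2) - theta) / (1 + v ^ 2)) 0 1.

Lemma is_derive_fresnel_rem theta t :
  is_derive (fresnel_rem theta) t
    (RInt (fun v => 2 * t * cos (t ^ 2 * (1 + v ^ 2) - theta)) 0 1).
Proof.
  apply (is_derive_RInt_parameter (fun t v => sin (t ^ 2 * (1 + v ^ 2) - theta) / (1 + v ^ 2))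
     (fun t v => 2 * t * cos (t ^ 2 * (1 + v ^ 2) - theta))).
  - intros x v. assert (0 < 1 + v ^ 2) by nra. auto_derive; [nra |].
    replace (x * (x * 1) * (1 + v * (v * 1)) + - theta) with (x ^ 2 * (1 + v ^ 2) - theta) by ring.
    field. nra.
  - intros x v. apply continuity_2d_pt_mult.
    + apply (continuity_2d_pt_mult (fun _ _ => 2) (fun x _ => x));
        [apply continuity_2d_pt_const | apply continuity_2d_pt_id1].
    + apply (continuity_1d_2d_pt_comp cos (fun x v => x ^ 2 * (1 + v ^ 2) - theta)).
      * apply continuity_cos.
      * apply (continuity_2d_pt_ext (fun x v => x * x * (1 + v * v) - theta)); [intros; ring |].
        apply continuity_2d_pt_minus; [| apply continuity_2d_pt_const].
        repeat (apply continuity_2d_pt_mult || apply continuity_2d_pt_plus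
              || apply continuity_2d_pt_const || apply continuity_2d_pt_id1
              || apply continuity_2d_pt_id2).
  - intros x v. assert (0 < 1 + v ^ 2) by nra.
    solve_continuous (fun v => sin (x ^ 2 * (1 + v ^ 2) - theta) / (1 + v ^ 2)).
Qed.

(** The left-hand side is the real part of e^(- i theta) (C + i S)^2.  Its
    derivative is twice the integral of cos (t^2 + u^2 - theta) for u in [0, t], and u = t v
    transforms this into the derivative of fresnel_rem.  The angles 0 and pi/2 give C^2 - S^2 and
    2 C S. *)
Lemma fresnel_square_identity theta t :
  cos theta * (fresnel_c t ^ 2 - fresnel_s t ^ 2) + sin theta * (2 * fresnel_c t * fresnel_s t)
  = fresnel_rem theta t + sin theta * (PI / 4).
Proof.
  set (g := fun t => cos theta * (fresnel_c t * fresnel_c t - fresnel_s t * fresnel_s t)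
     + sin theta * (2 * (fresnel_c t * fresnel_s t)) - fresnel_rem theta t).
  assert (Hd : forall t, is_derive g t 0).
  { intro u. assert (Dc := is_derive_fresnel_c u). assert (Ds := is_derive_fresnel_s u).
    eapply is_derive_eq.
    - apply is_derive_minus_R; [| apply is_derive_fresnel_rem].
      apply is_derive_plus_R; apply is_derive_scal.
      + apply is_derive_minus_R; apply is_derive_mult_R; eassumption.
      + apply is_derive_scal, is_derive_mult_R; eassumption.
    - destruct (Req_dec u 0) as [-> | Hu].
      + unfold fresnel_c, fresnel_s. rewrite !RInt_point_R.
        rewrite (RInt_ext _ (fun _ => 0)) by (intros; simpl; ring).
        rewrite RInt_const. unfold zero, scal; simpl. unfold mult; simpl. ring.
      + rewrite (RInt_ext _ (fun v => 2 * u * cos (u ^ 2 * v ^ 2 - (theta - u ^ 2))))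
          by (intros; f_equal; f_equal; ring).
        rewrite RInt_scal_R.
        * rewrite RInt_unit_fresnel by exact Hu.
          rewrite cos_minus, sin_minus. field. exact Hu.
        * intro v. solve_continuous (fun v => cos (u ^ 2 * v ^ 2 - (theta - u ^ 2))). }
  assert (E : g t = g 0).
  { destruct (MVT_gen g 0 t (fun _ => 0)) as [c [_ Hc]].
    - intros; apply Hd.
    - intros; apply continuity_pt_filterlim, (ex_derive_continuous g); eexists; apply Hd.
    - lra. }
  assert (E0 : g 0 = sin theta * (PI / 4)).
  { unfold g, fresnel_c, fresnel_s. rewrite !RInt_point_R. unfold fresnel_rem.
    rewrite (RInt_of_derive (fun v => - sin theta * atan v)).
    - rewrite atan_1, atan_0. ring.
    - intros v _. eapply is_derive_eq.
      + apply is_derive_scal. apply is_derive_Reals, derivable_pt_lim_atan.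
      + replace (0 ^ 2 * (1 + v ^ 2) - theta) with (- theta) by ring.
        rewrite sin_neg. unfold Rdiv. reflexivity.
    - intros v _. assert (0 < 1 + v ^ 2) by nra.
      solve_continuous (fun v => sin (0 ^ 2 * (1 + v ^ 2) - theta) / (1 + v ^ 2)). }
  unfold g in E at 1. rewrite E0 in E. lra.
Qed.

Lemma continuous_fresnel_rem_integrand theta t v :
  continuous (fun v => sin (t ^ 2 * (1 + v ^ 2) - theta) / (1 + v ^ 2)) v.
Proof.
  assert (0 < 1 + v ^ 2) by nra.
  solve_continuous (fun v => sin (t ^ 2 * (1 + v ^ 2) - theta) / (1 + v ^ 2)).
Qed.

Lemma fresnel_rem_le_1 theta t : Rabs (fresnel_rem theta t) <= 1.
Proof.
  replace 1 with ((1 - 0) * 1) by ring.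
  apply abs_RInt_le_interval; [lra | intro; apply continuous_fresnel_rem_integrand |].
  intros v _. unfold Rdiv. rewrite Rabs_mult.
  assert (Hv : 1 <= 1 + v ^ 2) by nra.
  assert (0 < / (1 + v ^ 2) <= 1).
  { split; [apply Rinv_0_lt_compat; lra |]. rewrite <- Rinv_1. apply Rinv_le_contravar; lra. }
  rewrite (Rabs_pos_eq (/ _)) by lra.
  assert (Hs := Rabs_sin_le_1 (t ^ 2 * (1 + v ^ 2) - theta)).
  assert (Hp := Rabs_pos (sin (t ^ 2 * (1 + v ^ 2) - theta))). nra.
Qed.

(** C^2 - S^2 and C S are bounded by the identity, and therefore so are C and S. *)
Lemma fresnel_bounded t : fresnel_c t ^ 2 <= 4 /\ fresnel_s t ^ 2 <= 4.
Proof.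
  assert (H1 := fresnel_square_identity 0 t). rewrite cos_0, sin_0 in H1.
  assert (H2 := fresnel_square_identity (PI / 2) t). rewrite cos_PI2, sin_PI2 in H2.
  assert (B1 := proj1 (Rabs_le_between _ _) (fresnel_rem_le_1 0 t)).
  assert (B2 := proj1 (Rabs_le_between _ _) (fresnel_rem_le_1 (PI / 2) t)).
  assert (HPI := PI_4). assert (HPI0 := PI_RGT_0).
  set (c := fresnel_c t) in *. set (s := fresnel_s t) in *.
  assert (E1 : -1 <= c ^ 2 - s ^ 2 <= 1) by lra.
  assert (E2 : -2 <= 2 * c * s <= 2) by lra.
  assert (Hc : 0 <= c ^ 2) by apply pow2_ge_0. assert (Hs : 0 <= s ^ 2) by apply pow2_ge_0.
  assert (E3 : c ^ 2 * s ^ 2 <= 1).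
  { replace (c ^ 2 * s ^ 2) with ((c * s) * (c * s)) by ring. nra. }
  split; nra.
Qed.

Lemma fresnel_phase_le_4 theta t :
  Rabs (cos theta * fresnel_c t + sin theta * fresnel_s t) <= 4.
Proof.
  destruct (fresnel_bounded t) as [Hc Hs].
  assert (Bc : -2 <= fresnel_c t <= 2) by nra. assert (Bs : -2 <= fresnel_s t <= 2) by nra.
  eapply Rle_trans; [apply Rabs_triang |]. rewrite !Rabs_mult.
  assert (H1 := Rabs_cos_le_1 theta). assert (H2 := Rabs_sin_le_1 theta).
  assert (Rabs (fresnel_c t) <= 2) by (apply Rabs_le; lra).
  assert (Rabs (fresnel_s t) <= 2) by (apply Rabs_le; lra).
  assert (P1 := Rabs_pos (cos theta)). assert (P2 := Rabs_pos (sin theta)).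
  assert (P3 := Rabs_pos (fresnel_c t)). assert (P4 := Rabs_pos (fresnel_s t)).
  nra.
Qed.

(** Integration by parts in the form of an estimate: f is the derivative of A up to
    the small remainder r. *)
Lemma RInt_near_primitive (A f r : R -> R) (a b M : R) :
  a <= b ->
  (forall v, a <= v <= b -> is_derive A v (f v - r v)) ->
  (forall v, a <= v <= b -> continuous f v) ->
  (forall v, a <= v <= b -> continuous r v) ->
  (forall v, a <= v <= b -> Rabs (r v) <= M) ->
  Rabs (RInt f a b - (A b - A a)) <= (b - a) * M.
Proof.
  intros Hab HA Hf Hr HM.
  assert (If : ex_RInt f a b).
  { apply (ex_RInt_continuous (V := R_CompleteNormedModule)).
    rewrite Rmin_left, Rmax_right by lra. exact Hf. }
  assert (Ir : ex_RInt r a b).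
  { apply (ex_RInt_continuous (V := R_CompleteNormedModule)).
    rewrite Rmin_left, Rmax_right by lra. exact Hr. }
  assert (E : RInt (fun v => f v - r v) a b = A b - A a).
  { apply RInt_of_derive; rewrite Rmin_left, Rmax_right by lra; [exact HA |].
    intros v Hv. apply (continuous_minus f r); auto. }
  assert (E' : RInt (fun v => f v - r v) a b = RInt f a b - RInt r a b)
    by exact (RInt_minus f r a b If Ir).
  replace (RInt f a b - (A b - A a)) with (RInt r a b) by lra.
  apply abs_RInt_le_const; assumption.
Qed.

(** With 1 / (1 + v^2) = 1 - v * (v / (1 + v^2)), the first part is a Fresnel integral
    divided by t, and the factor v of the second one cancels the stationary point v = 0 in an
    integration by parts. *)
Lemma fresnel_rem_decay theta t : 1 <= t -> Rabs (fresnel_rem theta t) <= 5 / t.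
Proof.
  intro Ht.
  set (phi := theta + PI / 2 - t ^ 2).
  set (A := fun v => (cos phi * fresnel_c (t * v) + sin phi * fresnel_s (t * v)) / t
              + v / (1 + v ^ 2) * cos (t ^ 2 * (1 + v ^ 2) - theta) / (2 * t ^ 2)).
  set (r := fun v => - ((1 - v ^ 2) / (1 + v ^ 2) ^ 2 * cos (t ^ 2 * (1 + v ^ 2) - theta) / (2 * t ^ 2))).
  assert (H := RInt_near_primitive A
     (fun v => sin (t ^ 2 * (1 + v ^ 2) - theta) / (1 + v ^ 2)) r 0 1 (/ (2 * t ^ 2))).
  fold (fresnel_rem theta t) in H.
  assert (Hk : 0 < / (2 * t ^ 2)) by (apply Rinv_0_lt_compat; nra).
  assert (Hk2 : / (2 * t ^ 2) <= / (2 * t)) by (apply Rinv_le_contravar; nra).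
  assert (Hit : 0 < / t) by (apply Rinv_0_lt_compat; lra).
  rewrite (Rinv_mult 2 t) in Hk2.
  assert (HA0 : A 0 = 0).
  { unfold A, fresnel_c, fresnel_s. rewrite Rmult_0_r, !RInt_point_R. field. lra. }
  assert (HA1 : Rabs (A 1) <= 4 / t + / t / 4).
  { unfold A. rewrite Rmult_1_r.
    eapply Rle_trans; [apply Rabs_triang |]. apply Rplus_le_compat.
    - unfold Rdiv. rewrite Rabs_mult, (Rabs_pos_eq (/ t)) by lra.
      apply Rmult_le_compat_r; [lra | apply fresnel_phase_le_4].
    - replace (1 / (1 + 1 ^ 2) * cos (t ^ 2 * (1 + 1 ^ 2) - theta) / (2 * t ^ 2))
        with (/ (2 * t ^ 2) * / 2 * cos (t ^ 2 * (1 + 1 ^ 2) - theta)) by (field; lra).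
      rewrite Rabs_mult, (Rabs_pos_eq (/ (2 * t ^ 2) * / 2)) by lra.
      assert (Hc := Rabs_cos_le_1 (t ^ 2 * (1 + 1 ^ 2) - theta)).
      generalize (Rabs (cos (t ^ 2 * (1 + 1 ^ 2) - theta))), Hc. intros c Hc'.
      apply Rle_trans with (/ (2 * t ^ 2) * / 2 * 1); [apply Rmult_le_compat_l; lra | lra]. }
  rewrite HA0, Rminus_0_r in H.
  assert (B : Rabs (fresnel_rem theta t - A 1) <= (1 - 0) * / (2 * t ^ 2)).
  { apply H; [lra | | | |].
    - intros v _. assert (Hv : 0 < 1 + v ^ 2) by nra.
      eapply is_derive_eq.
      + apply is_derive_plus_R.
        * apply (is_derive_ext (fun v => / t * (cos phi * fresnel_c (t * v) + sin phi * fresnel_s (t * v))));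
            [intro; apply Rmult_comm |].
          apply is_derive_scal, is_derive_plus_R; apply is_derive_scal.
          -- apply (is_derive_comp_R fresnel_c (fun v => t * v)); [apply is_derive_fresnel_c |].
             auto_derive; [exact I | reflexivity].
          -- apply (is_derive_comp_R fresnel_s (fun v => t * v)); [apply is_derive_fresnel_s |].
             auto_derive; [exact I | reflexivity].
        * auto_derive; [nra | reflexivity].
      + assert (Es : sin (t ^ 2 * (1 + v ^ 2) - theta)
                     = cos phi * cos ((t * v) ^ 2) + sin phi * sin ((t * v) ^ 2)).
        { rewrite <- cos_shift, <- cos_minus. unfold phi. f_equal. ring. }
        replace (t * (t * 1) * (1 + v * (v * 1)) + - theta) with (t ^ 2 * (1 + v ^ 2) - theta) by ring.
        unfold r. rewrite Es. field. split; nra.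
    - intros v _. apply continuous_fresnel_rem_integrand.
    - intros v _. unfold r. assert (0 < 1 + v ^ 2) by nra. assert (0 < (1 + v ^ 2) ^ 2) by nra.
      solve_continuous (fun v => - ((1 - v ^ 2) / (1 + v ^ 2) ^ 2 * cos (t ^ 2 * (1 + v ^ 2) - theta) / (2 * t ^ 2))).
    - intros v Hv. unfold r. rewrite Rabs_Ropp. unfold Rdiv. rewrite !Rabs_mult.
      rewrite (Rabs_pos_eq (/ (2 * t ^ 2))) by lra.
      assert (Hq : 1 <= (1 + v ^ 2) ^ 2) by nra.
      assert (Hi : 0 < / (1 + v ^ 2) ^ 2 <= 1).
      { split; [apply Rinv_0_lt_compat; lra |]. rewrite <- Rinv_1. apply Rinv_le_contravar; lra. }
      rewrite (Rabs_pos_eq (/ (1 + v ^ 2) ^ 2)) by lra.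
      rewrite (Rabs_pos_eq (1 - v ^ 2)) by nra.
      assert (Hc := Rabs_cos_le_1 (t ^ 2 * (1 + v ^ 2) - theta)).
      assert (Hp := Rabs_pos (cos (t ^ 2 * (1 + v ^ 2) - theta))).
      assert (0 <= (1 - v ^ 2) * / (1 + v ^ 2) ^ 2 <= 1) by (assert (0 <= v ^ 2 <= 1) by nra; nra).
      rewrite <- (Rmult_1_l (/ (2 * t ^ 2))) at 2. apply Rmult_le_compat_r; [lra |]. nra. }
  replace (fresnel_rem theta t) with ((fresnel_rem theta t - A 1) + A 1) by ring.
  eapply Rle_trans; [apply Rabs_triang |]. unfold Rdiv in *. lra.
Qed.

Lemma is_lim_0_of_le_inv (f : R -> R) (K : R) :
  (forall t, 1 <= t -> Rabs (f t) <= K / t) -> is_lim f p_infty 0.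
Proof.
  intro H. apply is_lim_le_le_loc with (f := fun t => - (K * / t)) (g := fun t => K * / t).
  - exists 1. intros t Ht. apply Rabs_le_between. apply H. lra.
  - replace (Finite 0) with (Rbar_opp (Rbar_mult K 0)) by (simpl; f_equal; ring).
    apply is_lim_opp. apply is_lim_scal_l.
    replace (Finite 0) with (Rbar_inv p_infty) by reflexivity.
    apply is_lim_inv; [apply is_lim_id | discriminate].
  - replace (Finite 0) with (Rbar_mult K 0) by (simpl; f_equal; ring).
    apply is_lim_scal_l.
    replace (Finite 0) with (Rbar_inv p_infty) by reflexivity.
    apply is_lim_inv; [apply is_lim_id | discriminate].
Qed.

Lemma is_lim_0_eventually (f : R -> R) (eps : R) :
  0 < eps -> is_lim f p_infty 0 -> exists T, forall t, T < t -> Rabs (f t) < eps.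
Proof.
  intros He H. apply is_lim_spec in H. destruct (H (mkposreal eps He)) as [T HT].
  exists T. intros t Ht. specialize (HT t Ht). simpl in HT. rewrite Rminus_0_r in HT. exact HT.
Qed.

Lemma is_lim_0_intro (f : R -> R) :
  (forall eps, 0 < eps -> exists T, forall t, T < t -> Rabs (f t) < eps) -> is_lim f p_infty 0.
Proof.
  intro H. apply is_lim_spec. intro eps. destruct (H eps (cond_pos eps)) as [T HT].
  exists T. intros t Ht. rewrite Rminus_0_r. apply HT, Ht.
Qed.

(** C^2 - S^2 tends to 0 and 2 C S to pi/4, so C - S tends to 0 and (C + S)^2 to pi/2.
    The sign of l is left open: it changes the sign of J_m in the asymptotics below, not its
    zeros. *)
Lemma fresnel_limit :
  exists l, l <> 0 /\ is_lim (fun t => fresnel_c t - l) p_infty 0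
                   /\ is_lim (fun t => fresnel_s t - l) p_infty 0.
Proof.
  assert (L0 := is_lim_0_of_le_inv _ _ (fresnel_rem_decay 0)).
  assert (L1 := is_lim_0_of_le_inv _ _ (fresnel_rem_decay (PI / 2))).
  assert (HPI := PI2_3_2).
  assert (K0 : forall t, fresnel_c t ^ 2 - fresnel_s t ^ 2 = fresnel_rem 0 t).
  { intro t. assert (H := fresnel_square_identity 0 t). rewrite cos_0, sin_0 in H. lra. }
  assert (K1 : forall t, 2 * fresnel_c t * fresnel_s t = fresnel_rem (PI / 2) t + PI / 4).
  { intro t. assert (H := fresnel_square_identity (PI / 2) t). rewrite cos_PI2, sin_PI2 in H. lra. }
  set (s := sqrt (PI / 2)).
  assert (Hs : s * s = PI / 2) by (apply sqrt_sqrt; lra).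
  assert (Hs1 : 1 <= s) by (rewrite <- sqrt_1; apply sqrt_le_1; lra).
  destruct (is_lim_0_eventually _ (1 / 10) ltac:(lra) L1) as [T HT].
  (* the sum C + S stays away from 0, so by continuity it has a constant sign *)
  assert (Hsum : forall t, T < t -> 1 <= (fresnel_c t + fresnel_s t) ^ 2).
  { intros t Ht. specialize (HT t Ht). apply Rabs_lt_between in HT.
    assert (0 <= (fresnel_c t - fresnel_s t) ^ 2) by apply pow2_ge_0.
    assert (H1 := K1 t). nra. }
  assert (Hcont : forall t, continuous (fun t => fresnel_c t + fresnel_s t) t).
  { intro t. apply (ex_derive_continuous (fun t => fresnel_c t + fresnel_s t)).
    eexists. apply is_derive_plus_R; [apply is_derive_fresnel_c | apply is_derive_fresnel_s]. }
  assert (Hsign : exists e, (e = 1 \/ e = -1) /\ forall t, T < t -> 1 <= e * (fresnel_c t + fresnel_s t)).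
  { assert (Ht0 := Hsum (T + 1) ltac:(lra)).
    set (F := fun t => fresnel_c t + fresnel_s t) in *.
    assert (Hiv : forall a b, T < a -> T < b -> F a < 0 -> 0 < F b -> False).
    { intros a b Ha Hb Fa Fb.
      destruct (IVT_gen F a b 0) as [c [Hc Hc0]].
      - intro x. apply continuity_pt_filterlim, Hcont.
      - rewrite Rmin_left, Rmax_right by lra. lra.
      - assert (Tc : T < c).
        { eapply Rlt_le_trans; [| apply Hc]. apply Rmin_glb_lt; assumption. }
        specialize (Hsum c Tc). fold (F c) in Hsum. rewrite Hc0 in Hsum. lra. }
    destruct (Rlt_le_dec (F (T + 1)) 0) as [Hneg | Hpos].
    - exists (-1). split; [right; reflexivity |]. intros t Ht.
      specialize (Hsum t Ht). fold (F t) in Hsum |- *.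
      destruct (Rlt_le_dec 0 (F t)) as [Hp | Hn]; [elim (Hiv (T + 1) t); lra | nra].
    - exists 1. split; [left; reflexivity |]. intros t Ht.
      specialize (Hsum t Ht). fold (F t) in Hsum |- *. fold (F (T + 1)) in Ht0.
      assert (0 < F (T + 1)) by nra.
      destruct (Rlt_le_dec (F t) 0) as [Hn | Hp]; [elim (Hiv t (T + 1)); lra | nra]. }
  destruct Hsign as [e [He Hsign]].
  exists (e * s / 2). split; [destruct He as [-> | ->]; nra |].
  assert (Hmain : forall eps, 0 < eps -> exists T', forall t, T' < t ->
             Rabs (fresnel_c t - e * s / 2) < eps /\ Rabs (fresnel_s t - e * s / 2) < eps).
  { intros eps Heps. set (d := Rmin (eps / 8) (1/10)).
    assert (Hd : 0 < d <= 1/10 /\ d <= eps / 8).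
    { unfold d. split; [split |]; [apply Rmin_glb_lt; lra | apply Rmin_r | apply Rmin_l]. }
    destruct (is_lim_0_eventually _ d ltac:(lra) L0) as [T0 HT0].
    destruct (is_lim_0_eventually _ d ltac:(lra) L1) as [T1 HT1].
    exists (Rmax T (Rmax T0 T1)). intros t Ht.
    assert (Ht' : T < t /\ T0 < t /\ T1 < t).
    { assert (A := Rmax_l T (Rmax T0 T1)). assert (B := Rmax_r T (Rmax T0 T1)).
      assert (C := Rmax_l T0 T1). assert (D := Rmax_r T0 T1). lra. }
    specialize (HT0 t ltac:(tauto)). specialize (HT1 t ltac:(tauto)).
    specialize (Hsign t ltac:(tauto)).
    apply Rabs_lt_between in HT0, HT1. rewrite <- K0 in HT0.
    assert (H1 := K1 t).
    set (c := fresnel_c t) in *. set (sn := fresnel_s t) in *.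
    (* u tends to s and w tends to 0, because u w = C^2 - S^2 and u^2 = w^2 + 4 C S *)
    set (u := e * (c + sn)) in *. set (w := e * (c - sn)).
    assert (He2 : e * e = 1) by (destruct He as [-> | ->]; lra).
    assert (Euw : u * w = c ^ 2 - sn ^ 2).
    { unfold u, w. transitivity ((e * e) * (c ^ 2 - sn ^ 2)); [ring | rewrite He2; ring]. }
    assert (Hw : - d < w < d) by (split; nra).
    assert (Eu : u * u = w * w + 4 * c * sn).
    { unfold u, w. transitivity ((e * e) * (c + sn) ^ 2); [ring |].
      transitivity ((e * e) * (c - sn) ^ 2 + 4 * c * sn); [rewrite He2; ring | ring]. }
    assert (Hu : - (3 * d) < u - s < 3 * d).
    { assert (Hus : (u - s) * (u + s) = w * w + 2 * fresnel_rem (PI / 2) t)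
        by (replace ((u - s) * (u + s)) with (u * u - s * s) by ring; lra).
      assert (-(3 * d) < (u - s) * (u + s) < 3 * d) by (split; nra).
      split; nra. }
    assert (Ec : e * (c - e * s / 2) = (u - s + w) / 2) by (unfold u, w; nra).
    assert (Es : e * (sn - e * s / 2) = (u - s - w) / 2) by (unfold u, w; nra).
    split; apply Rabs_def1; destruct He as [-> | ->]; lra. }
  split; apply is_lim_0_intro; intros eps Heps; destruct (Hmain eps Heps) as [T' HT'];
    exists T'; intros t Ht; apply (HT' t Ht).
Qed.

(** * Asymptotics of Bessel functions *)

(** Poisson's integrals for J_0 and J_1, up to the factor pi/2. *)
Definition poisson_0 (x : R) : R := RInt (fun a => cos (x * cos (2 * a))) 0 (PI / 2).
Definition poisson_1 (x : R) : R :=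
  RInt (fun a => cos (2 * a) * sin (x * cos (2 * a))) 0 (PI / 2).

Ltac solve_continuity_2d :=
  repeat first
    [ apply continuity_2d_pt_const | apply continuity_2d_pt_id1 | apply continuity_2d_pt_id2
    | apply continuity_2d_pt_mult | apply continuity_2d_pt_plus | apply continuity_2d_pt_minus
    | apply continuity_2d_pt_opp ].

Lemma continuity_2d_cos_double x a : continuity_2d_pt (fun _ a => cos (2 * a)) x a.
Proof.
  apply (continuity_1d_2d_pt_comp cos (fun _ a => 2 * a)); [apply continuity_cos |].
  solve_continuity_2d.
Qed.

Lemma is_derive_poisson_0 x : is_derive poisson_0 x (- poisson_1 x).
Proof.
  eapply is_derive_eq.
  - apply (is_derive_RInt_parameter (fun x a => cos (x * cos (2 * a)))
      (fun x a => -1 * (cos (2 * a) * sin (x * cos (2 * a))))).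
    + intros. auto_derive; [exact I | ring].
    + intros. apply continuity_2d_pt_mult; [apply continuity_2d_pt_const |].
      apply continuity_2d_pt_mult; [apply continuity_2d_cos_double |].
      apply (continuity_1d_2d_pt_comp sin (fun x a => x * cos (2 * a))); [apply continuity_sin |].
      apply continuity_2d_pt_mult; [apply continuity_2d_pt_id1 | apply continuity_2d_cos_double].
    + intros x0 t. solve_continuous (fun a => cos (x0 * cos (2 * a))).
  - rewrite RInt_scal_R.
    + unfold poisson_1. ring.
    + intro a. solve_continuous (fun a => cos (2 * a) * sin (x * cos (2 * a))).
Qed.

Lemma is_derive_poisson_1_RInt x :
  is_derive poisson_1 x (RInt (fun a => cos (2 * a) * (cos (2 * a) * cos (x * cos (2 * a)))) 0 (PI / 2)).
Proof.
  apply (is_derive_RInt_parameter (fun x a => cos (2 * a) * sin (x * cos (2 * a)))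
      (fun x a => cos (2 * a) * (cos (2 * a) * cos (x * cos (2 * a))))).
  - intros. auto_derive; [exact I | ring].
  - intros. apply continuity_2d_pt_mult; [apply continuity_2d_cos_double |].
    apply continuity_2d_pt_mult; [apply continuity_2d_cos_double |].
    apply (continuity_1d_2d_pt_comp cos (fun x a => x * cos (2 * a))); [apply continuity_cos |].
    apply continuity_2d_pt_mult; [apply continuity_2d_pt_id1 | apply continuity_2d_cos_double].
  - intros x0 t. solve_continuous (fun a => cos (2 * a) * sin (x0 * cos (2 * a))).
Qed.

Lemma is_derive_poisson_1 x :
  x <> 0 -> is_derive poisson_1 x (poisson_0 x - poisson_1 x / x).
Proof.
  intro Hx. eapply is_derive_eq; [apply is_derive_poisson_1_RInt |].
    set (f := fun a => cos (2 * a) * (cos (2 * a) * cos (x * cos (2 * a)))).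
    set (f0 := fun a => cos (x * cos (2 * a))).
    set (f1 := fun a => cos (2 * a) * sin (x * cos (2 * a))).
    assert (Cf : forall a, continuous f a).
    { intro a. unfold f. solve_continuous (fun a => cos (2 * a) * (cos (2 * a) * cos (x * cos (2 * a)))). }
    assert (C0 : forall a, continuous f0 a).
    { intro a. unfold f0. solve_continuous (fun a => cos (x * cos (2 * a))). }
    assert (C1 : forall a, continuous f1 a).
    { intro a. unfold f1. solve_continuous (fun a => cos (2 * a) * sin (x * cos (2 * a))). }
    assert (I0 := ex_RInt_everywhere_continuous f0 0 (PI / 2) C0).
    assert (I1 := ex_RInt_everywhere_continuous f1 0 (PI / 2) C1).
    assert (E : RInt (fun a => f0 a - / x * f1 a) 0 (PI / 2)
                = RInt f0 0 (PI / 2) - / x * RInt f1 0 (PI / 2)).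
    { rewrite <- (RInt_scal_R (/ x) f1) by exact C1.
      apply (RInt_minus f0 (fun a => / x * f1 a)); [exact I0 |].
      apply (ex_RInt_scal f1 0 (PI / 2) (/ x) I1). }
    assert (Cm : forall a, continuous (fun a => f0 a - / x * f1 a) a).
    { intro a. apply (continuous_minus f0 (fun a => / x * f1 a)); [apply C0 |].
      apply (continuous_scal_r (/ x) f1), C1. }
    assert (Z : RInt (fun a => f a - (f0 a - / x * f1 a)) 0 (PI / 2)
                = / (2 * x) * (sin (2 * (PI / 2)) * sin (x * cos (2 * (PI / 2))))
                  - / (2 * x) * (sin (2 * 0) * sin (x * cos (2 * 0)))).
    { apply (RInt_of_derive (fun a => / (2 * x) * (sin (2 * a) * sin (x * cos (2 * a))))).
      - intros a _. auto_derive; [exact I |]. unfold f, f0, f1.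
        assert (Hs := sin2_cos2 (2 * a)). unfold Rsqr in Hs.
        set (c := cos (2 * a)) in *. set (s := sin (2 * a)) in *.
        transitivity (c * sin (x * c) / x - (s * s) * cos (x * c)); [field; exact Hx |].
        replace (s * s) with (1 - c * c) by lra. field. exact Hx.
      - intros a _. apply (continuous_minus f (fun a => f0 a - / x * f1 a)); auto. }
    replace (2 * (PI / 2)) with PI in Z by field. rewrite Rmult_0_r, sin_0, sin_PI in Z.
    assert (Z' : RInt (fun a => f a - (f0 a - / x * f1 a)) 0 (PI / 2)
                 = RInt f 0 (PI / 2) - RInt (fun a => f0 a - / x * f1 a) 0 (PI / 2)).
    { apply (RInt_minus f (fun a => f0 a - / x * f1 a));
        apply ex_RInt_everywhere_continuous; assumption. }
    unfold poisson_0, poisson_1. fold f0 f1. unfold Rdiv at 3. rewrite (Rmult_comm (RInt f1 _ _)).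
    rewrite E in Z'. change (RInt f 0 (PI / 2) = RInt f0 0 (PI / 2) - / x * RInt f1 0 (PI / 2)).
    lra.
Qed.

Lemma bessel_0_0 : bessel 0 0 = 1.
Proof. unfold bessel. replace (0 ^ 2 / 4) with 0 by field. rewrite clifford_0. simpl. field. Qed.

Lemma bessel_1_0 : bessel 1 0 = 0.
Proof. unfold bessel. simpl. field. Qed.

Lemma bessel_continuous m x : continuous (bessel m) x.
Proof.
  unfold bessel. apply (continuous_mult (fun x => (x / 2) ^ m) (fun x => clifford m (x ^ 2 / 4))).
  - apply (ex_derive_continuous (fun x => (x / 2) ^ m)). auto_derive. exact I.
  - apply (continuous_comp (fun x => x ^ 2 / 4) (clifford m)); [| apply clifford_continuous].
    apply (ex_derive_continuous (fun x => x ^ 2 / 4)). auto_derive. exact I.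
Qed.

Lemma is_derive_bessel_0 x : x <> 0 -> is_derive (bessel 0) x (- bessel 1 x).
Proof.
  intro Hx. eapply is_derive_eq; [apply is_derive_bessel, Hx |].
  unfold bessel_d. simpl. field. exact Hx.
Qed.

Lemma is_derive_bessel_1 x : x <> 0 -> is_derive (bessel 1) x (bessel 0 x - bessel 1 x / x).
Proof.
  intro Hx. eapply is_derive_eq; [apply is_derive_bessel, Hx |].
  unfold bessel_d. assert (H := bessel_rec 0 x). simpl INR in *.
  apply (Rmult_eq_reg_r x); [| exact Hx]. field_simplify; [lra | exact Hx | exact Hx].
Qed.

Lemma poisson_0_0 : poisson_0 0 = PI / 2.
Proof.
  unfold poisson_0. rewrite (RInt_ext _ (fun _ => 1)).
  - rewrite RInt_const. unfold scal; simpl. unfold mult; simpl. ring.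
  - intros. rewrite Rmult_0_l. apply cos_0.
Qed.

Lemma poisson_1_0 : poisson_1 0 = 0.
Proof.
  unfold poisson_1. rewrite (RInt_ext _ (fun _ => 0)).
  - rewrite RInt_const. unfold scal; simpl. unfold mult; simpl. ring.
  - intros. rewrite Rmult_0_l, sin_0. apply Rmult_0_r.
Qed.

Lemma poisson_1_continuous x : continuous poisson_1 x.
Proof. apply (ex_derive_continuous poisson_1). eexists. apply is_derive_poisson_1_RInt. Qed.

(** Both pairs of functions satisfy the same first-order system with the same values
    at 0, and the squared norm of their difference is nonincreasing. *)
Lemma bessel_poisson x : 0 < x ->
  poisson_0 x = PI / 2 * bessel 0 x /\ poisson_1 x = PI / 2 * bessel 1 x.
Proof.
  intro Hx.
  set (d0 := fun x => poisson_0 x - PI / 2 * bessel 0 x).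
  set (d1 := fun x => poisson_1 x - PI / 2 * bessel 1 x).
  set (g := fun x => d0 x * d0 x + d1 x * d1 x).
  assert (D0 : forall t, t <> 0 -> is_derive d0 t (- d1 t)).
  { intros t Ht. eapply is_derive_eq.
    - apply is_derive_minus_R; [apply is_derive_poisson_0 | apply is_derive_scal, is_derive_bessel_0, Ht].
    - unfold d1. ring. }
  assert (D1 : forall t, t <> 0 -> is_derive d1 t (d0 t - d1 t / t)).
  { intros t Ht. eapply is_derive_eq.
    - apply is_derive_minus_R;
        [apply is_derive_poisson_1, Ht | apply is_derive_scal, is_derive_bessel_1, Ht].
    - unfold d0, d1. field. exact Ht. }
  assert (Dg : forall t, t <> 0 -> is_derive g t (- 2 * (d1 t * d1 t) / t)).
  { intros t Ht. eapply is_derive_eq.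
    - apply is_derive_plus_R; apply is_derive_mult_R; auto.
    - field. exact Ht. }
  assert (C0 : forall t, continuous d0 t).
  { intro t. apply (continuous_minus poisson_0 (fun x => PI / 2 * bessel 0 x)).
    - apply (ex_derive_continuous poisson_0). eexists. apply is_derive_poisson_0.
    - apply (continuous_scal_r (PI / 2) (bessel 0)), bessel_continuous. }
  assert (C1 : forall t, continuous d1 t).
  { intro t. apply (continuous_minus poisson_1 (fun x => PI / 2 * bessel 1 x)).
    - apply poisson_1_continuous.
    - apply (continuous_scal_r (PI / 2) (bessel 1)), bessel_continuous. }
  assert (G0 : g 0 = 0).
  { unfold g, d0, d1. rewrite poisson_0_0, poisson_1_0, bessel_0_0, bessel_1_0. ring. }
  assert (Hg : g x <= 0).
  { destruct (MVT_gen g 0 x (fun t => - 2 * (d1 t * d1 t) / t)) as [c [Hc Hc']].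
    - rewrite Rmin_left, Rmax_right by lra. intros. apply Dg. lra.
    - intros. apply continuity_pt_filterlim.
      apply (continuous_plus (fun t => d0 t * d0 t) (fun t => d1 t * d1 t)).
      + apply (continuous_mult d0 d0); auto.
      + apply (continuous_mult d1 d1); auto.
    - rewrite Rmin_left, Rmax_right in Hc by lra.
      rewrite G0 in Hc'.
      assert (0 <= d1 c * d1 c) by nra.
      destruct (Req_dec c 0) as [-> | Hc0].
      + assert (D10 : d1 0 = 0) by (unfold d1; rewrite poisson_1_0, bessel_1_0; ring).
        rewrite D10 in Hc'. unfold Rdiv in Hc'. lra.
      + assert (0 < / c) by (apply Rinv_0_lt_compat; lra).
        assert (0 <= (d1 c * d1 c) * / c) by nra. unfold Rdiv in Hc'. nra. }
  unfold g in Hg.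
  assert (d0 x = 0) by nra. assert (d1 x = 0) by nra. unfold d0, d1 in *. lra.
Qed.

Lemma RInt_odd_half (h : R -> R) :
  (forall c, h (- c) = - h c) -> (forall c, continuous h c) ->
  RInt (fun a => h (cos (2 * a))) 0 (PI / 2) = 0.
Proof.
  intros Hodd Hc.
  assert (Cf : forall a, continuous (fun a => h (cos (2 * a))) a).
  { intro a. apply (continuous_comp (fun a => cos (2 * a)) h); [| apply Hc].
    solve_continuous (fun a => cos (2 * a)). }
  set (f := fun a => h (cos (2 * a))) in *.
  assert (E := RInt_comp_lin f (-1) (PI / 2) 0 (PI / 2)
                 (ex_RInt_everywhere_continuous f _ _ Cf)).
  replace (-1 * 0 + PI / 2) with (PI / 2) in E by ring.
  replace (-1 * (PI / 2) + PI / 2) with 0 in E by ring.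
  rewrite <- (opp_RInt_swap f 0 (PI / 2)) in E by (apply ex_RInt_everywhere_continuous, Cf).
  rewrite (RInt_ext _ f) in E.
  - unfold opp in E; simpl in E. change (RInt f 0 (PI / 2) = - RInt f 0 (PI / 2)) in E. lra.
  - intros a _. unfold scal; simpl; unfold mult; simpl. unfold f.
    replace (2 * (-1 * a + PI / 2)) with (- (2 * a) + PI) by field.
    rewrite neg_cos, cos_neg, Hodd. ring.
Qed.

Lemma RInt_plus_R (f g : R -> R) a b :
  (forall t, continuous f t) -> (forall t, continuous g t) ->
  RInt (fun t => f t + g t) a b = RInt f a b + RInt g a b.
Proof.
  intros Hf Hg. exact (RInt_plus f g a b (ex_RInt_everywhere_continuous f a b Hf)
                          (ex_RInt_everywhere_continuous g a b Hg)).
Qed.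

(** The phase x cos (2 a) becomes x - 2 x sin^2 a, with stationary point a = 0.  The terms
    that are odd in cos (2 a) integrate to 0, which allows the weight 1 + cos (2 a) = 2 cos^2 a
    that vanishes at the other end. *)
Lemma poisson_phase theta x :
  cos (x - theta) * poisson_0 x + sin (x - theta) * poisson_1 x
  = RInt (fun a => 2 * cos a ^ 2 * cos (2 * x * sin a ^ 2 - theta)) 0 (PI / 2).
Proof.
  set (p := x - theta).
  assert (Z0 : RInt (fun a => cos (2 * a) * cos (x * cos (2 * a))) 0 (PI / 2) = 0).
  { apply (RInt_odd_half (fun c => c * cos (x * c))).
    - intro c. replace (x * - c) with (- (x * c)) by ring. rewrite cos_neg. ring.
    - intro c. solve_continuous (fun c => c * cos (x * c)). }
  assert (Z1 : RInt (fun a => sin (x * cos (2 * a))) 0 (PI / 2) = 0).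
  { apply (RInt_odd_half (fun c => sin (x * c))).
    - intro c. replace (x * - c) with (- (x * c)) by ring. apply sin_neg.
    - intro c. solve_continuous (fun c => sin (x * c)). }
  rewrite (RInt_ext (fun a => 2 * cos a ^ 2 * cos (2 * x * sin a ^ 2 - theta))
    (fun a => cos p * (cos (x * cos (2 * a)) + cos (2 * a) * cos (x * cos (2 * a)))
            + sin p * (sin (x * cos (2 * a)) + cos (2 * a) * sin (x * cos (2 * a))))).
  - assert (C0 : forall a, continuous (fun a => cos (x * cos (2 * a))) a)
      by (intro a; solve_continuous (fun a => cos (x * cos (2 * a)))).
    assert (C1 : forall a, continuous (fun a => sin (x * cos (2 * a))) a)
      by (intro a; solve_continuous (fun a => sin (x * cos (2 * a)))).
    assert (C2 : forall a, continuous (fun a => cos (2 * a) * cos (x * cos (2 * a))) a)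
      by (intro a; solve_continuous (fun a => cos (2 * a) * cos (x * cos (2 * a)))).
    assert (C3 : forall a, continuous (fun a => cos (2 * a) * sin (x * cos (2 * a))) a)
      by (intro a; solve_continuous (fun a => cos (2 * a) * sin (x * cos (2 * a)))).
    assert (C4 : forall a, continuous (fun a => cos (x * cos (2 * a)) + cos (2 * a) * cos (x * cos (2 * a))) a)
      by (intro a; solve_continuous (fun a => cos (x * cos (2 * a)) + cos (2 * a) * cos (x * cos (2 * a)))).
    assert (C5 : forall a, continuous (fun a => sin (x * cos (2 * a)) + cos (2 * a) * sin (x * cos (2 * a))) a)
      by (intro a; solve_continuous (fun a => sin (x * cos (2 * a)) + cos (2 * a) * sin (x * cos (2 * a)))).
    rewrite (RInt_plus_R (fun a => cos p * (cos (x * cos (2 * a)) + cos (2 * a) * cos (x * cos (2 * a))))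
       (fun a => sin p * (sin (x * cos (2 * a)) + cos (2 * a) * sin (x * cos (2 * a))))).
    + rewrite !RInt_scal_R by assumption. rewrite !RInt_plus_R by assumption.
      rewrite Z0, Z1. unfold poisson_0, poisson_1. ring.
    + intro a. apply (continuous_scal_r (cos p) (fun a => cos (x * cos (2 * a)) + cos (2 * a) * cos (x * cos (2 * a)))), C4.
    + intro a. apply (continuous_scal_r (sin p) (fun a => sin (x * cos (2 * a)) + cos (2 * a) * sin (x * cos (2 * a)))), C5.
  - intros a _.
    assert (Hs := sin2_cos2 a). unfold Rsqr in Hs.
    assert (H2 : cos (2 * a) = 2 * cos a ^ 2 - 1) by (rewrite cos_2a_cos; ring).
    replace (2 * x * sin a ^ 2 - theta) with (p - x * cos (2 * a))
      by (rewrite H2; unfold p; replace (cos a ^ 2) with (1 - sin a ^ 2) by (simpl; lra); ring).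
    rewrite cos_minus. replace (2 * cos a ^ 2) with (1 + cos (2 * a)) by lra. as_real_eq. ring.
Qed.

(** For the weight 2 cos a instead of 2 cos^2 a, the substitution s = sin a turns
    the integral into a Fresnel integral exactly.  The difference 2 cos a (1 - cos a) of the
    weights vanishes at the stationary point and is of order 1 / x after an integration by
    parts. *)
Lemma stationary_phase_bound theta x : 0 < x ->
  Rabs (RInt (fun a => 2 * cos a ^ 2 * cos (2 * x * sin a ^ 2 - theta)) 0 (PI / 2)
        - 2 / sqrt (2 * x) * (cos theta * fresnel_c (sqrt (2 * x)) + sin theta * fresnel_s (sqrt (2 * x))))
  <= 2 / x.
Proof.
  intro Hx. set (k := sqrt (2 * x)).
  assert (Hk : 0 < k) by (apply sqrt_lt_R0; lra).
  assert (Hk2 : k * k = 2 * x) by (apply sqrt_sqrt; lra).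
  assert (HPI := PI_4). assert (HPI0 := PI_RGT_0).
  set (arg := fun a => 2 * x * sin a ^ 2 - theta).
  set (A := fun a => 2 / k * (cos theta * fresnel_c (k * sin a) + sin theta * fresnel_s (k * sin a))
              - / (2 * x) * (sin a / (1 + cos a) * sin (arg a))).
  set (r := fun a => / (2 * x) * (/ (1 + cos a) * sin (arg a))).
  assert (Hix : 0 < / x) by (apply Rinv_0_lt_compat; lra).
  assert (Hcos : forall a, 0 <= a <= PI / 2 -> 0 <= cos a) by (intros; apply cos_ge_0; lra).
  assert (H : Rabs (RInt (fun a => 2 * cos a ^ 2 * cos (arg a)) 0 (PI / 2) - (A (PI / 2) - A 0))
              <= (PI / 2 - 0) * / (2 * x)).
  { apply RInt_near_primitive with (r := r); [lra | | | |].
    - intros a Ha. specialize (Hcos a Ha). unfold A. eapply is_derive_eq.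
      + apply is_derive_minus_R.
        * apply is_derive_scal, is_derive_plus_R; apply is_derive_scal.
          -- apply (is_derive_comp_R fresnel_c (fun a => k * sin a)); [apply is_derive_fresnel_c |].
             auto_derive; [exact I | reflexivity].
          -- apply (is_derive_comp_R fresnel_s (fun a => k * sin a)); [apply is_derive_fresnel_s |].
             auto_derive; [exact I | reflexivity].
        * unfold arg. auto_derive; [lra | reflexivity].
      + assert (E : cos (arg a) = cos theta * cos ((k * sin a) ^ 2) + sin theta * sin ((k * sin a) ^ 2)).
        { rewrite <- cos_minus, <- cos_neg. unfold arg. f_equal.
          replace ((k * sin a) ^ 2) with ((k * k) * sin a ^ 2) by ring. rewrite Hk2. ring. }
        replace (2 * x * (sin a * (sin a * 1)) + - theta) with (arg a) by (unfold arg; ring).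
        unfold r.
        transitivity (2 * cos a * (cos theta * cos ((k * sin a) ^ 2) + sin theta * sin ((k * sin a) ^ 2))
          - / (2 * x) * ((cos a * (1 + cos a) + sin a * sin a) / (1 + cos a) ^ 2 * sin (arg a)
                        + 4 * x * (sin a * sin a) * cos a / (1 + cos a) * cos (arg a))).
        * field. repeat split; lra.
        * rewrite <- E. assert (Hs := sin2_cos2 a). unfold Rsqr in Hs.
          replace (sin a * sin a) with (1 - cos a * cos a) by lra.
          field. repeat split; lra.
    - intros a _. unfold arg. solve_continuous (fun a => 2 * cos a ^ 2 * cos (2 * x * sin a ^ 2 - theta)).
    - intros a Ha. specialize (Hcos a Ha). unfold r, arg.
      solve_continuous (fun a => / (2 * x) * (/ (1 + cos a) * sin (2 * x * sin a ^ 2 - theta))).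
    - intros a Ha. specialize (Hcos a Ha). unfold r. rewrite !Rabs_mult.
      assert (Hi : 0 < / (1 + cos a) <= 1).
      { split; [apply Rinv_0_lt_compat; lra |]. rewrite <- Rinv_1. apply Rinv_le_contravar; lra. }
      assert (Hi2 : 0 < / (2 * x)) by (apply Rinv_0_lt_compat; lra).
      rewrite (Rabs_pos_eq (/ (2 * x))), (Rabs_pos_eq (/ (1 + cos a))) by lra.
      assert (Hs := Rabs_sin_le_1 (arg a)). assert (Hp := Rabs_pos (sin (arg a))).
      rewrite <- (Rmult_1_r (/ (2 * x))) at 2. apply Rmult_le_compat_l; [lra |]. nra. }
  assert (A0 : A 0 = 0).
  { unfold A. rewrite sin_0, cos_0, Rmult_0_r. unfold fresnel_c, fresnel_s.
    rewrite !RInt_point_R. field. split; lra. }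
  assert (A1 : A (PI / 2) = 2 / k * (cos theta * fresnel_c k + sin theta * fresnel_s k)
                - / (2 * x) * sin (arg (PI / 2))).
  { unfold A. rewrite sin_PI2, cos_PI2, Rmult_1_r. field. split; lra. }
  rewrite A0, A1 in H.
  fold (arg 0) in H.
  set (V := RInt (fun a => 2 * cos a ^ 2 * cos (arg a)) 0 (PI / 2)) in *.
  set (W := 2 / k * (cos theta * fresnel_c k + sin theta * fresnel_s k)) in *.
  change (Rabs (V - W) <= 2 / x).
  assert (Hs := SIN_bound (arg (PI / 2))).
  replace (/ (2 * x)) with (/ 2 * / x) in H by (field; lra).
  apply Rabs_le_between in H. apply Rabs_le. unfold Rdiv. split; nra.
Qed.

Lemma is_lim_0_le (f g : R -> R) :
  (forall x, 1 <= x -> Rabs (f x) <= g x) -> is_lim g p_infty 0 -> is_lim f p_infty 0.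
Proof.
  intros H Hg. apply is_lim_0_intro. intros eps Heps.
  destruct (is_lim_0_eventually g eps Heps Hg) as [T HT].
  exists (Rmax T 1). intros t Ht.
  assert (T < t) by (eapply Rle_lt_trans; [apply Rmax_l | exact Ht]).
  assert (1 < t) by (eapply Rle_lt_trans; [apply Rmax_r | exact Ht]).
  eapply Rle_lt_trans; [apply H; lra |]. eapply Rle_lt_trans; [apply Rle_abs |]. auto.
Qed.

Lemma is_lim_0_plus (f g : R -> R) :
  is_lim f p_infty 0 -> is_lim g p_infty 0 -> is_lim (fun x => f x + g x) p_infty 0.
Proof.
  intros Hf Hg. replace (Finite 0) with (Finite (0 + 0)) by (f_equal; ring).
  apply is_lim_plus'; assumption.
Qed.

Lemma is_lim_0_scal (k : R) (f : R -> R) :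
  is_lim f p_infty 0 -> is_lim (fun x => k * f x) p_infty 0.
Proof.
  intros Hf. replace (Finite 0) with (Rbar_mult k 0) by (simpl; f_equal; ring).
  apply is_lim_scal_l, Hf.
Qed.

Lemma is_lim_0_abs (f : R -> R) : is_lim f p_infty 0 -> is_lim (fun x => Rabs (f x)) p_infty 0.
Proof.
  intro H. apply is_lim_0_intro. intros eps He.
  destruct (is_lim_0_eventually f eps He H) as [T HT]. exists T. intros t Ht.
  rewrite Rabs_Rabsolu. auto.
Qed.

Lemma is_lim_0_comp_sqrt (f : R -> R) :
  is_lim f p_infty 0 -> is_lim (fun x => f (sqrt (2 * x))) p_infty 0.
Proof.
  intro H. apply is_lim_0_intro. intros eps He.
  destruct (is_lim_0_eventually f eps He H) as [T HT].
  exists (Rmax 0 (T ^ 2)). intros t Ht. apply HT.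
  assert (0 < t) by (eapply Rle_lt_trans; [apply Rmax_l | exact Ht]).
  assert (T ^ 2 < t) by (eapply Rle_lt_trans; [apply Rmax_r | exact Ht]).
  apply Rle_lt_trans with (Rabs T); [apply Rle_abs |].
  rewrite <- sqrt_Rsqr_abs. apply sqrt_lt_1; unfold Rsqr; nra.
Qed.

(** The bound g does not depend on theta, which can therefore vary with x: theta = x
    isolates J_0 and theta = x - pi/2 isolates J_1. *)
Lemma poisson_phase_limit : exists (l : R) (g : R -> R), l <> 0 /\ is_lim g p_infty 0 /\
  forall theta x, 1 <= x ->
    Rabs (sqrt x * (cos (x - theta) * poisson_0 x + sin (x - theta) * poisson_1 x)
          - l * cos (theta - PI / 4)) <= g x.
Proof.
  destruct fresnel_limit as [l [Hl [Lc Ls]]].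
  exists (2 * l), (fun x => sqrt 2 * (Rabs (fresnel_c (sqrt (2 * x)) - l)
                     + Rabs (fresnel_s (sqrt (2 * x)) - l)) + 3 * / sqrt (2 * x)).
  split; [lra |]. split.
  - apply is_lim_0_plus; apply is_lim_0_scal.
    + apply is_lim_0_plus.
      * apply (is_lim_0_comp_sqrt (fun x => Rabs (fresnel_c x - l))), is_lim_0_abs, Lc.
      * apply (is_lim_0_comp_sqrt (fun x => Rabs (fresnel_s x - l))), is_lim_0_abs, Ls.
    + apply (is_lim_0_comp_sqrt (fun x => / x)).
      replace (Finite 0) with (Rbar_inv p_infty) by reflexivity.
      apply is_lim_inv; [apply is_lim_id | discriminate].
  - intros theta x Hx. rewrite poisson_phase.
    assert (H := stationary_phase_bound theta x ltac:(lra)).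
    set (V := RInt (fun a => 2 * cos a ^ 2 * cos (2 * x * sin a ^ 2 - theta)) 0 (PI / 2)) in *.
    set (k := sqrt (2 * x)) in *.
    assert (H2 : 0 < sqrt 2) by (apply sqrt_lt_R0; lra).
    assert (H22 : sqrt 2 * sqrt 2 = 2) by (apply sqrt_sqrt; lra).
    assert (Hsx : 1 <= sqrt x) by (rewrite <- sqrt_1; apply sqrt_le_1; lra).
    assert (Hsx2 : sqrt x * sqrt x = x) by (apply sqrt_sqrt; lra).
    assert (Hk : k = sqrt 2 * sqrt x) by (apply sqrt_mult; lra).
    assert (Hcos : 2 * l * cos (theta - PI / 4) = sqrt 2 * (l * (cos theta + sin theta))).
    { rewrite cos_minus, cos_PI4, sin_PI4. apply (Rmult_eq_reg_l (sqrt 2)); [| lra].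
      transitivity (2 * l * (cos theta + sin theta)); [field; lra |].
      transitivity ((sqrt 2 * sqrt 2) * (l * (cos theta + sin theta))); [rewrite H22; ring | ring]. }
    rewrite Hcos.
    replace (sqrt x * V - sqrt 2 * (l * (cos theta + sin theta)))
      with (sqrt x * (V - 2 / k * (cos theta * fresnel_c k + sin theta * fresnel_s k))
            + sqrt 2 * (cos theta * (fresnel_c k - l) + sin theta * (fresnel_s k - l))).
    2: { rewrite Hk at 1. replace 2 with (sqrt 2 * sqrt 2) at 1 by exact H22. field. lra. }
    eapply Rle_trans; [apply Rabs_triang |]. rewrite Rplus_comm. apply Rplus_le_compat.
    + rewrite Rabs_mult, (Rabs_pos_eq (sqrt 2)) by lra. apply Rmult_le_compat_l; [lra |].
      eapply Rle_trans; [apply Rabs_triang |]. rewrite !Rabs_mult.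
      assert (B1 := Rabs_cos_le_1 theta). assert (B2 := Rabs_sin_le_1 theta).
      assert (P1 := Rabs_pos (fresnel_c k - l)). assert (P2 := Rabs_pos (fresnel_s k - l)).
      nra.
    + rewrite Rabs_mult, (Rabs_pos_eq (sqrt x)) by lra.
      apply Rle_trans with (sqrt x * (2 / x)); [apply Rmult_le_compat_l; [lra | exact H] |].
      rewrite Hk. replace (sqrt x * (2 / x)) with (2 * / sqrt x)
        by (rewrite <- Hsx2 at 3; field; lra).
      assert (0 < / sqrt x) by (apply Rinv_0_lt_compat; lra).
      rewrite Rinv_mult.
      assert (Hs2 : / sqrt 2 = sqrt 2 / 2) by (rewrite <- H22 at 3; field; lra).
      assert (4 / 3 <= sqrt 2) by nra.
      rewrite Hs2. nra.
Qed.

Definition bessel_error (A : R) (m : nat) (x : R) : R :=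
  sqrt x * bessel m x - A * cos (x - INR m * (PI / 2) - PI / 4).

(** The orders 0 and 1 come from Poisson's integrals.  In
    J_(m+2) = (2 (m + 1) / x) J_(m+1) - J_m the first term is negligible, and the sign change is
    the shift of the phase by pi. *)
Lemma bessel_asymptotics :
  exists A, A <> 0 /\ forall m, is_lim (bessel_error A m) p_infty 0.
Proof.
  destruct poisson_phase_limit as [l [g [Hl [Hg H]]]].
  assert (HPI0 := PI_RGT_0).
  set (A := 2 / PI * l).
  assert (HA : A <> 0).
  { unfold A. apply Rmult_integral_contrapositive_currified; [| exact Hl].
    apply Rgt_not_eq, Rdiv_lt_0_compat; lra. }
  exists A. split; [exact HA |].
  assert (Hboth : is_lim (bessel_error A 0) p_infty 0 /\ is_lim (bessel_error A 1) p_infty 0).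
  { split; apply is_lim_0_le with (g := fun x => 2 / PI * g x); try apply is_lim_0_scal, Hg.
    - intros x Hx. specialize (H x x Hx).
      destruct (bessel_poisson x ltac:(lra)) as [E0 E1].
      replace (x - x) with 0 in H by ring. rewrite cos_0, sin_0, E0 in H.
      unfold bessel_error. simpl INR.
      replace (sqrt x * bessel 0 x - A * cos (x - 0 * (PI / 2) - PI / 4))
        with (2 / PI * (sqrt x * (1 * (PI / 2 * bessel 0 x) + 0 * poisson_1 x) - l * cos (x - PI / 4)))
        by (replace (x - 0 * (PI / 2) - PI / 4) with (x - PI / 4) by ring; unfold A; field; lra).
      assert (0 < 2 / PI) by (apply Rdiv_lt_0_compat; lra).
      rewrite Rabs_mult, (Rabs_pos_eq (2 / PI)) by lra.
      apply Rmult_le_compat_l; [lra | exact H].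
    - intros x Hx. specialize (H (x - PI / 2) x Hx).
      destruct (bessel_poisson x ltac:(lra)) as [E0 E1].
      replace (x - (x - PI / 2)) with (PI / 2) in H by ring. rewrite cos_PI2, sin_PI2, E1 in H.
      unfold bessel_error. simpl INR.
      replace (sqrt x * bessel 1 x - A * cos (x - 1 * (PI / 2) - PI / 4))
        with (2 / PI * (sqrt x * (0 * poisson_0 x + 1 * (PI / 2 * bessel 1 x)) - l * cos (x - PI / 2 - PI / 4)))
        by (rewrite (Rmult_1_l (PI / 2)); unfold A; field; lra).
      assert (0 < 2 / PI) by (apply Rdiv_lt_0_compat; lra).
      rewrite Rabs_mult, (Rabs_pos_eq (2 / PI)) by lra.
      apply Rmult_le_compat_l; [lra | exact H]. }
  assert (Hall : forall m, is_lim (bessel_error A m) p_infty 0 /\ is_lim (bessel_error A (S m)) p_infty 0).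
  { induction m as [| m [IH0 IH1]]; [exact Hboth |]. split; [exact IH1 |].
    set (K := 2 * (INR m + 1)). assert (Hm := pos_INR m).
    apply is_lim_0_le with (g := fun x => K * Rabs (bessel_error A (S m) x)
        + Rabs (bessel_error A m x) + K * Rabs A * / x).
    - intros x Hx.
      assert (Hix : 0 < / x <= 1).
      { split; [apply Rinv_0_lt_compat; lra |]. rewrite <- Rinv_1. apply Rinv_le_contravar; lra. }
      assert (E : bessel_error A (S (S m)) x
        = K * / x * bessel_error A (S m) x + - bessel_error A m x
          + K * / x * A * cos (x - INR (S m) * (PI / 2) - PI / 4)).
      { unfold bessel_error. rewrite !S_INR.
        replace (x - (INR m + 1 + 1) * (PI / 2) - PI / 4)
          with (x - INR m * (PI / 2) - PI / 4 - PI) by field.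
        rewrite (cos_minus _ PI), cos_PI, sin_PI.
        assert (Hr := bessel_rec m x).
        replace (bessel (S (S m)) x) with (K * / x * bessel (S m) x - bessel m x)
          by (unfold K; apply (Rmult_eq_reg_l x); [field_simplify; lra | lra]).
        ring. }
      rewrite E.
      eapply Rle_trans; [apply Rabs_triang |]. apply Rplus_le_compat.
      + eapply Rle_trans; [apply Rabs_triang |]. rewrite Rabs_Ropp. apply Rplus_le_compat_r.
        rewrite !Rabs_mult, (Rabs_pos_eq K), (Rabs_pos_eq (/ x)) by (unfold K; lra).
        assert (P := Rabs_pos (bessel_error A (S m) x)).
        assert (0 <= K) by (unfold K; lra).
        apply Rmult_le_compat_r; [exact P |]. nra.
      + rewrite !Rabs_mult, (Rabs_pos_eq K), (Rabs_pos_eq (/ x)) by (unfold K; lra).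
        assert (B := Rabs_cos_le_1 (x - INR (S m) * (PI / 2) - PI / 4)).
        assert (P := Rabs_pos A).
        assert (0 <= K * / x * Rabs A)
          by (apply Rmult_le_pos; [apply Rmult_le_pos; [unfold K; lra | lra] | exact P]).
        nra.
    - apply is_lim_0_plus; [apply is_lim_0_plus |].
      + apply is_lim_0_scal, is_lim_0_abs, IH1.
      + apply is_lim_0_abs, IH0.
      + apply is_lim_0_scal. replace (Finite 0) with (Rbar_inv p_infty) by reflexivity.
        apply is_lim_inv; [apply is_lim_id | discriminate]. }
  intro m. apply Hall.
Qed.

(** * Counting critical points *)

(** Only the values s 0, ..., s (k - 1) matter. *)
Definition zero_chain (g : R -> R) (k : nat) (a b : R) (s : nat -> R) : Prop :=
  (forall i, (i < k)%nat -> a <= s i <= b /\ g (s i) = 0) /\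
  (forall i, (S i < k)%nat -> s i < s (S i)).

Lemma zero_chain_snoc g k a b s z b' :
  zero_chain g k a b s -> a <= z <= b' -> b < z -> g z = 0 ->
  zero_chain g (S k) a b' (fun i => if Nat.ltb i k then s i else z).
Proof.
  intros [H1 H2] Hz Hbz Hg. split.
  - intros i Hi. destruct (Nat.ltb_spec i k) as [L | L].
    + destruct (H1 i L). split; [lra | assumption].
    + split; assumption.
  - intros i Hi. destruct (Nat.ltb_spec i k) as [L | L]; [| lia].
    destruct (Nat.ltb_spec (S i) k) as [L' | L']; [auto |].
    destruct (H1 i L). lra.
Qed.

Lemma zero_chain_cons g k a b s z :
  zero_chain g k a b s -> z < a -> z <= b -> g z = 0 ->
  zero_chain g (S k) z b (fun i => match i with O => z | S j => s j end).
Proof.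
  intros [H1 H2] Hz Hzb Hg. split.
  - intros [| i] Hi; [split; [lra | assumption] |].
    destruct (H1 i ltac:(lia)). split; [lra | assumption].
  - intros [| i] Hi; [| apply H2; lia]. destruct (H1 0%nat ltac:(lia)). lra.
Qed.

Lemma zero_chain_interlace (f g : R -> R) k a b s :
  (forall u v, a <= u < v -> f u = 0 -> f v = 0 -> exists c, u < c < v /\ g c = 0) ->
  zero_chain f (S k) a b s ->
  exists s', zero_chain g k a (s k) s'.
Proof.
  intros Hfg. revert b. induction k as [| k IH]; intros b [H1 H2].
  - exists s. split; intros; lia.
  - destruct (IH (s k)) as [s' Hs'].
    { split; [| intros; apply H2; lia]. intros i Hi. destruct (H1 i ltac:(lia)) as [Ha Hg].
      split; [| exact Hg]. split; [lra |].
      assert (Hmono : forall n, (i + n <= k)%nat -> s i <= s (i + n)%nat).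
      { induction n as [| n IHn]; intro Hn; [rewrite Nat.add_0_r; lra |].
        rewrite Nat.add_succ_r. specialize (H2 (i + n)%nat ltac:(lia)).
        specialize (IHn ltac:(lia)). lra. }
      replace k with (i + (k - i))%nat by lia. apply Hmono. lia. }
    destruct (Hfg (s k) (s (S k))) as [c [Hc Hgc]].
    + split; [apply H1; lia | apply H2; lia].
    + apply H1; lia.
    + apply H1; lia.
    + eexists. apply (zero_chain_snoc g k a (s k) s' c); [exact Hs' | | | exact Hgc].
      * destruct (H1 k ltac:(lia)). lra.
      * lra.
Qed.

Lemma IVT_sign (f : R -> R) (a b : R) :
  a < b -> (forall x, a <= x <= b -> continuous f x) -> f a * f b < 0 ->
  exists z, a < z < b /\ f z = 0.
Proof.
  intros Hab Hc Hf.
  assert (Hc' : forall x, a <= x <= b -> continuity_pt f x)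
    by (intros; apply continuity_pt_filterlim, Hc; assumption).
  assert (Hz : exists z, a <= z <= b /\ f z = 0).
  { destruct (Rlt_le_dec (f a) 0) as [Ha | Ha].
    - assert (Hb : 0 < f b) by (apply Rnot_le_lt; intro; assert (0 <= f a * f b) by nra; lra).
      destruct (Ranalysis5.IVT_interv f a b Hc' Hab Ha Hb) as [z Hz]. exists z. exact Hz.
    - assert (Ha' : - f a < 0).
      { destruct (Req_dec (f a) 0) as [E | E]; [rewrite E in Hf; lra | lra]. }
      assert (Hb : 0 < - f b) by (apply Rnot_le_lt; intro; assert (0 <= f a * f b) by nra; lra).
      assert (Hco : forall x, a <= x <= b -> continuity_pt (fun x => - f x) x)
        by (intros; apply (continuity_pt_opp f); auto).
      destruct (Ranalysis5.IVT_interv (fun x => - f x) a b Hco Hab Ha' Hb) as [z Hz].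
      exists z. split; [tauto | lra]. }
  destruct Hz as [z [Hz Ez]]. exists z. split; [| exact Ez].
  split.
  - destruct (Req_dec a z) as [E | E]; [subst; nra | lra].
  - destruct (Req_dec z b) as [E | E]; [subst; nra | lra].
Qed.

Lemma cos_shift_pi (k : nat) (t : R) : cos (INR k * PI - PI / 2 + t) = (-1) ^ k * sin t.
Proof.
  induction k as [| k IH].
  - simpl INR. replace (0 * PI - PI / 2 + t) with (- (PI / 2 - t)) by ring.
    rewrite cos_neg, cos_shift. simpl. ring.
  - rewrite S_INR. replace ((INR k + 1) * PI - PI / 2 + t) with ((INR k * PI - PI / 2 + t) + PI) by ring.
    rewrite neg_cos, IH. simpl. ring.
Qed.

Lemma pow_m1_sqr k : (-1) ^ k * (-1) ^ k = 1.
Proof. rewrite <- Rpow_mult_distr. replace (-1 * -1) with 1 by ring. apply pow1. Qed.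

Lemma eventually_nat_mult_PI (T c : R) : exists K, forall k, (K <= k)%nat -> T < INR k * PI + c.
Proof.
  destruct (nfloor_ex (Rmax 0 (T - c))) as [N HN]; [apply Rmax_l |].
  exists (S N). intros k Hk. apply le_INR in Hk. rewrite S_INR in Hk.
  assert (H := Rmax_r 0 (T - c)). assert (H0 := Rmax_l 0 (T - c)).
  assert (HPI := PI2_3_2). nra.
Qed.

(** G has opposite signs on the two sides of a zero of cos (x - phi). *)
Lemma asymptotic_zero (G : R -> R) (B phi eps : R) :
  B <> 0 -> 0 < eps < PI / 2 -> (forall x, 0 < x -> continuous G x) ->
  is_lim (fun x => sqrt x * G x - B * cos (x - phi)) p_infty 0 ->
  exists K, forall k, (K <= k)%nat ->
    exists z, INR k * PI - PI / 2 + phi - eps < z < INR k * PI - PI / 2 + phi + eps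
              /\ 0 < z /\ G z = 0.
Proof.
  intros HB He Hc HL.
  assert (Hsin : 0 < sin eps) by (apply sin_gt_0; lra).
  assert (Hd : 0 < Rabs B * sin eps) by (apply Rmult_lt_0_compat; [apply Rabs_pos_lt, HB | exact Hsin]).
  destruct (is_lim_0_eventually _ _ Hd HL) as [T HT].
  destruct (eventually_nat_mult_PI (Rmax 0 T) (- PI / 2 + phi - eps)) as [K HK].
  exists K. intros k Hk. specialize (HK k Hk).
  set (c := INR k * PI - PI / 2 + phi) in *.
  assert (H0 : 0 < c - eps) by (assert (H := Rmax_l 0 T); unfold c; lra).
  assert (HT' : T < c - eps) by (assert (H := Rmax_r 0 T); unfold c; lra).
  assert (H1 := HT (c - eps) HT'). assert (H2 := HT (c + eps) ltac:(lra)).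
  replace (c - eps - phi) with (INR k * PI - PI / 2 + - eps) in H1 by (unfold c; ring).
  replace (c + eps - phi) with (INR k * PI - PI / 2 + eps) in H2 by (unfold c; ring).
  rewrite cos_shift_pi in H1, H2. rewrite sin_neg in H1.
  set (p := (-1) ^ k) in *. assert (Hp : p * p = 1) by apply pow_m1_sqr.
  assert (S1 : 0 < sqrt (c - eps)) by (apply sqrt_lt_R0; lra).
  assert (S2 : 0 < sqrt (c + eps)) by (apply sqrt_lt_R0; lra).
  set (r1 := sqrt (c - eps)) in *. set (r2 := sqrt (c + eps)) in *.
  set (G1 := G (c - eps)) in *. set (G2 := G (c + eps)) in *.
  assert (Hneg : G1 * G2 < 0).
  { assert (HBB : Rabs (p * B) = Rabs B).
    { rewrite Rabs_mult. unfold p. rewrite pow_1_abs. ring. }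
    rewrite <- HBB in H1, H2. apply Rabs_def2 in H1, H2.
    set (q := p * B) in *.
    replace (B * (p * - sin eps)) with (- (q * sin eps)) in H1 by (unfold q; ring).
    replace (B * (p * sin eps)) with (q * sin eps) in H2 by (unfold q; ring).
    destruct (Rlt_le_dec q 0) as [Hq | Hq].
    - rewrite (Rabs_left q) in H1, H2 by exact Hq.
      assert (0 < r1 * G1) by lra. assert (r2 * G2 < 0) by lra.
      assert (0 < G1) by nra. assert (G2 < 0) by nra. nra.
    - rewrite (Rabs_pos_eq q) in H1, H2 by exact Hq.
      assert (r1 * G1 < 0) by lra. assert (0 < r2 * G2) by lra.
      assert (G1 < 0) by nra. assert (0 < G2) by nra. nra. }
  destruct (IVT_sign G (c - eps) (c + eps)) as [z [Hz Ez]]; [lra | | exact Hneg |].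
  - intros x Hx. apply Hc. lra.
  - exists z. split; [lra | split; [lra | exact Ez]].
Qed.

Lemma asymptotic_no_zero (G : R -> R) (B phi eps : R) :
  B <> 0 -> 0 < eps < PI / 2 ->
  is_lim (fun x => sqrt x * G x - B * cos (x - phi)) p_infty 0 ->
  exists K, forall k, (K <= k)%nat -> forall x,
    INR k * PI - PI / 2 + phi + eps <= x <= INR k * PI + PI / 2 + phi - eps -> G x <> 0.
Proof.
  intros HB He HL.
  assert (Hsin : 0 < sin eps) by (apply sin_gt_0; lra).
  assert (Hd : 0 < Rabs B * sin eps) by (apply Rmult_lt_0_compat; [apply Rabs_pos_lt, HB | exact Hsin]).
  destruct (is_lim_0_eventually _ _ Hd HL) as [T HT].
  destruct (eventually_nat_mult_PI T (- PI / 2 + phi + eps)) as [K HK].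
  exists K. intros k Hk x Hx E. specialize (HK k Hk).
  assert (H := HT x ltac:(lra)). rewrite E, Rmult_0_r in H.
  unfold Rminus at 1 in H. rewrite Rplus_0_l, Rabs_Ropp, Rabs_mult in H.
  set (t := x - phi - (INR k * PI - PI / 2)).
  replace (x - phi) with (INR k * PI - PI / 2 + t) in H by (unfold t; ring).
  rewrite cos_shift_pi, Rabs_mult, pow_1_abs in H.
  assert (Ht : eps <= t <= PI - eps) by (unfold t; lra).
  assert (Hst : sin eps <= sin t).
  { destruct (Rle_lt_dec t (PI / 2)) as [L | L].
    - apply sin_incr_1; lra.
    - rewrite <- (sin_PI_x t). apply sin_incr_1; lra. }
  rewrite (Rabs_pos_eq (sin t)) in H by lra.
  assert (0 < Rabs B) by (apply Rabs_pos_lt, HB). nra.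
Qed.

(** Sturm comparison: y = sqrt x J_0 satisfies y'' = - (1 + 1 / (4 x^2)) y and so
    oscillates faster than sin (x - a).  The proof follows the Wronskian Om of the two. *)
Lemma bessel_0_sturm a : 0 < a -> exists z, a < z < a + PI /\ bessel 0 z = 0.
Proof.
  intro Ha. assert (HPI := PI_RGT_0).
  apply Classical_Prop.NNPP. intro Hn.
  assert (Hnz : forall z, a < z < a + PI -> bessel 0 z <> 0) by (intros z Hz E; apply Hn; eauto).
  (* the sign of J_0 on the zero-free interval is that of its value at the midpoint *)
  set (mid := a + PI / 2).
  set (sg := bessel 0 mid).
  assert (Hmid : sg <> 0) by (apply Hnz; unfold mid; lra).
  assert (Hsg : forall x, a <= x <= a + PI -> 0 <= sg * bessel 0 x).
  { intros x Hx. apply Rnot_lt_le. intro Hlt.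
    destruct (Rlt_le_dec x mid) as [L | L].
    - destruct (IVT_sign (bessel 0) x mid) as [z [Hz Ez]]; [exact L | intros; apply bessel_continuous | fold sg; lra |].
      apply (Hnz z); [unfold mid in *; lra | exact Ez].
    - assert (L' : mid < x) by (destruct (Req_dec mid x) as [E | E]; [subst x; fold sg in Hlt; nra | lra]).
      destruct (IVT_sign (bessel 0) mid x) as [z [Hz Ez]]; [exact L' | intros; apply bessel_continuous | fold sg; lra |].
      apply (Hnz z); [unfold mid in *; lra | exact Ez]. }
  set (Om := fun x => (bessel 0 x / (2 * sqrt x) - sqrt x * bessel 1 x) * sin (x - a)
                      - sqrt x * bessel 0 x * cos (x - a)).
  destruct (MVT_cor2 Om (fun x => - (/ (4 * x ^ 2)) * (sqrt x * bessel 0 x) * sin (x - a)) a (a + PI))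
    as [c [Hc1 Hc2]]; [lra | |].
  - intros x Hx. apply is_derive_Reals. unfold Om.
    assert (Hr : 0 < sqrt x) by (apply sqrt_lt_R0; lra).
    assert (Dr : is_derive sqrt x (/ (2 * sqrt x))) by (auto_derive; [lra | field; lra]).
    assert (Hr2 : sqrt x * sqrt x = x) by (apply sqrt_sqrt; lra).
    assert (D0 := is_derive_bessel_0 x ltac:(lra)). assert (D1 := is_derive_bessel_1 x ltac:(lra)).
    assert (Di : is_derive (fun x => / (2 * sqrt x)) x (- (/ (4 * sqrt x * x)))).
    { auto_derive; [split; [lra | split; [lra | exact I]] |].
      rewrite <- Hr2 at 5. field. lra. }
    assert (Ds : is_derive (fun x => sin (x - a)) x (cos (x - a))) by (auto_derive; [exact I | unfold Rminus; ring]).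
    assert (Dc : is_derive (fun x => cos (x - a)) x (- sin (x - a))) by (auto_derive; [exact I | unfold Rminus; ring]).
    eapply is_derive_eq.
    + apply is_derive_minus_R; apply is_derive_mult_R; [| exact Ds | | exact Dc].
      * apply is_derive_minus_R; apply is_derive_mult_R; eassumption.
      * apply is_derive_mult_R; eassumption.
    + cbv beta. generalize (sin (x - a)) (cos (x - a)) (bessel 0 x) (bessel 1 x).
      intros S C J0 J1. set (r := sqrt x) in *. rewrite <- Hr2. field. lra.
  - unfold Om in Hc1. replace (a + PI - a) with PI in Hc1 by ring. replace (a - a) with 0 in Hc1 by ring.
    rewrite sin_PI, cos_PI, sin_0, cos_0 in Hc1.
    assert (HA := Hsg a ltac:(lra)). assert (HB := Hsg (a + PI) ltac:(lra)).
    assert (HC := Hsg c ltac:(lra)).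
    assert (HC0 : 0 < sg * bessel 0 c).
    { assert (bessel 0 c <> 0) by (apply Hnz; lra).
      assert (sg * bessel 0 c <> 0) by (apply Rmult_integral_contrapositive_currified; assumption). lra. }
    assert (R1 : 0 < sqrt a) by (apply sqrt_lt_R0; lra).
    assert (R2 : 0 < sqrt (a + PI)) by (apply sqrt_lt_R0; lra).
    assert (R3 : 0 < sqrt c) by (apply sqrt_lt_R0; lra).
    assert (R4 : 0 < sin (c - a)) by (apply sin_gt_0; lra).
    assert (R5 : 0 < / (4 * c ^ 2)) by (apply Rinv_0_lt_compat; nra).
    assert (E : sqrt (a + PI) * (sg * bessel 0 (a + PI)) + sqrt a * (sg * bessel 0 a)
                = - (/ (4 * c ^ 2) * sqrt c * sin (c - a) * PI) * (sg * bessel 0 c)).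
    { transitivity (sg * ((bessel 0 (a + PI) / (2 * sqrt (a + PI)) -
         sqrt (a + PI) * bessel 1 (a + PI)) * 0 -
        sqrt (a + PI) * bessel 0 (a + PI) * -1 -
        ((bessel 0 a / (2 * sqrt a) - sqrt a * bessel 1 a) * 0 -
         sqrt a * bessel 0 a * 1))); [ring | rewrite Hc1; ring]. }
    assert (0 < / (4 * c ^ 2) * sqrt c * sin (c - a) * PI)
      by (apply Rmult_lt_0_compat; [apply Rmult_lt_0_compat; [apply Rmult_lt_0_compat |] |]; assumption).
    assert (0 <= sqrt (a + PI) * (sg * bessel 0 (a + PI))) by (apply Rmult_le_pos; lra).
    assert (0 <= sqrt a * (sg * bessel 0 a)) by (apply Rmult_le_pos; lra).
    nra.
Qed.

Lemma zero_chain_mono g k a b s i j :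
  zero_chain g k a b s -> (i <= j)%nat -> (j < k)%nat -> s i <= s j.
Proof.
  intros [_ H2] Hij. induction Hij as [| j Hij IH]; intro Hj; [lra |].
  specialize (H2 j Hj). specialize (IH ltac:(lia)). lra.
Qed.

Lemma zero_chain_shrink g k a b b' s :
  zero_chain g (S k) a b s -> s k <= b' -> zero_chain g (S k) a b' s.
Proof.
  intros H Hb. split; [| apply H]. intros i Hi.
  destruct (proj1 H i Hi) as [Ha Hg]. split; [| exact Hg].
  assert (Hm := zero_chain_mono _ _ _ _ _ i k H ltac:(lia) ltac:(lia)). lra.
Qed.

Lemma rolle_open (f df : R -> R) (a b : R) :
  a < b -> (forall x, a < x < b -> is_derive f x (df x)) ->
  (forall x, continuous f x) -> f a = f b -> exists c, a < c < b /\ df c = 0.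
Proof.
  intros Hab Hd Hc Hf.
  assert (pr : forall x, a < x < b -> derivable_pt f x).
  { intros x Hx. exists (df x). apply is_derive_Reals, Hd, Hx. }
  destruct (Rolle f a b pr) as [c [P HP]]; [| exact Hab | exact Hf |].
  - intros x _. apply continuity_pt_filterlim, Hc.
  - exists c. split; [exact P |]. rewrite <- HP, (Derive_Reals f c (pr c P)).
    symmetry. apply is_derive_unique, Hd, P.
Qed.

Lemma bessel_rolle_critical m u v :
  0 <= u < v -> bessel m u = 0 -> bessel m v = 0 -> exists c, u < c < v /\ neumann_char m c = 0.
Proof.
  intros Huv Hu Hv.
  destruct (rolle_open (bessel m) (fun x => bessel_d m x / x) u v) as [c [Hc E]]; try lra.
  - intros x Hx. apply is_derive_bessel. lra.
  - intro. apply bessel_continuous.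
  - exists c. split; [exact Hc |]. rewrite bessel_d_char in E.
    assert (Hp : (c / 2) ^ m <> 0) by (apply pow_nonzero; lra).
    unfold Rdiv in E. apply Rmult_integral in E. destruct E as [E | E].
    + apply Rmult_integral in E. destruct E; [elim Hp; assumption | assumption].
    + elim (Rinv_neq_0_compat c); [lra | exact E].
Qed.

Lemma bessel_rolle_succ m u v :
  0 < u < v -> bessel m u = 0 -> bessel m v = 0 -> exists c, u < c < v /\ bessel (S m) c = 0.
Proof.
  intros Huv Hu Hv.
  assert (H : forall x, 0 < x -> bessel m x = 0 -> clifford m (x ^ 2 / 4) = 0).
  { intros x Hx E. unfold bessel in E. apply Rmult_integral in E. destruct E as [E | E]; [| exact E].
    elim (pow_nonzero (x / 2) m); [lra | exact E]. }
  destruct (rolle_open (fun x => clifford m (x ^ 2 / 4)) (fun x => x / 2 * - clifford (S m) (x ^ 2 / 4)) u v)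
    as [c [Hc E]]; [lra | | | |].
  - intros x _. apply (is_derive_comp_R (clifford m) (fun t => t ^ 2 / 4)).
    + apply is_derive_clifford.
    + auto_derive; [exact I | field].
  - intro x. apply (continuous_comp (fun x => x ^ 2 / 4) (clifford m)); [| apply clifford_continuous].
    apply (ex_derive_continuous (fun x => x ^ 2 / 4)). auto_derive. exact I.
  - rewrite (H u), (H v); lra.
  - exists c. split; [exact Hc |]. unfold bessel.
    apply Rmult_integral in E. destruct E as [E | E]; [lra |].
    replace (clifford (S m) (c ^ 2 / 4)) with 0 by lra. ring.
Qed.

Lemma bessel_0_chain k : exists s, zero_chain (bessel 0) k 1 (1 + INR k * PI) s.
Proof.
  induction k as [| k [s Hs]]; [exists (fun _ => 0); split; intros; lia |].
  assert (HPI := PI_RGT_0). assert (Hk := pos_INR k).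
  destruct (bessel_0_sturm (1 + INR k * PI)) as [z [Hz Ez]]; [nra |].
  eexists. apply (zero_chain_snoc (bessel 0) k 1 (1 + INR k * PI) s z);
    [exact Hs | rewrite S_INR; split; nra | lra | exact Ez].
Qed.

(** The asymptotics give the zeros modulo pi; what has to be added is their
    index.  For m = 0, Sturm comparison gives k zeros below 1 + k pi, and none of them lies in
    the interval from k pi - pi/4 + eps to 1 + k pi, where the asymptotics exclude zeros.  From m
    to m + 1, interlacing loses one zero, and the asymptotics provide a new one a quarter of a
    period, pi/2, further out. *)
Lemma bessel_zeros_asymptotic m eps : 0 < eps < PI / 4 ->
  exists K, forall k, (K <= k)%nat ->
    exists s, zero_chain (bessel m) k 1 (INR k * PI + INR m * (PI / 2) - PI / 4 + eps) s.
Proof.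
  intro He. assert (HPI := PI2_3_2).
  destruct bessel_asymptotics as [A [HA Has]].
  assert (Hlim : forall m, is_lim (fun x => sqrt x * bessel m x
              - A * cos (x - (INR m * (PI / 2) + PI / 4))) p_infty 0).
  { intro n. apply is_lim_ext with (2 := Has n). intro x. unfold bessel_error. do 3 f_equal. ring. }
  induction m as [| m [K IH]].
  - destruct (asymptotic_no_zero (bessel 0) A _ eps HA ltac:(lra) (Hlim 0%nat)) as [K HK].
    exists (S K). intros k Hk. destruct (bessel_0_chain k) as [s Hs].
    exists s. destruct k as [| k]; [lia |].
    apply zero_chain_shrink with (1 := Hs).
    apply Rnot_lt_le. intro Hlt.
    destruct (proj1 Hs k ltac:(lia)) as [Hb Hz].
    apply (HK (S k) ltac:(lia) (s k)); [| exact Hz].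
    change (INR 0) with 0 in *. lra.
  - destruct (asymptotic_zero (bessel (S m)) A _ eps HA ltac:(lra)
                (fun x _ => bessel_continuous _ x) (Hlim (S m))) as [K' HK'].
    exists (S (Nat.max K K')). intros k Hk.
    destruct (IH k ltac:(lia)) as [s Hs]. destruct k as [| k]; [lia |].
    destruct (zero_chain_interlace (bessel m) (bessel (S m)) k 1 _ s
        (fun u v Huv Hu Hv => bessel_rolle_succ m u v ltac:(lra) Hu Hv) Hs) as [s' Hs'].
    destruct (HK' (S k) ltac:(lia)) as [z [Hz [Hz0 Ez]]].
    destruct (proj1 Hs k ltac:(lia)) as [Hb _].
    rewrite (S_INR m) in *.
    eexists. apply (zero_chain_snoc (bessel (S m)) k 1 (s k) s' z);
      [exact Hs' | split; lra | lra | exact Ez].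
Qed.

Lemma neumann_char_0_0 : neumann_char 0 0 = 0.
Proof. unfold neumann_char. simpl. field. Qed.

Lemma bessel_S_0 m : bessel (S m) 0 = 0.
Proof. unfold bessel. simpl. field. Qed.

Lemma neumann_char_of_bessel_d m x : 0 < x -> bessel_d m x = 0 -> neumann_char m x = 0.
Proof.
  intros Hx E. rewrite bessel_d_char in E. apply Rmult_integral in E.
  destruct E as [E | E]; [| exact E]. elim (pow_nonzero (x / 2) m); [lra | exact E].
Qed.

(** As from J_m to J_(m+1) above, but no zero is lost, because of the point 0: for
    m = 0 it is itself a zero of neumann_char, and for m >= 1 it is a zero of J_m and hence one
    more end point for Rolle's theorem. *)
Lemma neumann_zeros_asymptotic m eps : 0 < eps < PI / 4 ->
  exists K, forall k, (K <= k)%nat ->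
    exists s, zero_chain (neumann_char m) (S k) 0
                (INR k * PI + INR m * (PI / 2) + PI / 4 + eps) s.
Proof.
  intro He. assert (HPI := PI2_3_2). assert (Hm := pos_INR m).
  destruct (bessel_zeros_asymptotic m eps He) as [K HK].
  destruct bessel_asymptotics as [A [HA Has]].
  assert (Hlim : is_lim (fun x => sqrt x * (bessel_d m x / x)
              - - A * cos (x - (INR (S m) * (PI / 2) + PI / 4))) p_infty 0).
  { apply is_lim_0_le with (g := fun x => INR m * Rabs (bessel_error A m x)
        + INR m * (Rabs A * / x) + Rabs (bessel_error A (S m) x)).
    - intros x Hx.
      assert (Hix : 0 < / x <= 1).
      { split; [apply Rinv_0_lt_compat; lra |]. rewrite <- Rinv_1. apply Rinv_le_contravar; lra. }
      assert (E : sqrt x * (bessel_d m x / x) - - A * cos (x - (INR (S m) * (PI / 2) + PI / 4))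
         = INR m * / x * bessel_error A m x
           + INR m * / x * (A * cos (x - INR m * (PI / 2) - PI / 4)) + - bessel_error A (S m) x).
      { unfold bessel_error, bessel_d.
        replace (x - (INR (S m) * (PI / 2) + PI / 4)) with (x - INR (S m) * (PI / 2) - PI / 4) by ring.
        field. lra. }
      rewrite E.
      eapply Rle_trans; [apply Rabs_triang |]. rewrite Rabs_Ropp. apply Rplus_le_compat_r.
      eapply Rle_trans; [apply Rabs_triang |].
      rewrite !Rabs_mult, (Rabs_pos_eq (INR m)), (Rabs_pos_eq (/ x)) by lra.
      assert (B := Rabs_cos_le_1 (x - INR m * (PI / 2) - PI / 4)).
      assert (P0 := Rabs_pos (cos (x - INR m * (PI / 2) - PI / 4))).
      assert (P := Rabs_pos A). assert (P' := Rabs_pos (bessel_error A m x)).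
      apply Rplus_le_compat.
      + apply Rmult_le_compat_r; [exact P' |]. nra.
      + rewrite Rmult_assoc. apply Rmult_le_compat_l; [exact Hm |].
        rewrite <- Rmult_assoc, (Rmult_comm (/ x)).
        rewrite <- (Rmult_1_r (Rabs A * / x)) at 2. apply Rmult_le_compat_l; [| exact B].
        apply Rmult_le_pos; lra.
    - apply is_lim_0_plus; [apply is_lim_0_plus |].
      + apply is_lim_0_scal, is_lim_0_abs, Has.
      + apply is_lim_0_scal, is_lim_0_scal.
        replace (Finite 0) with (Rbar_inv p_infty) by reflexivity.
        apply is_lim_inv; [apply is_lim_id | discriminate].
      + apply is_lim_0_abs, Has. }
  assert (Hcont : forall x, 0 < x -> continuous (fun x => bessel_d m x / x) x).
  { intros x Hx. apply (ex_derive_continuous (fun x => bessel_d m x / x)).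
    assert (D := is_derive_bessel_d m x ltac:(lra)).
    auto_derive. split; [eexists; exact D | split; [lra | exact I]]. }
  destruct (asymptotic_zero _ (- A) _ eps ltac:(lra) ltac:(lra) Hcont Hlim) as [K' HK'].
  exists (S (Nat.max K K')). intros k Hk.
  destruct (HK k ltac:(lia)) as [s Hs].
  destruct (HK' k ltac:(lia)) as [z [Hz [Hz0 Ez]]]. rewrite (S_INR m) in Hz.
  assert (Ez' : neumann_char m z = 0).
  { apply neumann_char_of_bessel_d; [exact Hz0 |]. unfold Rdiv in Ez. apply Rmult_integral in Ez.
    destruct Ez as [Ez | Ez]; [exact Ez |]. elim (Rinv_neq_0_compat z); [lra | exact Ez]. }
  destruct k as [| k]; [lia |].
  destruct (proj1 Hs k ltac:(lia)) as [Hb _].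
  destruct m as [| m].
  - destruct (zero_chain_interlace (bessel 0) (neumann_char 0) k 1 _ s
        (fun u v Huv Hu Hv => bessel_rolle_critical 0 u v ltac:(lra) Hu Hv) Hs) as [s' Hs'].
    eexists. apply zero_chain_cons with (a := 1); [| lra | | apply neumann_char_0_0].
    + apply (zero_chain_snoc (neumann_char 0) k 1 (s k) s' z);
        [exact Hs' | split; lra | lra | exact Ez'].
    + lra.
  - assert (Hs0 := zero_chain_cons _ _ _ _ s 0 Hs ltac:(lra) ltac:(lra) (bessel_S_0 m)).
    destruct (zero_chain_interlace (bessel (S m)) (neumann_char (S m)) (S k) 0 _ _
        (fun u v Huv Hu Hv => bessel_rolle_critical (S m) u v ltac:(lra) Hu Hv) Hs0) as [s' Hs'].
    eexists. apply (zero_chain_snoc (neumann_char (S m)) (S k) 0 (s k) s' z);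
        [exact Hs' | split; lra | lra | exact Ez'].
Qed.

Lemma atan_le_id t : 0 <= t -> atan t <= t.
Proof.
  intro Ht. destruct (MVT_gen atan 0 t (fun x => / (1 + x ^ 2))) as [c [_ Hc]].
  - intros. apply is_derive_Reals, derivable_pt_lim_atan.
  - intros. apply derivable_continuous_pt, derivable_pt_atan.
  - rewrite atan_0 in Hc.
    assert (Hi : / (1 + c ^ 2) <= 1) by (rewrite <- Rinv_1 at 2; apply Rinv_le_contravar; nra).
    nra.
Qed.

(** The error term tends to 0 as t grows, and m pi/2 is the phase shift in the
    asymptotics of J_m. *)
Lemma wkb_phase_upper m t :
  0 <= m -> m < t -> wkb_phase m t <= t - m * (PI / 2) + m ^ 2 / sqrt (t ^ 2 - m ^ 2).
Proof.
  intros Hm Ht. assert (HQ : 0 < t ^ 2 - m ^ 2) by nra.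
  set (q := sqrt (t ^ 2 - m ^ 2)).
  assert (Hq : 0 < q) by (apply sqrt_lt_R0, HQ).
  assert (Hq2 : q * q = t ^ 2 - m ^ 2) by (apply sqrt_sqrt; lra).
  assert (Hqt : q <= t) by nra.
  unfold wkb_phase. fold q.
  destruct (Req_dec m 0) as [E | E].
  - rewrite E. unfold Rdiv. lra.
  - assert (Hmp : 0 < m) by lra.
    assert (Hr : 0 < q / m) by (apply Rdiv_lt_0_compat; lra).
    assert (Hi := atan_inv (q / m) Hr).
    assert (Hl := atan_le_id (/ (q / m)) ltac:(apply Rlt_le, Rinv_0_lt_compat, Hr)).
    replace (/ (q / m)) with (m / q) in * by (field; lra).
    replace (m ^ 2 / q) with (m * (m / q)) by (field; lra).
    nra.
Qed.

Lemma zero_chain_spacing m k b s i n :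
  zero_chain (neumann_char m) k 0 b s -> (i + n < k)%nat -> INR m < s i ->
  wkb_phase (INR m) (s i) + INR n * PI <= wkb_phase (INR m) (s (i + n)%nat).
Proof.
  intros H Hn Hi. assert (Hm := pos_INR m). induction n as [| n IH].
  - rewrite Nat.add_0_r. simpl. lra.
  - specialize (IH ltac:(lia)). rewrite Nat.add_succ_r, S_INR.
    assert (Hmono := zero_chain_mono _ _ _ _ _ i (i + n) H ltac:(lia) ltac:(lia)).
    assert (Hlt := proj2 H (i + n)%nat ltac:(lia)).
    assert (Z1 := proj2 (proj1 H (i + n)%nat ltac:(lia))).
    assert (Z2 := proj2 (proj1 H (S (i + n)) ltac:(lia))).
    assert (Hsp := bessel_critical_spacing m (s (i + n)%nat) (s (S (i + n))) ltac:(lra) Hlt).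
    rewrite !bessel_d_char, Z1, Z2 in Hsp. specialize (Hsp ltac:(ring) ltac:(ring)). lra.
Qed.

(** For y far out, neumann_zeros_asymptotic gives k + j + 1 zeros in [0, y], while the
    phase grows by at most j pi between x and y.  If the zero s k were beyond x, the j gaps
    between s k and s (k + j) would need more phase than that. *)
Lemma neumann_zero_count (m k : nat) (x : R) :
  INR m < x -> INR k * PI + PI / 4 < wkb_phase (INR m) x ->
  exists s, zero_chain (neumann_char m) (S k) 0 x s.
Proof.
  intros Hmx Hf. assert (Hm := pos_INR m). assert (HPI := PI2_3_2).
  set (M := INR m) in *. set (f := wkb_phase M) in *.
  set (delta := Rmin (f x - (INR k * PI + PI / 4)) (PI / 4)).
  assert (Hd : 0 < delta <= PI / 4) by (unfold delta; split; [apply Rmin_glb_lt; lra | apply Rmin_r]).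
  assert (Hd' : delta <= f x - (INR k * PI + PI / 4)) by apply Rmin_l.
  destruct (neumann_zeros_asymptotic m (delta / 2) ltac:(lra)) as [K HK].
  (* beyond T the phase correction M^2 / sqrt (y^2 - M^2) is below delta / 2 *)
  set (T := M + 1 + 2 * M ^ 2 / delta).
  assert (HT : M + 1 <= T).
  { unfold T. assert (0 <= 2 * M ^ 2 / delta) by (apply Rmult_le_pos; [nra | apply Rlt_le, Rinv_0_lt_compat; lra]). lra. }
  destruct (eventually_nat_mult_PI T 0) as [K2 HK2].
  set (j := Nat.max K K2).
  destruct (HK (k + j)%nat ltac:(lia)) as [s Hs]. fold M in Hs.
  set (y := INR (k + j) * PI + M * (PI / 2) + PI / 4 + delta / 2) in *.
  assert (Hy : T < y).
  { specialize (HK2 (k + j)%nat ltac:(lia)). unfold y.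
    assert (0 <= M * (PI / 2)) by nra. lra. }
  assert (Hfy : f y <= f x + INR j * PI).
  { assert (Hup := wkb_phase_upper M y Hm ltac:(lra)). fold f in Hup.
    assert (Hsq : M ^ 2 / sqrt (y ^ 2 - M ^ 2) <= delta / 2).
    { assert (Hq : T - M <= sqrt (y ^ 2 - M ^ 2)).
      { rewrite <- (sqrt_pow2 (T - M)) by lra. apply sqrt_le_1; nra. }
      assert (Hp : M ^ 2 <= delta / 2 * (T - M)).
      { unfold T. replace (delta / 2 * (M + 1 + 2 * M ^ 2 / delta - M)) with (delta / 2 + M ^ 2) by (field; lra). lra. }
      apply (Rmult_le_reg_r (sqrt (y ^ 2 - M ^ 2))); [lra |].
      unfold Rdiv at 1. rewrite Rmult_assoc, Rinv_l, Rmult_1_r by lra. nra. }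
    unfold y in Hup at 2. rewrite plus_INR in Hup. lra. }
  assert (Hlast : s k <= x).
  { apply Rnot_lt_le. intro Hlt.
    assert (Hsp := zero_chain_spacing m (S (k + j)) y s k j Hs ltac:(lia) ltac:(fold M; lra)).
    fold M f in Hsp.
    destruct (proj1 Hs (k + j)%nat ltac:(lia)) as [Hle _].
    assert (Hmono := zero_chain_mono _ _ _ _ _ k (k + j) Hs ltac:(lia) ltac:(lia)).
    assert (f x < f (s k)) by (apply wkb_phase_increasing; lra).
    assert (f (s (k + j)%nat) <= f y).
    { destruct (Req_dec (s (k + j)%nat) y) as [-> | E]; [lra |].
      apply Rlt_le, wkb_phase_increasing; lra. }
    lra. }
  exists s. apply zero_chain_shrink with (b := y); [| exact Hlast].
  split; intros; apply Hs; lia.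
Qed.

(** * The curve of WKB phases *)

Lemma PI_bounds : 3.1415 < PI < 3.1416.
Proof.
  assert (H := PI_2_3_7_ineq 2).
  unfold tg_alt, PI_2_3_7_tg, Ratan_seq in H. simpl in H.
  split; lra.
Qed.

(** For m = mu cos t the WKB phase of order m at mu is mu * wkb_angle t. *)
Definition wkb_angle (t : R) : R := sin t - t * cos t.

(** The integral of t sin t cos t, that is, of cos t with respect to wkb_angle t. *)
Definition wkb_area (t : R) : R := (sin t * cos t - t * (2 * cos t ^ 2 - 1)) / 4.

Lemma is_derive_wkb_angle t : is_derive wkb_angle t (t * sin t).
Proof. unfold wkb_angle. auto_derive; [exact I | ring]. Qed.

Lemma is_derive_wkb_area t : is_derive wkb_area t (t * sin t * cos t).
Proof.
  unfold wkb_area. auto_derive; [exact I |].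
  assert (H := sin2_cos2 t). unfold Rsqr in H.
  transitivity (((cos t * cos t - (1 - cos t * cos t)) - (2 * (cos t * cos t) - 1)
     + 4 * t * (cos t * sin t)) / 4); [| field].
  replace (1 - cos t * cos t) with (sin t * sin t) by lra. field.
Qed.

Lemma nondecreasing_of_derive (f df : R -> R) (a b : R) :
  a <= b -> (forall x, a <= x <= b -> is_derive f x (df x)) ->
  (forall x, a <= x <= b -> 0 <= df x) -> f a <= f b.
Proof.
  intros Hab Hd Hp.
  destruct (MVT_gen f a b df) as [c [Hc Hc']].
  - rewrite Rmin_left, Rmax_right by lra. intros; apply Hd; lra.
  - rewrite Rmin_left, Rmax_right by lra. intros.
    apply continuity_pt_filterlim, (ex_derive_continuous f). eexists. apply Hd. lra.
  - rewrite Rmin_left, Rmax_right in Hc by lra. specialize (Hp c Hc). nra.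
Qed.

Lemma wkb_angle_mono a b : 0 <= a <= b -> b <= PI / 2 -> wkb_angle a <= wkb_angle b.
Proof.
  intros Hab Hb. assert (HPI := PI_RGT_0).
  apply nondecreasing_of_derive with (df := fun t => t * sin t); [lra | |].
  - intros; apply is_derive_wkb_angle.
  - intros x Hx. apply Rmult_le_pos; [lra | apply sin_ge_0; lra].
Qed.

Lemma sin_diff_le_cos a b :
  0 <= a <= b -> b <= PI / 2 -> sin b - sin a <= (b - a) * cos a.
Proof.
  intros Hab Hb. assert (HPI := PI_RGT_0).
  set (k := fun t => (t - a) * cos a - sin t).
  assert (H : k a <= k b).
  { apply nondecreasing_of_derive with (df := fun t => cos a - cos t); [lra | |].
    - intros x _. unfold k. auto_derive; [exact I | ring].
    - intros x Hx. assert (cos x <= cos a) by (apply cos_decr_1; lra). lra. }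
  unfold k in H. lra.
Qed.

(** cos t is a convex function of wkb_angle t, so that trapezoids overestimate the area;
    sin_diff_le_cos is this convexity. *)
Lemma wkb_trapezoid a b : 0 <= a <= b -> b <= PI / 2 ->
  wkb_area b - wkb_area a <= (wkb_angle b - wkb_angle a) * ((cos a + cos b) / 2).
Proof.
  intros Hab Hb. assert (HPI := PI_RGT_0).
  set (h := fun t => (wkb_angle t - wkb_angle a) * ((cos a + cos t) / 2) - (wkb_area t - wkb_area a)).
  assert (H : h a <= h b).
  { apply nondecreasing_of_derive with
      (df := fun t => sin t / 2 * ((t - a) * cos a - (sin t - sin a))); [lra | |].
    - intros x _. unfold h. eapply is_derive_eq.
      + apply is_derive_minus_R.
        * apply is_derive_mult_R.
          -- apply (is_derive_minus_R wkb_angle (fun _ => wkb_angle a));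
               [apply is_derive_wkb_angle | apply @is_derive_const].
          -- instantiate (1 := - sin x / 2). auto_derive; [exact I | field].
        * apply (is_derive_minus_R wkb_area (fun _ => wkb_area a));
            [apply is_derive_wkb_area | apply @is_derive_const].
      + unfold zero; simpl. unfold wkb_angle. field.
    - intros x Hx. assert (0 <= sin x) by (apply sin_ge_0; lra).
      assert (Hs := sin_diff_le_cos a x ltac:(lra) ltac:(lra)).
      apply Rmult_le_pos; lra. }
  unfold h in H. lra.
Qed.

Lemma wkb_angle_0 : wkb_angle 0 = 0.
Proof. unfold wkb_angle. rewrite sin_0, cos_0. ring. Qed.

Lemma wkb_angle_PI2 : wkb_angle (PI / 2) = 1.
Proof. unfold wkb_angle. rewrite sin_PI2, cos_PI2. ring. Qed.

Lemma wkb_area_PI2 : wkb_area (PI / 2) = PI / 8.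
Proof. unfold wkb_area. rewrite sin_PI2, cos_PI2. field. Qed.

Lemma wkb_angle_surj v : 0 <= v <= 1 -> {t | 0 <= t <= PI / 2 /\ wkb_angle t = v}.
Proof.
  intro Hv. assert (HPI := PI_RGT_0).
  destruct (IVT_gen wkb_angle 0 (PI / 2) v) as [t [Ht E]].
  - intro x. apply continuity_pt_filterlim, (ex_derive_continuous wkb_angle).
    eexists. apply is_derive_wkb_angle.
  - rewrite wkb_angle_0, wkb_angle_PI2, Rmin_left, Rmax_right by lra. exact Hv.
  - exists t. rewrite Rmin_left, Rmax_right in Ht by lra. split; assumption.
Qed.

Lemma sin_cos_taylor t : 0 <= t <= 2 ->
  t - t ^ 3 / 6 + t ^ 5 / 120 - t ^ 7 / 5040 <= sin t
    <= t - t ^ 3 / 6 + t ^ 5 / 120 - t ^ 7 / 5040 + t ^ 9 / 362880 /\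
  1 - t ^ 2 / 2 + t ^ 4 / 24 - t ^ 6 / 720 <= cos t
    <= 1 - t ^ 2 / 2 + t ^ 4 / 24 - t ^ 6 / 720 + t ^ 8 / 40320 /\
  1 - t ^ 2 / 2 + t ^ 4 / 24 - t ^ 6 / 720 + t ^ 8 / 40320 - t ^ 10 / 3628800 <= cos t.
Proof.
  intro Ht.
  destruct (pre_sin_bound t 1 ltac:(lra) ltac:(lra)) as [S1 S2].
  destruct (pre_cos_bound t 1 ltac:(lra) ltac:(lra)) as [C1 C2].
  destruct (pre_cos_bound t 2 ltac:(lra) ltac:(lra)) as [C3 _].
  unfold sin_approx, sin_term, cos_approx, cos_term in *.
  cbn [sum_f_R0 Nat.mul Nat.add] in *.
  repeat rewrite fact_S_INR in *. change (fact 0) with 1%nat in *.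
  simpl INR in *.
  repeat split; lra.
Qed.

Lemma wkb_angle_taylor t : 0 <= t <= 2 ->
  t ^ 3 * (1 / 3 - t ^ 2 / 30 + t ^ 4 / 840 - t ^ 6 / 40320) <= wkb_angle t
  <= t ^ 3 * (1 / 3 - t ^ 2 / 30 + t ^ 4 / 840 - t ^ 6 / 45360 + t ^ 8 / 3628800).
Proof.
  intro Ht. unfold wkb_angle.
  destruct (sin_cos_taylor t Ht) as [[S1 S2] [[_ C2] C3]].
  apply (Rmult_le_compat_l t) in C2; [| lra]. apply (Rmult_le_compat_l t) in C3; [| lra].
  split; lra.
Qed.

Lemma wkb_area_double t : wkb_area t = wkb_angle (2 * t) / 8.
Proof. unfold wkb_area, wkb_angle. rewrite sin_2a, cos_2a_cos. field. Qed.

(** For t = phi 0 and mu = pi / (4 wkb_angle t) this is the inequality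
    mu / pi + 3/4 <= h_0 - 2 (mu^2 / pi) wkb_area t left at the end of the summation, multiplied by
    16 (wkb_angle t)^2.  The range is determined by the threshold: mu = 11.89 corresponds to t
    slightly below 0.59, and the expression changes sign near t = 0.5904. *)
Lemma wkb_first_point_bound t : 0 <= t <= 0.59 ->
  0 <= 4 * PI * wkb_angle t * cos t - 2 * PI * wkb_area t - 4 * wkb_angle t - 12 * wkb_angle t ^ 2.
Proof.
  intro Ht. destruct PI_bounds as [HP _].
  destruct (wkb_angle_taylor t ltac:(lra)) as [G1 G2].
  destruct (wkb_angle_taylor (2 * t) ltac:(lra)) as [_ A2].
  destruct (sin_cos_taylor t ltac:(lra)) as [_ [[C1 _] _]].
  rewrite wkb_area_double.
  assert (T3 : 0 <= t ^ 3) by (apply pow_le; lra).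
  set (gl := 1 / 3 - t ^ 2 / 30 + t ^ 4 / 840 - t ^ 6 / 40320) in *.
  set (gu := 1 / 3 - t ^ 2 / 30 + t ^ 4 / 840 - t ^ 6 / 45360 + t ^ 8 / 3628800) in *.
  set (cl := 1 - t ^ 2 / 2 + t ^ 4 / 24 - t ^ 6 / 720) in *.
  set (au := 1 / 3 - 4 * t ^ 2 / 30 + 16 * t ^ 4 / 840 - 64 * t ^ 6 / 45360 + 256 * t ^ 8 / 3628800).
  assert (A3 : wkb_angle (2 * t) / 8 <= t ^ 3 * au) by (unfold au; lra).
  assert (B2 : 0 <= t ^ 2 <= 0.3481) by nra.
  assert (B4 : 0 <= t ^ 4 <= 0.3481 * t ^ 2) by (replace (t ^ 4) with (t ^ 2 * t ^ 2) by ring; nra).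
  assert (B6 : 0 <= t ^ 6 <= 0.3481 * t ^ 4) by (replace (t ^ 6) with (t ^ 2 * t ^ 4) by ring; nra).
  assert (B8 : 0 <= t ^ 8 <= 0.3481 * t ^ 6) by (replace (t ^ 8) with (t ^ 2 * t ^ 6) by ring; nra).
  assert (Hgl : 0.31 <= gl <= 0.334) by (unfold gl; lra).
  assert (Hgu : 0.31 <= gu <= 0.334) by (unfold gu; lra).
  assert (Hcl : 0.8 <= cl <= 1) by (unfold cl; lra).
  assert (Hau : 0.28 <= au <= 0.334) by (unfold au; lra).
  assert (B3 : t ^ 3 <= 0.205379) by (replace (t ^ 3) with (t * t ^ 2) by ring; nra).
  set (w := wkb_angle t) in *. set (a := wkb_angle (2 * t) / 8) in *.
  assert (Hw : 0 <= w) by nra.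
  assert (Hw2 : w <= t ^ 3 * gu) by exact G2.
  assert (Hbr : 4 * PI * cl - 4 - 12 * (t ^ 3 * gu) >= 0) by nra.
  (* E1, E2, E3 put the Taylor bounds in one factor at a time; cos t and wkb_angle t are
     only replaced where their coefficients have a known sign *)
  assert (E1 : w * (4 * PI * cl - 4 - 12 * (t ^ 3 * gu))
               <= w * (4 * PI * cos t - 4 - 12 * w)).
  { apply Rmult_le_compat_l; [exact Hw |]. assert (PI * cl <= PI * cos t) by (apply Rmult_le_compat_l; lra). lra. }
  assert (E2 : t ^ 3 * gl * (4 * PI * cl - 4 - 12 * (t ^ 3 * gu))
               <= w * (4 * PI * cl - 4 - 12 * (t ^ 3 * gu))) by (apply Rmult_le_compat_r; lra).
  assert (E3 : 2 * PI * a <= 2 * PI * (t ^ 3 * au)) by (apply Rmult_le_compat_l; lra).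
  assert (E4 : 0 <= t ^ 3 * (gl * (4 * PI * cl - 4 - 12 * (t ^ 3 * gu)) - 2 * PI * au)).
  { apply Rmult_le_pos; [exact T3 |].
    assert (F1 : 0 <= 4 * gl * cl - 2 * au) by nra.
    assert (P3 : forall k, t ^ (3 + k) <= 0.59 ^ k * t ^ 3).
    { intro k. rewrite pow_add, Rmult_comm. apply Rmult_le_compat_r; [exact T3 |].
      apply pow_incr. exact Ht. }
    assert (N : forall k, 0 <= t ^ k) by (intro; apply pow_le; lra).
    (* tangent inequalities at t = 0.59, the point where the margin is smallest *)
    assert (Q4 : 0.6962 * t ^ 2 - 0.1211737 <= t ^ 4).
    { replace (t ^ 4) with (t ^ 2 * t ^ 2) by ring. nra. }
    assert (Q5 : 3 * t ^ 5 - 5 * 0.59 ^ 2 * t ^ 3 + 2 * 0.59 ^ 5 >= 0).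
    { replace (3 * t ^ 5 - 5 * 0.59 ^ 2 * t ^ 3 + 2 * 0.59 ^ 5)
        with ((t - 0.59) ^ 2 * (3 * t ^ 3 + 6 * 0.59 * t ^ 2 + 4 * 0.59 ^ 2 * t + 2 * 0.59 ^ 3)) by field.
      apply Rle_ge, Rmult_le_pos; [apply pow2_ge_0 | lra]. }
    assert (F2 : 0 <= 3.1415 * (4 * gl * cl - 2 * au) - gl * (4 + 12 * (t ^ 3 * gu))).
    { assert (Z6 := P3 3%nat). assert (Z7 := P3 4%nat). assert (Z10 := P3 7%nat).
      assert (Z11 := P3 8%nat). assert (Z15 := P3 12%nat).
      cbn [Nat.add] in Z6, Z7, Z10, Z11, Z15.
      assert (N8 := N 8%nat). assert (N9 := N 9%nat). assert (N12 := N 12%nat).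
      assert (N13 := N 13%nat). assert (N17 := N 17%nat).
      unfold gl, gu, cl, au. lra. }
    nra. }
  lra.
Qed.

(** * Summation over the levels *)

Lemma nat_below x : 0 < x -> exists n, INR n < x <= INR n + 1.
Proof.
  intro Hx. destruct (nfloor_ex x ltac:(lra)) as [n [H1 H2]].
  destruct (Req_dec (INR n) x) as [E | E]; [| exists n; lra].
  destruct n as [| n]; [simpl in E; lra |]. exists n. rewrite S_INR in *. lra.
Qed.

Lemma wkb_angle_lt a b : 0 < a < b -> b <= PI / 2 -> wkb_angle a < wkb_angle b.
Proof.
  intros Hab Hb. assert (HPI := PI_RGT_0).
  destruct (MVT_gen wkb_angle a b (fun t => t * sin t)) as [c [Hc Hc']].
  - intros; apply is_derive_wkb_angle.
  - intros. apply continuity_pt_filterlim, (ex_derive_continuous wkb_angle).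
    eexists. apply is_derive_wkb_angle.
  - rewrite Rmin_left, Rmax_right in Hc by lra.
    assert (0 < sin c) by (apply sin_gt_0; lra).
    assert (0 < c * sin c) by (apply Rmult_lt_0_compat; lra). nra.
Qed.

Lemma wkb_phase_angle m mu : 0 <= m < mu ->
  exists psi, 0 <= psi <= PI / 2 /\ cos psi = m / mu /\ wkb_phase m mu = mu * wkb_angle psi.
Proof.
  intro Hm. assert (HPI := PI_RGT_0).
  assert (Hr : 0 <= m / mu < 1).
  { split; [apply Rmult_le_pos; [lra | apply Rlt_le, Rinv_0_lt_compat; lra] |].
    apply (Rmult_lt_reg_r mu); [lra |]. unfold Rdiv. rewrite Rmult_assoc, Rinv_l; lra. }
  set (psi := acos (m / mu)). exists psi.
  assert (Hb : 0 <= psi <= PI) by apply acos_bound.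
  assert (Hc : cos psi = m / mu) by (apply cos_acos; lra).
  assert (Hb2 : psi <= PI / 2).
  { apply Rnot_lt_le. intro Hlt. assert (cos psi < 0) by (apply cos_lt_0; lra). lra. }
  assert (Hs : sqrt (mu ^ 2 - m ^ 2) = mu * sin psi).
  { assert (Hs0 : 0 <= sin psi) by (apply sin_ge_0; lra).
    rewrite <- (sqrt_pow2 (mu * sin psi)) by (apply Rmult_le_pos; lra). f_equal.
    assert (Hsc := sin2_cos2 psi). unfold Rsqr in Hsc. rewrite Hc in Hsc.
    replace ((mu * sin psi) ^ 2) with (mu ^ 2 * (sin psi * sin psi)) by ring.
    replace (sin psi * sin psi) with (1 - m / mu * (m / mu)) by lra. field. lra. }
  split; [lra |]. split; [exact Hc |].
  unfold wkb_phase, wkb_angle. rewrite Hs, Hc.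
  destruct (Req_dec m 0) as [E | E].
  - rewrite E. field. lra.
  - assert (Hlt : psi < PI / 2).
    { destruct (Req_dec psi (PI / 2)) as [E' | E']; [| lra].
      rewrite E', cos_PI2 in Hc. assert (0 < m / mu) by (apply Rdiv_lt_0_compat; lra). lra. }
    replace (mu * sin psi / m) with (tan psi).
    + rewrite atan_tan by lra. field. lra.
    + unfold tan. rewrite Hc. field. lra.
Qed.

(** m < mu cos t says that the order m has at mu a larger phase than the order
    mu cos t, whose phase is (n + 1/4) pi. *)
Lemma zero_count_below_height (m n : nat) (mu t : R) :
  0 < mu -> 0 < t <= PI / 2 -> mu * wkb_angle t = PI * (INR n + 1 / 4) ->
  INR m < mu * cos t ->
  exists s, zero_chain (neumann_char m) (S n) 0 mu s.
Proof.
  intros Hmu Ht Hg Hm. assert (HPI := PI_RGT_0). assert (Hm0 := pos_INR m).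
  assert (Hc1 := COS_bound t).
  assert (Hmmu : INR m < mu) by nra.
  destruct (wkb_phase_angle (INR m) mu (conj Hm0 Hmmu)) as [psi [Hpsi [Hc Hw]]].
  apply neumann_zero_count; [exact Hmmu |]. rewrite Hw.
  assert (Hlt : t < psi).
  { apply Rnot_le_lt. intro Hle. assert (cos t <= cos psi) by (apply cos_decr_1; lra).
    rewrite Hc in H. apply (Rmult_le_compat_l mu) in H; [| lra].
    replace (mu * (INR m / mu)) with (INR m) in H by (field; lra). lra. }
  assert (Hgl := wkb_angle_lt t psi ltac:(lra) ltac:(lra)). nra.
Qed.

(** phi n parametrises the point at level n + 1/4 of the curve of phases divided by pi. *)
Definition wkb_node (mu : R) (N : nat) (phi : nat -> R) : Prop :=
  forall n, (n <= N)%nat -> 0 < phi n <= PI / 2 /\ mu * wkb_angle (phi n) = PI * (INR n + 1 / 4).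

Lemma wkb_node_exists mu N :
  0 < mu -> PI * (INR N + 1 / 4) < mu -> exists phi, wkb_node mu N phi.
Proof.
  intros Hmu HN. assert (HPI := PI_RGT_0).
  assert (Hv : forall n, 0 <= Rmin 1 (PI * (INR n + 1 / 4) / mu) <= 1).
  { intro n. assert (Hn := pos_INR n). split; [| apply Rmin_l]. apply Rmin_glb; [lra |].
    apply Rmult_le_pos; [nra | apply Rlt_le, Rinv_0_lt_compat, Hmu]. }
  exists (fun n => proj1_sig (wkb_angle_surj _ (Hv n))).
  intros n Hn. destruct (wkb_angle_surj _ (Hv n)) as [t [Ht E]]. simpl.
  assert (Hn0 := pos_INR n). apply le_INR in Hn.
  assert (Hlt : PI * (INR n + 1 / 4) < mu) by nra.
  rewrite Rmin_right in E.
  - split; [| rewrite E; field; lra]. split; [| lra].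
    destruct (Req_dec t 0) as [Z | Z]; [| lra]. exfalso.
    rewrite Z, wkb_angle_0 in E.
    assert (0 < PI * (INR n + 1 / 4) / mu) by (apply Rdiv_lt_0_compat; nra). lra.
  - apply (Rmult_le_reg_r mu); [exact Hmu |]. unfold Rdiv at 1.
    rewrite Rmult_assoc, Rinv_l by lra. lra.
Qed.

Lemma wkb_node_mono mu N phi n :
  0 < mu -> wkb_node mu N phi -> (S n <= N)%nat -> phi n <= phi (S n).
Proof.
  intros Hmu H Hn. assert (HPI := PI_RGT_0).
  destruct (H n ltac:(lia)) as [H1 E1]. destruct (H (S n) Hn) as [H2 E2].
  rewrite S_INR in E2.
  apply Rnot_lt_le. intro Hlt.
  assert (Hg := wkb_angle_mono (phi (S n)) (phi n) ltac:(lra) ltac:(lra)). nra.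
Qed.

Lemma trapezoid_sum mu N phi : 0 < mu -> wkb_node mu N phi -> forall n, (n <= N)%nat ->
  mu ^ 2 / PI * (wkb_area (phi n) - wkb_area (phi 0%nat))
    + (mu * cos (phi 0%nat) + mu * cos (phi n)) / 2
  <= sum_f_R0 (fun n => mu * cos (phi n)) n.
Proof.
  intros Hmu H. assert (HPI := PI_RGT_0). induction n as [| n IH]; intro Hn.
  - simpl. lra.
  - specialize (IH ltac:(lia)). rewrite tech5.
    destruct (H n ltac:(lia)) as [H1 E1]. destruct (H (S n) Hn) as [H2 E2]. rewrite S_INR in E2.
    assert (Hmono := wkb_node_mono mu N phi n Hmu H Hn).
    assert (T := wkb_trapezoid (phi n) (phi (S n)) ltac:(lra) ltac:(lra)).
    replace (wkb_angle (phi (S n)) - wkb_angle (phi n)) with (PI / mu) in T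
      by (apply (Rmult_eq_reg_l mu); [field_simplify; lra | lra]).
    apply (Rmult_le_compat_l (mu ^ 2 / PI)) in T; [| apply Rlt_le, Rdiv_lt_0_compat; nra].
    replace (mu ^ 2 / PI * (PI / mu * ((cos (phi n) + cos (phi (S n))) / 2)))
      with ((mu * cos (phi n) + mu * cos (phi (S n))) / 2) in T by (field; lra).
    lra.
Qed.

(** With h n = mu cos (phi n), the trapezoid rule from level 1/4 to level N + 1/4
    and one more trapezoid up to the end mu / pi of the curve bound the area mu^2 / 8, except for
    the part below level 1/4, which is mu^2 / pi * wkb_area (phi 0).  The half weight of h N in the
    first rule compensates for the last trapezoid, and there remains the inequality of
    wkb_first_point_bound at phi 0. *)
Lemma lattice_sum_lower_bound mu N phi :
  11.89 <= mu -> INR N + 1 / 4 < mu / PI <= INR N + 5 / 4 -> wkb_node mu N phi ->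
  mu ^ 2 / 4 <= sum_f_R0 (fun n => 2 * (mu * cos (phi n)) - 1) N.
Proof.
  intros Hmu HN H. destruct PI_bounds as [HP1 HP2].
  assert (Hsum := trapezoid_sum mu N phi ltac:(lra) H N (Nat.le_refl _)).
  assert (Es : sum_f_R0 (fun n => 2 * (mu * cos (phi n)) - 1) N
               = 2 * sum_f_R0 (fun n => mu * cos (phi n)) N - (INR N + 1)).
  { clear. induction N as [| N IH]; [simpl; ring |]. rewrite !tech5, IH, S_INR. ring. }
  rewrite Es.
  destruct (H 0%nat ltac:(lia)) as [P0 G0]. destruct (H N ltac:(lia)) as [PN GN].
  simpl INR in G0.
  set (h0 := mu * cos (phi 0%nat)) in *. set (hN := mu * cos (phi N)) in *.
  set (a0 := wkb_area (phi 0%nat)) in *. set (aN := wkb_area (phi N)) in *.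
  assert (T := wkb_trapezoid (phi N) (PI / 2) ltac:(lra) ltac:(lra)). fold aN in T.
  rewrite wkb_angle_PI2, wkb_area_PI2, cos_PI2 in T.
  set (d := mu / PI - INR N - 1 / 4) in *.
  assert (Hd : 0 < d <= 1) by (unfold d; lra).
  assert (HhN : 0 <= hN) by (apply Rmult_le_pos; [lra | apply cos_ge_0; lra]).
  assert (Tl : mu ^ 2 / 8 - mu ^ 2 / PI * aN <= d * hN / 2).
  { apply (Rmult_le_compat_l (mu ^ 2 / PI)) in T; [| apply Rlt_le, Rdiv_lt_0_compat; nra].
    replace (mu ^ 2 / 8 - mu ^ 2 / PI * aN) with (mu ^ 2 / PI * (PI / 8 - aN)) by (field; lra).
    eapply Rle_trans; [exact T |]. apply Req_le. unfold d, hN.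
    replace (INR N) with (mu * wkb_angle (phi N) / PI - 1 / 4) by (rewrite GN; field; lra).
    field. lra. }
  assert (H59 : phi 0%nat <= 0.59).
  { apply Rnot_lt_le. intro Hlt.
    assert (Hg := wkb_angle_mono 0.59 (phi 0%nat) ltac:(lra) ltac:(lra)).
    destruct (wkb_angle_taylor 0.59 ltac:(lra)) as [Hl _].
    (* 0.0661 separates PI / (4 * 11.89) from wkb_angle 0.59 *)
    assert (Hx : 0.0661 <= wkb_angle (phi 0%nat)) by lra.
    assert (11.89 * wkb_angle (phi 0%nat) <= mu * wkb_angle (phi 0%nat))
      by (apply Rmult_le_compat_r; lra).
    lra. }
  assert (Hf := wkb_first_point_bound (phi 0%nat) ltac:(lra)). fold a0 in Hf.
  assert (Eg : wkb_angle (phi 0%nat) = PI / (4 * mu))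
    by (apply (Rmult_eq_reg_l mu); [rewrite G0; field; lra | lra]).
  rewrite Eg in Hf.
  assert (Hfirst : mu / PI + 3 / 4 <= h0 - 2 * (mu ^ 2 / PI * a0)).
  { apply (Rmult_le_compat_l (mu ^ 2 / PI ^ 2)) in Hf; [| apply Rlt_le, Rdiv_lt_0_compat; nra].
    rewrite Rmult_0_r in Hf.
    replace (mu ^ 2 / PI ^ 2 * (4 * PI * (PI / (4 * mu)) * cos (phi 0%nat) - 2 * PI * a0
               - 4 * (PI / (4 * mu)) - 12 * (PI / (4 * mu)) ^ 2))
      with (h0 - 2 * (mu ^ 2 / PI * a0) - mu / PI - 3 / 4) in Hf
      by (unfold h0; field; lra).
    lra. }
  assert (INR N + 1 = mu / PI + 3 / 4 - d) by (unfold d; lra).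
  nra.
Qed.

Lemma zero_list (P : nat) (k : nat -> nat) (mu : R) :
  (forall p, (p <= P)%nat -> exists s, zero_chain (neumann_char (angular_order p)) (k p) 0 mu s) ->
  exists E : list (nat * R), NoDup E /\
    (forall p s, In (p, s) E -> (p <= P)%nat /\ 0 <= s <= mu /\ neumann_char (angular_order p) s = 0) /\
    INR (length E) = sum_f_R0 (fun p => INR (k p)) P.
Proof.
  intro H.
  assert (Hone : forall p, (p <= P)%nat -> exists E : list (nat * R), NoDup E /\
    (forall q s, In (q, s) E -> q = p /\ 0 <= s <= mu /\ neumann_char (angular_order p) s = 0) /\
    length E = k p).
  { intros p Hp. destruct (H p Hp) as [s Hs].
    exists (map (fun i => (p, s i)) (seq 0 (k p))).
    split; [| split].
    - apply NoDup_map_inj_in; [| apply seq_NoDup].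
      intros i j Hi Hj E. apply in_seq in Hi, Hj. inversion E as [E'].
      assert (Hlt : forall i j, (i < j)%nat -> (j < k p)%nat -> s i < s j).
      { intros u v Huv Hv. assert (A := zero_chain_mono _ _ _ _ _ (S u) v Hs ltac:(lia) Hv).
        assert (B := proj2 Hs u ltac:(lia)). lra. }
      destruct (Nat.lt_trichotomy i j) as [L | [L | L]]; [| exact L |].
      + specialize (Hlt i j L ltac:(lia)). lra.
      + specialize (Hlt j i L ltac:(lia)). lra.
    - intros q t Hin. apply in_map_iff in Hin. destruct Hin as [i [Ei Hi]]. inversion Ei; subst.
      apply in_seq in Hi. destruct (proj1 Hs i ltac:(lia)) as [A B]. auto.
    - rewrite length_map, length_seq. reflexivity. }
  induction P as [| P IH].
  - destruct (Hone 0%nat (Nat.le_refl _)) as [E [E1 [E2 E3]]]. exists E.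
    split; [exact E1 |]. split; [| simpl; rewrite E3; reflexivity].
    intros p s Hin. destruct (E2 p s Hin) as [-> X]. split; [lia | exact X].
  - destruct IH as [E [E1 [E2 E3]]]; [intros; apply H; lia | intros; apply Hone; lia |].
    destruct (Hone (S P) (Nat.le_refl _)) as [E' [E1' [E2' E3']]].
    exists (E ++ E'). split; [| split].
    + apply NoDup_app; [exact E1 | exact E1' |].
      intros [p s] Hin Hin'. destruct (E2 p s Hin) as [X _]. destruct (E2' p s Hin') as [Y _]. lia.
    + intros p s Hin. apply in_app_or in Hin. destruct Hin as [Hin | Hin].
      * destruct (E2 p s Hin). split; [lia | assumption].
      * destruct (E2' p s Hin) as [-> X]. split; [lia | exact X].
    + rewrite length_app, plus_INR, E3, E3', tech5. reflexivity.
Qed.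

Definition below (m : nat) (h : R) : R := if Rlt_dec (INR m) h then 1 else 0.

Definition count_below (h : nat -> R) (N m : nat) : nat :=
  length (filter (fun n => if Rlt_dec (INR m) (h n) then true else false) (seq 0 (S N))).

Lemma INR_count_below h N m : INR (count_below h N m) = sum_f_R0 (fun n => below m (h n)) N.
Proof.
  unfold count_below. induction N as [| N IH].
  - simpl. unfold below. destruct (Rlt_dec (INR m) (h 0%nat)); simpl; reflexivity.
  - rewrite seq_S, filter_app, length_app, plus_INR, IH, tech5. f_equal.
    simpl. unfold below. destruct (Rlt_dec (INR m) (h (S N))); simpl; reflexivity.
Qed.

Lemma count_below_witness h N m k :
  count_below h N m = S k -> exists n, (k <= n <= N)%nat /\ INR m < h n.
Proof.
  unfold count_below. intro E.
  set (l := filter (fun n => if Rlt_dec (INR m) (h n) then true else false) (seq 0 (S N))) in *.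
  assert (Hl : NoDup l) by apply NoDup_filter, seq_NoDup.
  destruct (Classical_Prop.classic (incl l (seq 0 k))) as [Hi | Hi].
  - apply NoDup_incl_length in Hi; [| exact Hl]. rewrite length_seq in Hi. lia.
  - apply Classical_Pred_Type.not_all_ex_not in Hi. destruct Hi as [n Hn].
    apply Classical_Prop.imply_to_and in Hn. destruct Hn as [Hn Hk].
    apply filter_In in Hn. destruct Hn as [Hn Hlt]. rewrite in_seq in Hn, Hk.
    exists n. split; [lia |]. destruct (Rlt_dec (INR m) (h n)); [assumption | discriminate].
Qed.

(** angular_order takes the value 0 once and every other value twice, so the sum is the
    number of integers in the open interval from - h to h. *)
Lemma sum_below_ge (h : R) (P : nat) : 0 < h -> h <= INR P + 1 ->
  2 * h - 1 <= sum_f_R0 (fun p => below (angular_order p) h) (2 * P).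
Proof.
  intros Hh HP. destruct (nat_below h Hh) as [T [HT1 HT2]].
  assert (HTP : (T <= P)%nat) by (apply INR_le; assert (INR T < INR P + 1) by lra;
     rewrite <- S_INR in H; apply INR_lt in H; apply le_INR; lia).
  assert (Hsum : forall Q n, (n <= Q)%nat -> (n <= 2 * T)%nat ->
     INR n + 1 <= sum_f_R0 (fun p => below (angular_order p) h) Q).
  { assert (Hone : forall p, (p <= 2 * T)%nat -> below (angular_order p) h = 1).
    { intros p Hp. unfold below. destruct (Rlt_dec (INR (angular_order p)) h) as [L | L]; [reflexivity |].
      elim L. apply Rle_lt_trans with (INR T); [| exact HT1]. apply le_INR.
      unfold angular_order. assert (X := Nat.div2_odd (S p)).
      destruct (Nat.odd (S p)); simpl Nat.b2n in X; lia. }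
    assert (Hpos : forall p, 0 <= below (angular_order p) h)
      by (intro p; unfold below; destruct (Rlt_dec (INR (angular_order p)) h); lra).
    induction Q as [| Q IH]; intros n Hn HnT.
    - replace n with 0%nat by lia. simpl. rewrite (Hone 0%nat) by lia. lra.
    - rewrite tech5. destruct (Nat.eq_dec n (S Q)) as [-> | Hne].
      + rewrite (Hone (S Q) HnT). specialize (IH Q ltac:(lia) ltac:(lia)). rewrite S_INR. lra.
      + specialize (IH n ltac:(lia) HnT). specialize (Hpos (S Q)). lra. }
  specialize (Hsum (2 * P)%nat (2 * T)%nat ltac:(lia) ltac:(lia)).
  rewrite mult_INR in Hsum. simpl (INR 2) in Hsum. lra.
Qed.

Theorem theorem1p4 (mu : R) (hmu : 11.89 <= mu) :
  Rbar_le (Finite (mu ^ 2 / 4)) (neumann_counting mu).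
Proof.
  destruct PI_bounds as [HP1 HP2].
  assert (Hpi : 1 / 4 < mu / PI).
  { apply (Rmult_lt_reg_r PI); [lra |]. unfold Rdiv at 2. rewrite Rmult_assoc, Rinv_l; lra. }
  destruct (nat_below (mu / PI - 1 / 4) ltac:(lra)) as [N HN].
  assert (HNmu : PI * (INR N + 1 / 4) < mu).
  { apply (Rmult_lt_reg_r (/ PI)); [apply Rinv_0_lt_compat; lra |].
    replace (PI * (INR N + 1 / 4) * / PI) with (INR N + 1 / 4) by (field; lra).
    unfold Rdiv in HN. lra. }
  destruct (wkb_node_exists mu N ltac:(lra) HNmu) as [phi Hphi].
  set (h := fun n => mu * cos (phi n)).
  destruct (nfloor_ex mu ltac:(lra)) as [M HM].
  destruct (zero_list (2 * M) (fun p => count_below h N (angular_order p)) mu) as [E [E1 [E2 E3]]].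
  { intros p _. destruct (count_below h N (angular_order p)) as [| k] eqn:Hk.
    - exists (fun _ => 0). split; intros; lia.
    - destruct (count_below_witness _ _ _ _ Hk) as [n [Hn Hlt]].
      destruct (Hphi n ltac:(lia)) as [Hp Hg].
      destruct (zero_count_below_height _ n mu (phi n) ltac:(lra) Hp Hg Hlt) as [s [Hs1 Hs2]].
      exists s. split; intros; [apply Hs1 | apply Hs2]; lia. }
  apply Rbar_le_trans with (INR (length E)).
  - simpl. rewrite E3.
    rewrite (sum_eq _ (fun p => sum_f_R0 (fun n => below (angular_order p) (h n)) N))
      by (intros; apply INR_count_below).
    rewrite sum_f_R0_exchange.
    eapply Rle_trans; [apply (lattice_sum_lower_bound mu N phi hmu); [lra | exact Hphi] |].
    apply sum_Rle. intros n Hn. fold (h n).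
    destruct (Hphi n Hn) as [Hp Hg].
    assert (Hc := COS_bound (phi n)).
    destruct (Rle_lt_or_eq_dec 0 (h n)) as [Hpos | Hzero].
    + apply Rmult_le_pos; [lra | apply cos_ge_0; lra].
    + apply sum_below_ge; [exact Hpos |]. unfold h. nra.
    + rewrite <- Hzero. apply Rle_trans with 0; [lra |]. apply cond_pos_sum.
      intro p. unfold below. destruct (Rlt_dec (INR (angular_order p)) 0); lra.
  - apply neumann_counting_ge; [exact E1 |]. intros p s Hin. apply (E2 p s Hin).
Qed.
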